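(* Let $m\in\mathbb{R}$ and $\sigma\in M^{m}_{\rho,\Lambda}(\mathbb{Z}^n\times\mathbb{T}^n)$. Then the adjoint $T_\sigma^*$ of $T_\sigma$ is a pseudo-differential operator $T_{\sigma^*}$ with symbol $\sigma^*\in M^{m}_{\rho,\Lambda}(\mathbb{Z}^n\times\mathbb{T}^n)$ having the asymptotic expansion $$\sigma^*(k,x)\sim\sum_{\alpha\ge0}\frac{1}{\alpha!}\Delta_k^\alpha D_x^{(\alpha)}\overline{\sigma(k,x)},$$ meaning that for every $N\in\mathbb{N}$, $$\sigma^*(k,x)-\sum_{|\alpha|<N}\frac{1}{\alpha!}\Delta_k^\alpha D_x^{(\alpha)}\overline{\sigma(k,x)}\in M^{m-\rho N}_{\rho,\Lambda}(\mathbb{Z}^n\times\mathbb{T}^n).$$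
   Context: Write $\mathbb{T}^n=\mathbb{R}^n/\mathbb{Z}^n$ and $\mathbb{N}_0=\{0,1,2,\dots\}$. For $f$ on $\mathbb{Z}^n$ set $\Delta_{k_j}f(k)=f(k+e_j)-f(k)$ ($e_j$ the $j$-th unit vector) and $\Delta_k^\alpha=\Delta_{k_1}^{\alpha_1}\cdots\Delta_{k_n}^{\alpha_n}$ for $\alpha\in\mathbb{N}_0^n$. On smooth functions on $\mathbb{T}^n$ set $D_x^{(\beta)}=D_{x_1}^{(\beta_1)}\cdots D_{x_n}^{(\beta_n)}$, where $D_{x_j}^{(0)}=I$ and $D_{x_j}^{(\ell)}=\prod_{m=0}^{\ell-1}\big(\frac{1}{2\pi i}\frac{\partial}{\partial x_j}-m\big)$ for $\ell\ge1$. Write $k^\gamma=k_1^{\gamma_1}\cdots k_n^{\gamma_n}$. Weight function: $\Lambda:\mathbb{Z}^n\to(0,\infty)$ is a weight function if there are positive constants $\mu_0\le\mu_1\le\mu$ and $C_0,C_1$ with $C_0(1+|k|)^{\mu_0}\le\Lambda(k)\le C_1(1+|k|)^{\mu_1}$ for all $k\in\mathbb{Z}^n$, and for all $\alpha\in\mathbb{N}_0^n$, $\gamma\in\{0,1\}^n$ there is $C_{\alpha,\gamma}>0$ with $|k^\gamma\Delta_k^{\alpha+\gamma}\Lambda(k)|\le C_{\alpha,\gamma}\Lambda(k)^{1-|\alpha|/\mu}$ for all $k\in\mathbb{Z}^n$. Fix such a $\Lambda$ (with its constants) and $\rho\in(0,1/\mu]$. Symbol classes: for $m\in\mathbb{R}$,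 $S^m_{\rho,\Lambda}(\mathbb{Z}^n\times\mathbb{T}^n)$ is the set of $\sigma:\mathbb{Z}^n\times\mathbb{T}^n\to\mathbb{C}$, smooth in $x$ for every $k$, such that for all $\alpha,\beta\in\mathbb{N}_0^n$ there is a constant $C>0$ with $|D_x^{(\beta)}\Delta_k^\alpha\sigma(k,x)|\le C\Lambda(k)^{m-\rho|\alpha|}$ for all $(k,x)$. $M^m_{\rho,\Lambda}(\mathbb{Z}^n\times\mathbb{T}^n)$ is the set of $\sigma:\mathbb{Z}^n\times\mathbb{T}^n\to\mathbb{C}$, smooth in $x$ for every $k$, such that $k^\gamma\Delta_k^\gamma\sigma(k,x)\in S^m_{\rho,\Lambda}(\mathbb{Z}^n\times\mathbb{T}^n)$ for all $\gamma\in\{0,1\}^n$. Operators: $\mathcal{S}(\mathbb{Z}^n)$ is the space of rapidly decreasing functions on $\mathbb{Z}^n$. For $f\in\mathcal{S}(\mathbb{Z}^n)$ put $\widehat f(x)=\sum_{k\in\mathbb{Z}^n}e^{-2\pi i k\cdot x}f(k)$ and $T_\sigma f(k)=\int_{\mathbb{T}^n}e^{2\pi i k\cdot x}\sigma(k,x)\widehat f(x)\,dx$. The adjoint $T_\sigma^*$ is the operator on $\mathcal{S}(\mathbb{Z}^n)$ determined by $\langle T_\sigma f,g\rangle_{\ell^2(\mathbb{Z}^n)}=\langle f,T_\sigma^*g\rangle_{\ell^2(\mathbb{Z}^n)}$ for $f,g\in\mathcal{S}(\mathbb{Z}^n)$, with $\langle f,g\rangle_{\ell^2}=\sum_k f(k)\overline{g(k)}$.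 *)

(* Defs.v *)
From HB Require Import structures.
From mathcomp Require Import all_boot all_order all_algebra.
From mathcomp Require Import all_classical all_reals all_analysis.
From mathcomp Require Export complex.

Set Implicit Arguments.
Unset Strict Implicit.
Unset Printing Implicit Defensive.

Import Order.TTheory GRing.Theory Num.Theory.
Import numFieldNormedType.Exports.

Local Open Scope classical_set_scope.
Local Open Scope ring_scope.
Local Open Scope complex_scope.

(** Z^n is ['rV[int]_n], C is [R[i]], and functions on the torus R^n/Z^n are
    the Z^n-periodic functions on ['rV[R]_n].  A multi-index is a function
    ['I_n -> nat]; elements of {0,1}^n are functions ['I_n -> bool], booleans
    being read as 0 and 1.  A bound [`|z| <= c%:C] between complex numbers is
    the real inequality |z| <= c. *)

Section Lattice.
Variables (R : realType) (n : nat).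
Implicit Types (k : 'rV[int]_n) (x : 'rV[R]_n).

Definition mlen (a : 'I_n -> nat) : nat := (\sum_j a j)%N.

Definition mfact (a : 'I_n -> nat) : nat := (\prod_j (a j)`!)%N.

Definition enorm k : R := Num.sqrt (\sum_j (k 0 j)%:~R ^+ 2).

Definition mpow (K : pzRingType) k (a : 'I_n -> nat) : K :=
  \prod_j (k 0 j)%:~R ^+ a j.

Definition dot k x : R := \sum_j (k 0 j)%:~R * x 0 j.

Section Differences.
Variable V : zmodType.

Definition diff1 (j : 'I_n) (f : 'rV[int]_n -> V) : 'rV[int]_n -> V :=
  fun k => f (k + delta_mx 0 j) - f k.

Definition mdiff (a : 'I_n -> nat) (f : 'rV[int]_n -> V) : 'rV[int]_n -> V :=
  foldr (fun j g => iter (a j) (diff1 j) g) f (enum 'I_n).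

End Differences.

Definition weight_function (mu : R) (Lam : 'rV[int]_n -> R) : Prop :=
  (forall k, 0 < Lam k) /\
  (exists mu0 mu1 C0 C1 : R,
    [/\ [/\ 0 < mu0, mu0 <= mu1 & mu1 <= mu],
        0 < C0, 0 < C1 &
        forall k, C0 * (1 + enorm k) `^ mu0 <= Lam k /\
                  Lam k <= C1 * (1 + enorm k) `^ mu1]) /\
  (forall (a : 'I_n -> nat) (g : 'I_n -> bool),
    exists2 C : R, 0 < C &
      forall k, `|mpow R k g * mdiff (fun j => (a j + g j)%N) Lam k|
                <= C * Lam k `^ (1 - (mlen a)%:R / mu)).

Definition rapidly_decreasing (f : 'rV[int]_n -> R[i]) : Prop :=
  forall N : nat, exists C : R,
    forall k, `|f k| <= (C * (1 + enorm k) ^- N)%:C.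

(** Unordered sum of an absolutely summable family over Z^n. *)
Definition rsum (f : 'rV[int]_n -> R) : R :=
  fine (esum setT (EFin \o f)^\+%E) - fine (esum setT (EFin \o f)^\-%E).

Definition csum (f : 'rV[int]_n -> R[i]) : R[i] :=
  rsum (fun k => complex.Re (f k)) +i* rsum (fun k => complex.Im (f k)).

Definition inner (f g : 'rV[int]_n -> R[i]) : R[i] :=
  csum (fun k => f k * (g k)^*).

Definition is_adjoint
    (A B : ('rV[int]_n -> R[i]) -> 'rV[int]_n -> R[i]) : Prop :=
  (forall g, rapidly_decreasing g -> rapidly_decreasing (B g)) /\
  (forall f g, rapidly_decreasing f -> rapidly_decreasing g ->
    inner (A f) g = inner f (B g)).

End Lattice.

Section Torus.
Variables (R : realType) (n : nat).
Implicit Types (u : 'rV[R]_n -> R) (f : 'rV[R]_n -> R[i]).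

Definition periodic f : Prop :=
  forall x (l : 'rV[int]_n), f (x + map_mx intr l) = f x.

Definition partial (j : 'I_n) u : 'rV[R]_n -> R :=
  fun x => 'D_(delta_mx 0 j) u x.

Definition smooth_real u : Prop :=
  forall s : seq 'I_n,
    continuous (foldr partial u s) /\
    (forall j x, derivable (foldr partial u s) x (delta_mx 0 j)).

Definition smooth f : Prop :=
  smooth_real (fun x => complex.Re (f x)) /\ smooth_real (fun x => complex.Im (f x)).

Definition cpartial (j : 'I_n) f : 'rV[R]_n -> R[i] :=
  fun x => partial j (fun y => complex.Re (f y)) x +i* partial j (fun y => complex.Im (f y)) x.

(** [falling_deriv j l] is the product over m < l of
    (2 pi i)^-1 d/dx_j - m. *)
Fixpoint falling_deriv (j : 'I_n) (l : nat) f : 'rV[R]_n -> R[i] :=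
  if l is l'.+1 then
    fun x => (0 +i* (2 * pi))^-1 * cpartial j (falling_deriv j l' f) x
             - l'%:R * falling_deriv j l' f x
  else f.

Definition mfalling_deriv (b : 'I_n -> nat) f : 'rV[R]_n -> R[i] :=
  foldr (fun j g => falling_deriv j (b j) g) f (enum 'I_n).

End Torus.

(** Iterated integral over [0,1]^n, which for continuous functions is the
    integral for the n-dimensional Lebesgue measure, by Fubini's theorem. *)
Fixpoint cube_integral (R : realType) (n : nat) : ('rV[R]_n -> R) -> R :=
  match n return ('rV[R]_n -> R) -> R with
  | 0 => fun u => u 0
  | n'.+1 => fun u =>
      \int[lebesgue_measure]_(t in `[0, 1])
        cube_integral (fun y : 'rV[R]_n' => u (row_mx (t%:M : 'rV[R]_1) y))
  end.

Section PseudoDifferential.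
Variables (R : realType) (n : nat).
Implicit Types (f : 'rV[int]_n -> R[i]) (s : 'rV[int]_n -> 'rV[R]_n -> R[i]).

Definition torus_integral (h : 'rV[R]_n -> R[i]) : R[i] :=
  cube_integral (fun x => complex.Re (h x)) +i* cube_integral (fun x => complex.Im (h x)).

(** [cexp2pi t] is exp (2 pi i t). *)
Definition cexp2pi (t : R) : R[i] := cos (2 * pi * t) +i* sin (2 * pi * t).

Definition fourier f (x : 'rV[R]_n) : R[i] :=
  csum (fun k => cexp2pi (- dot k x) * f k).

Definition pdo s f : 'rV[int]_n -> R[i] :=
  fun k => torus_integral (fun x => cexp2pi (dot k x) * s k x * fourier f x).

Definition smooth_symbol s : Prop := forall k, periodic (s k) /\ smooth (s k).

Definition symbol_diff (a : 'I_n -> nat) s : 'rV[int]_n -> 'rV[R]_n -> R[i] :=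
  fun k x => mdiff a (fun l => s l x) k.

Definition symbol_deriv (b : 'I_n -> nat) s : 'rV[int]_n -> 'rV[R]_n -> R[i] :=
  fun k => mfalling_deriv b (s k).

Definition symbol_conj s : 'rV[int]_n -> 'rV[R]_n -> R[i] :=
  fun k x => (s k x)^*.

Definition symbol_S (rho : R) (Lam : 'rV[int]_n -> R) (m : R) s : Prop :=
  smooth_symbol s /\
  forall a b : 'I_n -> nat, exists2 C : R, 0 < C &
    forall k x, `|symbol_deriv b (symbol_diff a s) k x|
                <= (C * Lam k `^ (m - rho * (mlen a)%:R))%:C.

Definition symbol_M (rho : R) (Lam : 'rV[int]_n -> R) (m : R) s : Prop :=
  smooth_symbol s /\
  forall g : 'I_n -> bool,
    symbol_S rho Lam m (fun k x => mpow R[i] k g * symbol_diff g s k x).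

(** The multi-indices with all entries < N, among which are all those of
    length < N. *)
Definition box_index (N : nat) (a : {ffun 'I_n -> 'I_N}) : 'I_n -> nat :=
  fun j => a j.

Definition adjoint_expansion (N : nat) s : 'rV[int]_n -> 'rV[R]_n -> R[i] :=
  fun k x =>
    \sum_(a : {ffun 'I_n -> 'I_N} | (mlen (box_index a) < N)%N)
      (mfact (box_index a))%:R^-1
      * symbol_diff (box_index a)
          (symbol_deriv (box_index a) (symbol_conj s)) k x.

End PseudoDifferential.

(* Main.v *)
Require Import Defs.
From mathcomp Require Import all_boot all_order all_algebra.
From mathcomp Require Import all_classical all_reals all_analysis.
From mathcomp Require Import ring lra zify.
Import Order.TTheory GRing.Theory Num.Theory.
Import numFieldNormedType.Exports.

Set Implicit Arguments.
Unset Strict Implicit.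
Unset Printing Implicit Defensive.

Local Open Scope classical_set_scope.
Local Open Scope ring_scope.
Local Open Scope complex_scope.

(** The theorem is proved on the Fourier side in [x], where it becomes a statement
    of discrete calculus in [k].

    Let [hat sigma p k] be the [p]-th Fourier coefficient of [sigma k]. The matrix
    of [pdo sigma] has the entries [hat sigma (l - k) k] ([pdo_synth]), and the
    matrix of the adjoint is its conjugate transpose. With [t p k], the conjugate
    of [hat sigma (- p) k], which is the [p]-th coefficient of the conjugate
    symbol, the adjoint is therefore the operator of the symbol whose [p]-th
    Fourier coefficient is [t p (k + p)] ([adjoint_symbol], [is_adjoint_symbol]).
    Newton's forward difference formula expands this shift by [p] as the sum over
    the multi-indices [a] of the binomial coefficient of [p] over [a] times
    [Delta^a t p k]. Since the falling factorials of [p] are the eigenvalues of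
    the falling derivatives on the exponentials, the terms of this formula are
    the Fourier coefficients of the terms of the asymptotic expansion
    ([adjoint_remainder]), and what remains is to show that Newton's remainder
    belongs to the right class.

    The symbol classes S and M correspond to classes [Scl] and [Mcl] of families
    that are symbols in [k] with rapid decay in [p], uniformly ([Mcl_hat],
    [symbol_M_synth]). One direction is integration by parts, with the remark
    that bounds against all falling factorials of [p] give rapid decay
    ([falling_decay]); the other one is termwise differentiation. The class
    [Mcl] is closed under differences, with a gain of [rho] in the order, and
    under shifts by [q] of size at most that of [p] ([Mcl_shift_diff]). For the
    shifts this is Peetre's inequality ([Lam_peetre]): a root of the weight is
    Lipschitz on the lattice, so that the weight changes at most by a power of
    [1 + |q|], which the rapid decay in [p] absorbs. Newton's remainder of order
    [N.+1] is a sum, along a lattice path from 0 to [p], of remainders of order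
    [N] of first differences of [t] ([taylor_rem_step]). Each step of the
    induction thus gains [rho] and loses a factor [|p|], which costs nothing
    ([Mcl_taylor_rem]).

    The transfer between both sides rests on Fourier inversion for smooth
    periodic functions in several variables ([fourier_inversion]). A continuous
    periodic function with vanishing Fourier coefficients is 0, by Fejer's
    positive kernel in one variable ([fourier_uniqueness1]) and by induction on
    the dimension through partial Fourier coefficients ([fourier_uniqueness]).
    The sums over the lattice are handled by comparison with sums over boxes,
    uniformly for all families below a fixed summable weight ([csum_box]); the
    iterated integral over the cube is additive, monotone and continuous in
    parameters on continuous functions ([cube_lawsP]), and it annihilates the
    partial derivatives of periodic functions ([cube_integral_partial]). *)

(** * The modulus of a complex number *)

(** The modulus as a real number, whereas the norm of [R[i]] has values in
    [R[i]]. *)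
Notation nm := Normc.normc.

Section Modulus.
Variable R : realType.
Implicit Types (z : R[i]) (r : R).

Lemma normE z : `|z| = (nm z)%:C.
Proof. by []. Qed.

Lemma nm_ge0 z : 0 <= nm z.
Proof. by case: z => a b; exact: sqrtr_ge0. Qed.

Lemma nm0 : nm (0 : R[i]) = 0. Proof. exact: Normc.normc0. Qed.
Lemma nm1 : nm (1 : R[i]) = 1. Proof. exact: Normc.normc1. Qed.
Lemma nmM z1 z2 : nm (z1 * z2) = nm z1 * nm z2.
Proof. exact: Normc.normcM. Qed.
Lemma nmN z : nm (- z) = nm z. Proof. by case: z => a b /=; rewrite !sqrrN. Qed.
Lemma nmJ z : nm (z^*) = nm z. Proof. by case: z => a b /=; rewrite sqrrN. Qed.

Lemma nmD z1 z2 : nm (z1 + z2) <= nm z1 + nm z2.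
Proof.
have := ler_normD z1 z2.
by rewrite !normE -rmorphD /= lecR.
Qed.

Lemma nmB z1 z2 : nm (z1 - z2) <= nm z1 + nm z2.
Proof. by rewrite -(nmN z2); exact: nmD. Qed.

Lemma nm_distC z1 z2 : nm (z1 - z2) = nm (z2 - z1).
Proof. by rewrite -nmN opprB. Qed.

Lemma nm_sum (I : Type) (s : seq I) (F : I -> R[i]) :
  nm (\sum_(i <- s) F i) <= \sum_(i <- s) nm (F i).
Proof.
elim: s => [|i s IH]; first by rewrite !big_nil nm0.
by rewrite !big_cons (le_trans (nmD _ _))// lerD2l.
Qed.

Lemma nm_Re z : `|complex.Re z| <= nm z.
Proof.
case: z => a b /=; rewrite -sqrtr_sqr ler_sqrt ?addr_ge0 ?sqr_ge0//.
by rewrite lerDl sqr_ge0.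
Qed.

Lemma nm_Im z : `|complex.Im z| <= nm z.
Proof.
case: z => a b /=; rewrite -sqrtr_sqr ler_sqrt ?addr_ge0 ?sqr_ge0//.
by rewrite lerDr sqr_ge0.
Qed.

Lemma nm_real r : nm (r%:C) = `|r|.
Proof. by rewrite /= expr0n /= addr0 sqrtr_sqr. Qed.

Lemma nm_le_ReIm z : nm z <= `|complex.Re z| + `|complex.Im z|.
Proof.
case: z => a b.
have -> : a +i* b = a%:C + (0 +i* b) by simpc.
apply: (le_trans (nmD _ _)); rewrite nm_real /= add0r addr0.
by rewrite expr0n /= add0r sqrtr_sqr.
Qed.

Lemma nm_nat k : nm (k%:R : R[i]) = k%:R.
Proof. by rewrite -[k%:R](rmorph_nat (real_complex R)) nm_real ger0_norm. Qed.

Lemma nm_int (k : int) : nm (k%:~R : R[i]) = `|k|%N%:R.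
Proof.
by rewrite -[k%:~R](rmorph_int (real_complex R)) nm_real -intr_norm; case: k.
Qed.

Lemma nm_eq0 z : nm z <= 0 -> z = 0.
Proof.
by move=> h; apply: Normc.eq0_normc; apply/eqP; rewrite eq_le h nm_ge0.
Qed.

(** Identities between lattice sums and integrals are obtained by comparing
    both sides with finite sums, up to errors proportional to [e]. *)
Lemma eq_small (C : R) z1 z2 :
  (forall e, 0 < e -> nm (z1 - z2) <= C * e) -> z1 = z2.
Proof.
move=> h; apply/eqP; rewrite -subr_eq0; apply/eqP/nm_eq0.
have C1 : 0 < `|C| + 1 by rewrite ltr_wpDl.
apply/ler_addgt0Pl => e e0; rewrite addr0.
have := h (e / (`|C| + 1)) (divr_gt0 e0 C1) => /le_trans; apply.
rewrite mulrCA ger_pMr// ler_pdivrMr// mul1r.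
by rewrite (le_trans (ler_norm C))// lerDl.
Qed.

Lemma complex_eq z1 z2 : complex.Re z1 = complex.Re z2 ->
  complex.Im z1 = complex.Im z2 -> z1 = z2.
Proof. by case: z1 z2 => a b [c d] /= -> ->. Qed.

Lemma cReD z1 z2 : complex.Re (z1 + z2) = complex.Re z1 + complex.Re z2.
Proof. by case: z1 z2 => ? ? [? ?]. Qed.
Lemma cImD z1 z2 : complex.Im (z1 + z2) = complex.Im z1 + complex.Im z2.
Proof. by case: z1 z2 => ? ? [? ?]. Qed.
Lemma cReN z : complex.Re (- z) = - complex.Re z. Proof. by case: z. Qed.
Lemma cImN z : complex.Im (- z) = - complex.Im z. Proof. by case: z. Qed.
Lemma cReM z1 z2 : complex.Re (z1 * z2) =
  complex.Re z1 * complex.Re z2 - complex.Im z1 * complex.Im z2.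
Proof. by case: z1 z2 => ? ? [? ?]. Qed.
Lemma cImM z1 z2 : complex.Im (z1 * z2) =
  complex.Re z1 * complex.Im z2 + complex.Im z1 * complex.Re z2.
Proof. by case: z1 z2 => ? ? [? ?]. Qed.
Lemma cReJ z : complex.Re (z^*) = complex.Re z. Proof. by case: z. Qed.
Lemma cImJ z : complex.Im (z^*) = - complex.Im z. Proof. by case: z. Qed.
Lemma cRe_sum (I : Type) (s : seq I) (F : I -> R[i]) :
  complex.Re (\sum_(i <- s) F i) = \sum_(i <- s) complex.Re (F i).
Proof. by elim: s => [|i s IH]; rewrite ?big_nil// !big_cons cReD IH. Qed.
Lemma cIm_sum (I : Type) (s : seq I) (F : I -> R[i]) :
  complex.Im (\sum_(i <- s) F i) = \sum_(i <- s) complex.Im (F i).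
Proof. by elim: s => [|i s IH]; rewrite ?big_nil// !big_cons cImD IH. Qed.

End Modulus.

Lemma ler_sum_subset (R : numDomainType) (T : eqType) (s s' : seq T)
    (F : T -> R) : uniq s -> uniq s' -> {subset s <= s'} ->
  (forall x, 0 <= F x) -> \sum_(x <- s) F x <= \sum_(x <- s') F x.
Proof.
move=> us us' sub F0; rewrite [leRHS](bigID (mem s)) /=.
rewrite -[X in _ <= X + _]big_filter.
rewrite [X in _ <= X + _](perm_big s) /=; last first.
  apply: uniq_perm => //; first exact: filter_uniq.
  move=> x; rewrite mem_filter /=.
  by case: (boolP (x \in s)) => //= /sub ->.
by rewrite lerDl sumr_ge0.
Qed.

(** * Absolutely convergent sums over the lattice *)

Section LatticeSums.
Variables (R : realType) (n : nat).
Implicit Types (p k : 'rV[int]_n) (K : nat).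

Definition line_weight (i : int) : R := (`|i|%N.+1%:R ^+ 2)^-1.

(** The summable weight with which all families on the lattice are compared. *)
Definition weight p : R := \prod_j line_weight (p 0 j).

Definition box K : seq 'rV[int]_n :=
  [seq \row_j (Posz (f j) - Posz K) |
     f : {ffun 'I_n -> 'I_(K.*2.+1)} <- enum {ffun 'I_n -> 'I_(K.*2.+1)}].

Definition linesum K : R := \sum_(i < K.*2.+1) line_weight (Posz i - Posz K).

Lemma line_weight_gt0 i : 0 < line_weight i.
Proof. by rewrite invr_gt0 exprn_gt0 // ltr0n. Qed.

Lemma line_weightN i : line_weight (- i) = line_weight i.
Proof. by rewrite /line_weight abszN. Qed.

Lemma weight_gt0 p : 0 < weight p.
Proof. by rewrite prodr_gt0// => j _; exact: line_weight_gt0. Qed.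

Lemma weightN p : weight (- p) = weight p.
Proof. by apply: eq_bigr => j _; rewrite mxE line_weightN. Qed.

Lemma box_uniq K : uniq (box K).
Proof.
rewrite map_inj_uniq ?enum_uniq // => f g /rowP fg.
apply/ffunP => j; have := fg j; rewrite !mxE => /addIr[] h.
exact/val_inj.
Qed.

Lemma mem_box K p : (p \in box K) = [forall j, (`|p 0%R j| <= K)%N].
Proof.
apply/mapP/forallP => [[f _ ->] j|h].
  rewrite mxE; move: (ltn_ord (f j)); move: (nat_of_ord _) => i; lia.
have hj j : (`|(p 0 j + Posz K)%R|%N < K.*2.+1)%N by have := h j; lia.
exists [ffun j => Ordinal (hj j)]; first by rewrite mem_enum.
apply/rowP => j; rewrite mxE ffunE /=.
by move: (h j); move: (p _ j) => i; lia.
Qed.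

Lemma sub_box K K' : (K <= K')%N -> {subset box K <= box K'}.
Proof.
move=> KK p; rewrite !mem_box => /forallP h; apply/forallP => j.
exact: leq_trans (h j) KK.
Qed.

Lemma sum_box_prod K (F : int -> R) :
  \sum_(p <- box K) \prod_j F (p 0 j) =
  (\sum_(i < K.*2.+1) F (Posz i - Posz K)) ^+ n.
Proof.
rewrite big_map big_enum /=.
transitivity (\prod_(j < n) \sum_(i < K.*2.+1) F (Posz i - Posz K)).
  rewrite bigA_distr_bigA /=; apply: eq_bigr => f _.
  by apply: eq_bigr => j _; rewrite mxE.
by rewrite prodr_const card_ord.
Qed.

Lemma linesumS K : linesum K.+1 = linesum K + 2 * line_weight (Posz K.+1).
Proof.
rewrite /linesum doubleS big_ord_recl big_ord_recr /=.
have -> : line_weight (Posz 0 - Posz K.+1) = line_weight (Posz K.+1) by rewrite sub0r line_weightN.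
have -> : line_weight (Posz (bump 0 K.*2.+1) - Posz K.+1) = line_weight (Posz K.+1).
  by congr line_weight; rewrite /bump; lia.
rewrite (eq_bigr (fun i : 'I_(K.*2.+1) => line_weight (Posz i - Posz K))); last first.
  by move=> i _; congr line_weight; rewrite /= /bump; lia.
by rewrite mulr_natl mulr2n addrCA addrC -addrA.
Qed.

(** The terms 2 / (1 + i)^2 are compared with the telescoping differences
    2 / i - 2 / (1 + i). *)
Lemma linesum_le K : linesum K <= 3 - 2 / K.+1%:R.
Proof.
elim: K => [|K IH].
  rewrite /linesum big_ord1 /line_weight subr0 /= expr1n invr1; lra.
rewrite linesumS.
have h : line_weight (Posz K.+1) <= K.+1%:R^-1 - K.+2%:R^-1.
  have k1 : 0 < K.+1%:R :> R by rewrite ltr0n.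
  have k2 : 0 < K.+2%:R :> R by rewrite ltr0n.
  have -> : K.+1%:R^-1 - K.+2%:R^-1 = (K.+1%:R * K.+2%:R)^-1 :> R.
    have -> : K.+2%:R = K.+1%:R + 1 :> R by rewrite -natr1.
    by field; apply/andP; split; apply: lt0r_neq0; lra.
  rewrite /line_weight lef_pV2 ?posrE ?mulr_gt0 ?exprn_gt0 //=.
  by rewrite expr2 ler_pM2r// ler_nat.
move: IH h; move: (linesum K) (line_weight _) (K.+1%:R^-1) (K.+2%:R^-1) => a b c d; lra.
Qed.

Definition boxweight K : R := linesum K ^+ n.

Lemma sum_box_weight K : \sum_(p <- box K) weight p = boxweight K.
Proof. exact: sum_box_prod. Qed.

Lemma boxweight_le K : boxweight K <= 3 ^+ n.
Proof.
apply: lerXn2r; rewrite ?nnegrE//.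
  by apply: sumr_ge0 => i _; exact: ltW (line_weight_gt0 _).
rewrite (le_trans (linesum_le K))// gerDl oppr_le0 divr_ge0 //.
Qed.

Lemma boxweight_incr K K' : (K <= K')%N -> boxweight K <= boxweight K'.
Proof.
move=> KK; rewrite -!sum_box_weight; apply: ler_sum_subset.
- exact: box_uniq.
- exact: box_uniq.
- exact: sub_box.
- by move=> p; exact: ltW (weight_gt0 p).
Qed.

(** The box sums of the weight are nondecreasing and bounded. *)
Lemma boxweight_tail (e : R) : 0 < e ->
  exists K0, forall K K', (K0 <= K)%N -> boxweight K' <= boxweight K + e.
Proof.
move=> e0; set E := range boxweight.
have hs : has_sup E.
  split; first by exists (boxweight 0), 0%N.
  by exists (3 ^+ n) => _ [K _ <-]; exact: boxweight_le.
have [_ [K0 _ <-] h] := sup_adherent e0 hs.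
exists K0 => K K' KK.
have h1 : boxweight K' <= sup E by apply: sup_ubound; [case: hs|exists K'].
rewrite (le_trans h1)// -lerBlDr (le_trans (ltW h))//.
exact: boxweight_incr.
Qed.

Section Nonneg.
Variables (C : R) (g : 'rV[int]_n -> R).
Hypothesis g_bound : forall p, 0 <= g p <= C * weight p.

Lemma sum_seq_box K e (s : seq 'rV[int]_n) : uniq s ->
  (forall K', boxweight K' <= boxweight K + e) ->
  \sum_(p <- s) g p <= \sum_(p <- box K) g p + C * e.
Proof.
move=> us hK.
(* A box that contains both [s] and [box K]. *)
pose K' := maxn K (\max_(p <- s) \max_j `|p 0%R j|)%N.
have C0 : 0 <= C.
  have /andP[h1 h2] := g_bound 0.
  by have := le_trans h1 h2; rewrite pmulr_lge0// weight_gt0.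
have sub : {subset s <= box K'}.
  move=> p ps; rewrite mem_box; apply/forallP => j.
  rewrite leq_max; apply/orP; right.
  apply: leq_trans (leq_bigmax (F := fun j => `|p 0%R j|%N) j) _.
  exact: (leq_bigmax_seq (F := fun p : 'rV[int]_n => (\max_j `|p 0%R j|)%N)).
have g0 p : 0 <= g p by case/andP: (g_bound p).
rewrite (le_trans (ler_sum_subset us (box_uniq K') sub g0))//.
have h : \sum_(p <- box K) (C * weight p - g p)
         <= \sum_(p <- box K') (C * weight p - g p).
  apply: ler_sum_subset; rewrite ?box_uniq//.
    by apply: sub_box; rewrite leq_maxl.
  by move=> p; rewrite subr_ge0; case/andP: (g_bound p).
rewrite !sumrB -!mulr_sumr !sum_box_weight in h.
have := ler_wpM2l C0 (hK K'); rewrite mulrDr => h2; lra.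
Qed.

(** The upper bound holds because a finite set that supports a competing sum
    lies in a larger box, where [g] exceeds its sum over [box K] by at most [C]
    times what the weight gains. *)
Lemma esum_box K e :
  (forall K', boxweight K' <= boxweight K + e) ->
  \sum_(p <- box K) g p <= fine (esum setT (EFin \o g))
    <= \sum_(p <- box K) g p + C * e.
Proof.
move=> hK.
have le1 : ((\sum_(p <- box K) g p)%:E <= esum setT (EFin \o g))%E.
  apply: esum_ge; exists [set` box K].
    by split => //; exact: finite_seq.
  by rewrite -fsbig_seq ?box_uniq// sumEFin.
have le2 : (esum setT (EFin \o g) <= (\sum_(p <- box K) g p + C * e)%:E)%E.
  apply: ge_ereal_sup => _ [A [finA _] <-].
  have [s As] := (finite_seqP A).1 finA.
  have -> : A = [set` undup s].
    by rewrite As; apply/seteqP; split => x /=; rewrite mem_undup.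
  rewrite -fsbig_seq ?undup_uniq// sumEFin lee_fin.
  exact: sum_seq_box (undup_uniq s) hK.
have fin : esum setT (EFin \o g) \is a fin_num.
  by rewrite fin_numE; case: esum le1 le2.
by move: le1 le2; rewrite -[esum _ _]fineK// !lee_fin => -> ->.
Qed.

End Nonneg.

(** The error depends on [f] through [C] only. This uniformity lets infinite
    sums be exchanged with each other and with integrals, by passing to finite
    sums over one and the same box. *)
Lemma rsum_box (e : R) : 0 < e -> exists K0, forall K, (K0 <= K)%N ->
  forall C (f : 'rV[int]_n -> R), (forall p, `|f p| <= C * weight p) ->
  `|rsum f - \sum_(p <- box K) f p| <= C * e.
Proof.
move=> e0; have [K0 hK0] := boxweight_tail e0.
exists K0 => K /hK0 hK C f hf.
pose fp p := Num.max (f p) 0; pose fn p := Num.max (- f p) 0.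
have hp p : 0 <= fp p <= C * weight p.
  rewrite le_max lexx orbT ge_max (le_trans (ler_norm _) (hf p)).
  by rewrite (le_trans _ (hf p)).
have hn p : 0 <= fn p <= C * weight p.
  rewrite le_max lexx orbT ge_max (le_trans _ (hf p)) ?(le_trans _ (hf p))//.
  by rewrite -normrN ler_norm.
have -> : rsum f = fine (esum setT (EFin \o fp)) - fine (esum setT (EFin \o fn)).
  by rewrite /rsum; congr (fine _ - fine _); apply: eq_esum => p _;
    rewrite /= ?funeposE ?funenegE /= -?EFinN EFin_max.
have := esum_box hp hK; have := esum_box hn hK.
have -> : \sum_(p <- box K) f p = \sum_(p <- box K) fp p - \sum_(p <- box K) fn p.
  rewrite -sumrB; apply: eq_bigr => p _; rewrite /fp /fn /Num.max.
  by case: ifPn; case: ifPn; rewrite -?leNgt => ? ?; lra.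
move=> /andP[? ?] /andP[? ?]; rewrite ler_norml; apply/andP; split; lra.
Qed.

Definition dominated (C : R) (f : 'rV[int]_n -> R[i]) :=
  forall p, nm (f p) <= C * weight p.

Lemma csum_box (e : R) : 0 < e -> exists K0, forall K, (K0 <= K)%N ->
  forall C f, dominated C f ->
  nm (csum f - \sum_(p <- box K) f p) <= 2 * C * e.
Proof.
move=> e0; have [K0 hK0] := rsum_box e0.
exists K0 => K /hK0 hK C f hf.
apply: (le_trans (nm_le_ReIm _)).
rewrite !(cReD,cImD,cReN,cImN,cRe_sum,cIm_sum) /=.
have h1 := hK C _ (fun p => le_trans (nm_Re (f p)) (hf p)).
have h2 := hK C _ (fun p => le_trans (nm_Im (f p)) (hf p)).
by rewrite -mulrA mulr_natl mulr2n lerD.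
Qed.

Lemma csum_eq (f g : 'rV[int]_n -> R[i]) : f =1 g -> csum f = csum g.
Proof. by move=> /funext ->. Qed.

Lemma dominated_ge0 C f : dominated C f -> 0 <= C.
Proof.
move=> h; have := le_trans (nm_ge0 _) (h 0).
by rewrite pmulr_lge0// weight_gt0.
Qed.

Lemma sum_box_le K C f : dominated C f ->
  \sum_(p <- box K) nm (f p) <= C * 3 ^+ n.
Proof.
move=> h; have C0 := dominated_ge0 h.
apply: (@le_trans _ _ (\sum_(p <- box K) C * weight p)).
  by apply: ler_sum => p _; exact: h.
by rewrite -mulr_sumr sum_box_weight ler_wpM2l// boxweight_le.
Qed.

Lemma csum_le C f : dominated C f -> nm (csum f) <= C * 3 ^+ n.
Proof.
move=> h; have C0 := dominated_ge0 h.
apply/ler_addgt0Pr => e e0.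
have C1 : 0 < 2 * C + 1 by lra.
have [K0 /(_ K0 (leqnn _)) hK] := csum_box (divr_gt0 e0 C1).
rewrite -[csum f](subrK (\sum_(p <- box K0) f p)).
rewrite (le_trans (nmD _ _))// addrC lerD//.
  by rewrite (le_trans (nm_sum _ _))// sum_box_le.
rewrite (le_trans (hK _ _ h))//.
rewrite mulrCA ger_pMr// ler_pdivrMr//; lra.
Qed.

Lemma dominatedD C1 C2 f g : dominated C1 f -> dominated C2 g ->
  dominated (C1 + C2) (fun p => f p + g p).
Proof.
move=> h1 h2 p; rewrite (le_trans (nmD _ _))// mulrDl lerD//.
Qed.

Lemma dominatedM C B f g : 0 <= B -> (forall p, nm (g p) <= B) ->
  dominated C f -> dominated (B * C) (fun p => g p * f p).
Proof.
move=> B0 hg hf p; rewrite nmM -mulrA ler_pM ?nm_ge0//.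
Qed.

Lemma dominatedN C f : dominated C f -> dominated C (fun p => - f p).
Proof. by move=> h p; rewrite nmN. Qed.

Lemma csumD C1 C2 f g : dominated C1 f -> dominated C2 g ->
  csum (fun p => f p + g p) = csum f + csum g.
Proof.
move=> h1 h2; apply: (@eq_small _ (4 * (C1 + C2))) => e e0.
have [K0 /(_ K0 (leqnn _)) hK] := csum_box e0.
have a := hK _ _ h1; have b := hK _ _ h2.
have c := hK _ _ (dominatedD h1 h2).
set B := box K0 in a b c *; rewrite big_split /= in c.
set F := \sum_(p <- B) f p in a c; set G := \sum_(p <- B) g p in b c.
have -> : csum (fun p => f p + g p) - (csum f + csum g) =
  (csum (fun p => f p + g p) - (F + G)) - (csum f - F) - (csum g - G) by ring.
apply: (le_trans (nmB _ _)).
apply: (@le_trans _ _ (2 * (C1 + C2) * e + 2 * C1 * e + 2 * C2 * e)).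
  by rewrite lerD// (le_trans (nmB _ _))// lerD.
by rewrite le_eqVlt; apply/orP; left; apply/eqP; ring.
Qed.

Lemma csumZ C (z : R[i]) f : dominated C f ->
  csum (fun p => z * f p) = z * csum f.
Proof.
move=> h1; apply: (@eq_small _ (2 * (nm z * C) + nm z * (2 * C))) => e e0.
have [K0 /(_ K0 (leqnn _)) hK] := csum_box e0.
have a := hK _ _ h1.
have b := hK _ _ (dominatedM (nm_ge0 z) (fun p => lexx (nm z)) h1).
rewrite -mulr_sumr in b; set F := \sum_(p <- _) _ in a b.
have -> : csum (fun p => z * f p) - z * csum f =
  (csum (fun p => z * f p) - z * F) - z * (csum f - F) by ring.
apply: (le_trans (nmB _ _)); rewrite mulrDl lerD// nmM -mulrA.
by rewrite ler_wpM2l// nm_ge0.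
Qed.

Lemma csumZr C (z : R[i]) f : dominated C f ->
  csum (fun p => f p * z) = csum f * z.
Proof.
by move=> h; rewrite mulrC -(csumZ _ h); apply: csum_eq => p; rewrite mulrC.
Qed.

Lemma csumN C f : dominated C f -> csum (fun p => - f p) = - csum f.
Proof.
move=> h; rewrite -mulN1r -(csumZ _ h); apply: csum_eq => p.
by rewrite mulN1r.
Qed.

Lemma csumB C1 C2 f g : dominated C1 f -> dominated C2 g ->
  csum (fun p => f p - g p) = csum f - csum g.
Proof. by move=> h1 h2; rewrite (csumD h1 (dominatedN h2)) (csumN h2). Qed.

Lemma csum0 : csum (fun _ : 'rV[int]_n => 0 : R[i]) = 0.
Proof.
have h : dominated 0 (fun _ => 0) by move=> p; rewrite nm0 mul0r.
by apply: nm_eq0; have := csum_le h; rewrite mul0r.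
Qed.

Lemma csumJ (f : 'rV[int]_n -> R[i]) : csum (fun p => (f p)^*) = (csum f)^*.
Proof.
have rsumN (g : 'rV[int]_n -> R) : rsum (fun p => - g p) = - rsum g.
  rewrite /rsum opprB; congr (fine _ - fine _); apply: eq_esum => p _;
    by rewrite /= !funeposE !funenegE /= -?EFinN ?opprK.
rewrite /csum; apply: complex_eq; rewrite /=.
  by congr rsum; apply/funext => p; case: (f p).
by rewrite -rsumN; congr rsum; apply/funext => p; case: (f p).
Qed.

Lemma box_opp K : perm_eq [seq - p | p <- box K] (box K).
Proof.
apply: uniq_perm; rewrite ?box_uniq//.
  by rewrite (map_inj_uniq oppr_inj) box_uniq.
move=> p; rewrite mem_box; apply/mapP/forallP => [[q qB ->] j|h].
  by rewrite mxE abszN; move: qB; rewrite mem_box => /forallP.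
exists (- p); rewrite ?opprK// mem_box; apply/forallP => j.
by rewrite mxE abszN.
Qed.

Lemma csum_opp C f : dominated C f -> csum (fun p => f (- p)) = csum f.
Proof.
move=> h; have h' : dominated C (fun p => f (- p)).
  by move=> p; rewrite -weightN.
apply: (@eq_small _ (4 * C)) => e e0.
have [K0 /(_ K0 (leqnn _)) hK] := csum_box e0.
have a := hK _ _ h; have b := hK _ _ h'.
have E : \sum_(p <- box K0) f (- p) = \sum_(p <- box K0) f p.
  rewrite -[RHS](perm_big _ (box_opp K0)) /= big_map. reflexivity.
rewrite {}E in b; set F := \sum_(p <- _) _ in a b.
have -> : csum (fun p => f (- p)) - csum f =
  (csum (fun p => f (- p)) - F) - (csum f - F) by ring.
apply: (le_trans (nmB _ _)); lra.
Qed.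

(** Both iterated sums are close to the same finite double sum. *)
Lemma csum_fubini C (F : 'rV[int]_n -> 'rV[int]_n -> R[i]) :
  (forall k l, nm (F k l) <= C * weight k * weight l) ->
  csum (fun k => csum (F k)) = csum (fun l => csum (F^~ l)).
Proof.
move=> hF.
have key (G : 'rV[int]_n -> 'rV[int]_n -> R[i]) :
    (forall k l, nm (G k l) <= C * weight k * weight l) ->
    forall e, 0 < e -> exists K0, forall K, (K0 <= K)%N ->
    nm (csum (fun k => csum (G k)) -
        \sum_(k <- box K) \sum_(l <- box K) G k l) <= 4 * C * 3 ^+ n * e.
  move=> hG e e0; have [K0 hK] := csum_box e0; exists K0 => K /hK {}hK.
  have d1 k : dominated (C * weight k) (G k) by move=> l; exact: hG.
  have d2 : dominated (C * 3 ^+ n) (fun k => csum (G k)).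
    by move=> k; rewrite (le_trans (csum_le (d1 k)))// mulrAC.
  rewrite -[X in nm X](subrKA (\sum_(k <- box K) csum (G k))).
  apply: (le_trans (nmD _ _)).
  have -> : 4 * C * 3 ^+ n * e = 2 * (C * 3 ^+ n) * e + 2 * (C * 3 ^+ n) * e.
    by ring.
  rewrite lerD ?hK// -sumrB (le_trans (nm_sum _ _))//.
  apply: (@le_trans _ _ (\sum_(k <- box K) 2 * C * e * weight k)).
    apply: ler_sum => k _; rewrite (le_trans (hK _ _ (d1 k)))//.
    by rewrite le_eqVlt; apply/orP; left; apply/eqP; ring.
  rewrite -mulr_sumr sum_box_weight.
  have -> : 2 * (C * 3 ^+ n) * e = 2 * C * e * 3 ^+ n by ring.
  rewrite ler_wpM2l ?boxweight_le// mulr_ge0 ?(ltW e0)// mulr_ge0//.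
  by have := dominated_ge0 (d1 0); rewrite pmulr_lge0// weight_gt0.
apply: (@eq_small _ (8 * C * 3 ^+ n)) => e e0.
have [K1 h1] := key F hF e e0.
have [|K2 h2] := key (fun l k => F k l) _ e e0.
  by move=> k l; rewrite mulrAC.
have {h1} a := h1 (maxn K1 K2) (leq_maxl _ _).
have {h2} b := h2 (maxn K1 K2) (leq_maxr _ _).
rewrite exchange_big /= in b; set S := \sum_(k <- _) _ in a b.
rewrite -[X in nm X](subrKA S) (le_trans (nmD _ _))//.
rewrite -nmN opprB in b.
rewrite (le_trans (lerD a b))//.
by rewrite le_eqVlt; apply/orP; left; apply/eqP; ring.
Qed.

End LatticeSums.

(** * Complex exponentials *)

Section TrigBounds.
Variable R : realType.
Implicit Types (s t : R).

Lemma mvt_bound (f df : R -> R) (B t : R) :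
  (forall x : R, is_derive x 1 f (df x)) ->
  (forall x, `|x| <= `|t| -> `|df x| <= B) -> `|f t - f 0| <= B * `|t|.
Proof.
move=> fd hB.
have fc : continuous f.
  by move=> x; apply/differentiable_continuous/derivable1_diffP; case: (fd x).
have hc a b : {within `[a, b], continuous f} by exact: continuous_subspaceT.
have [t0|t0] := leP 0 t.
  have [c] := MVT_segment t0 (fun x _ => fd x) (hc _ _).
  rewrite in_itv /= => /andP[c0 ct] ->; rewrite subr0 normrM ler_wpM2r// hB//.
  by rewrite !ger0_norm.
have [c] := MVT_segment (ltW t0) (fun x _ => fd x) (hc _ _).
rewrite in_itv /= => /andP[ct c0].
rewrite distrC => ->; rewrite sub0r normrM normrN ler_wpM2r// hB//.
by rewrite !ler0_norm ?lerN2 ?(ltW t0).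
Qed.

Lemma sin_lip t : `|sin t| <= `|t|.
Proof.
have := @mvt_bound sin cos 1 t (fun x => is_derive_sin x).
by rewrite sin0 subr0 mul1r; apply => x _; exact: cos_max.
Qed.

Lemma cos_lip t : `|cos t - 1| <= `|t|.
Proof.
have := @mvt_bound cos (fun x => - sin x) 1 t (fun x => is_derive_cos x).
by rewrite cos0 mul1r; apply => x _; rewrite normrN sin_max.
Qed.

Lemma cos_quad t : `|cos t - 1| <= t ^+ 2.
Proof.
have := @mvt_bound cos (fun x => - sin x) `|t| t (fun x => is_derive_cos x).
rewrite cos0 -expr2 real_normK ?num_real//; apply => x xt.
by rewrite normrN (le_trans (sin_lip x)).
Qed.

Lemma sin_quad t : `|sin t - t| <= t ^+ 2.
Proof.
have := @mvt_bound (fun x => sin x - x) (fun x => cos x - 1) `|t| t.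
rewrite sin0 !subr0 -expr2 real_normK ?num_real//; apply => x; last first.
  by move=> xt; rewrite (le_trans (cos_lip x)).
Qed.

Lemma cexpD s t : cexp2pi (s + t) = cexp2pi s * cexp2pi t.
Proof.
by rewrite /cexp2pi mulrDr sinD cosD; apply: complex_eq => /=; ring.
Qed.

Lemma cexp0 : cexp2pi 0 = 1 :> R[i].
Proof. by rewrite /cexp2pi mulr0 cos0 sin0. Qed.

Lemma cexpN t : cexp2pi (- t) = (cexp2pi t)^*.
Proof. by rewrite /cexp2pi mulrN cosN sinN. Qed.

Lemma nm_cexp t : nm (cexp2pi t) = 1.
Proof. by rewrite /= cos2Dsin2 sqrtr1. Qed.

Lemma cexp_int (i : int) : cexp2pi (i%:~R : R) = 1.
Proof.
have hn (m : nat) : cexp2pi (m%:R : R) = 1.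
  elim: m => [|m IH]; first exact: cexp0.
  rewrite -natr1 cexpD IH mul1r /cexp2pi mulr1 mulrC.
  by rewrite mulr_natr cos2pi sin2pi.
case: i => m; first exact: hn.
by rewrite NegzE mulrNz cexpN hn; apply: complex_eq; rewrite /= ?oppr0.
Qed.

Lemma cexp_lip t : nm (cexp2pi t - 1) <= 4 * pi * `|t|.
Proof.
apply: (le_trans (nm_le_ReIm _)).
rewrite !(cReD, cImD, cReN, cImN) /= oppr0 addr0.
have h : `|2 * pi * t| = 2 * pi * `|t|.
  by rewrite normrM ger0_norm// mulr_ge0// pi_ge0.
have := lerD (cos_lip (2 * pi * t)) (sin_lip (2 * pi * t)).
by rewrite h; lra.
Qed.

Lemma cexp_quad t :
  nm (cexp2pi t - 1 - (0 +i* (2 * pi * t))) <= 8 * pi ^+ 2 * t ^+ 2.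
Proof.
apply: (le_trans (nm_le_ReIm _)).
rewrite !(cReD, cImD, cReN, cImN) /= oppr0 !addr0.
have := lerD (cos_quad (2 * pi * t)) (sin_quad (2 * pi * t)).
by rewrite !exprMn; lra.
Qed.

End TrigBounds.

(** * Trigonometric series with rapidly decreasing coefficients *)

Section Synthesis.
Variables (R : realType) (n : nat).
Implicit Types (p k : 'rV[int]_n) (x y : 'rV[R]_n) (c : 'rV[int]_n -> R[i]).

Definition nrm p : nat := (\sum_j `|p 0%R j|)%N.

Lemma coord_le_nrm p j : (`|p 0%R j| <= nrm p)%N.
Proof. by rewrite /nrm (bigD1 j)//= leq_addr. Qed.

Lemma nrmD p k : (nrm (p + k)%R <= nrm p + nrm k)%N.
Proof.
rewrite /nrm -big_split /=; apply: leq_sum => j _; rewrite mxE.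
move: (p _ j) (k _ j) => a b; lia.
Qed.

Lemma nrmN p : nrm (- p)%R = nrm p.
Proof. by apply: eq_bigr => j _; rewrite mxE abszN. Qed.

Lemma nrm_delta j : nrm (delta_mx 0 j)%R = 1%N.
Proof.
rewrite /nrm (bigD1 j)//= mxE !eqxx big1// => i ij.
by rewrite mxE /= (negbTE ij).
Qed.

(** The Japanese bracket, for the l^1-norm. *)
Definition jp p : R := (nrm p).+1%:R.

Lemma jp_ge1 p : 1 <= jp p. Proof. by rewrite ler1n. Qed.
Lemma jp_gt0 p : 0 < jp p. Proof. by rewrite ltr0n. Qed.
Lemma jpN p : jp (- p) = jp p. Proof. by rewrite /jp nrmN. Qed.

Lemma jpD p k : jp (p + k) <= jp p * jp k.
Proof.
rewrite -natrM ler_nat; have := nrmD p k; nia.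
Qed.

Lemma weight_jp p : 1 <= jp p ^+ (2 * n) * weight R p.
Proof.
rewrite exprM -[in X in _ ^+ X](card_ord n) -prodr_const -big_split /=.
elim/big_ind : _ => // [a b a1 b1|j _].
  by rewrite -[leLHS]mulr1 ler_pM.
rewrite ler_pdivlMr ?exprn_gt0 ?ltr0n// mul1r lerXn2r// ?nnegrE ?ler0n//.
by rewrite ler_nat ltnS coord_le_nrm.
Qed.

(** The gain of [jp p ^- (2 * n)] is enough for summability, because each
    factor of [jp p ^+ 2] dominates one of the [n] factors of the weight. *)
Lemma jp_dominated c (C : R) :
  (forall p, nm (c p) * jp p ^+ (2 * n) <= C) -> dominated C c.
Proof.
move=> h p; rewrite -[leLHS]mulr1.
apply: le_trans (ler_wpM2l (nm_ge0 _) (weight_jp p)) _.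
by rewrite mulrA ler_wpM2r// ltW// weight_gt0.
Qed.

Definition rapid c := forall N, exists C : R, forall p, nm (c p) * jp p ^+ N <= C.

Lemma rapid_dominated c : rapid c -> exists C, dominated C c.
Proof. by move=> /(_ (2 * n)%N)[C h]; exists C; exact: jp_dominated. Qed.

Lemma rapidM (g c : 'rV[int]_n -> R[i]) (A : R) (M : nat) :
  (forall p, nm (g p) <= A * jp p ^+ M) -> rapid c -> rapid (fun p => g p * c p).
Proof.
move=> hg hc N; have [C hC] := hc (M + N)%N.
have A0 : 0 <= A.
  have := le_trans (nm_ge0 _) (hg 0).
  by rewrite pmulr_lge0// exprn_gt0// jp_gt0.
exists (A * C) => p; rewrite nmM.
have j0 : 0 <= jp p ^+ N by rewrite exprn_ge0// ltW// jp_gt0.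
have := ler_wpM2r (mulr_ge0 (nm_ge0 (c p)) j0) (hg p).
have := ler_wpM2l A0 (hC p); rewrite exprD; lra.
Qed.



Definition pbound (g : 'rV[int]_n -> R[i]) :=
  exists A M, forall p, nm (g p) <= A * jp p ^+ M.

Lemma rapid_pbound g c : pbound g -> rapid c -> rapid (fun p => g p * c p).
Proof. by move=> [A [M h]]; exact: rapidM h. Qed.

Lemma pbound_ge0 g (A : R) M : (forall p, nm (g p) <= A * jp p ^+ M) -> 0 <= A.
Proof.
move=> h; have := le_trans (nm_ge0 _) (h 0).
by rewrite pmulr_lge0// exprn_gt0// jp_gt0.
Qed.

Lemma pboundM g h : pbound g -> pbound h -> pbound (fun p => g p * h p).
Proof.
move=> [A [M gA]] [B [N hB]]; exists (A * B), (M + N)%N => p.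
have j0 i : 0 <= jp p ^+ i by rewrite exprn_ge0// ltW// jp_gt0.
rewrite nmM exprD mulrACA ler_pM ?nm_ge0//.
Qed.

Lemma pboundD g h : pbound g -> pbound h -> pbound (fun p => g p + h p).
Proof.
move=> [A [M gA]] [B [N hB]]; exists (A + B), (M + N)%N => p.
have j1 i : 1 <= jp p ^+ i by rewrite exprn_ege1// jp_ge1.
have j0 i : 0 <= jp p ^+ i by rewrite (le_trans ler01).
rewrite (le_trans (nmD _ _))// exprD mulrDl lerD//.
  rewrite (le_trans (gA p))// ler_wpM2l ?(pbound_ge0 gA)// ler_peMr//.
by rewrite (le_trans (hB p))// ler_wpM2l ?(pbound_ge0 hB)// ler_peMl//.
Qed.

Lemma pbound_cst z : pbound (fun _ => z).
Proof. by exists (nm z), 0%N => p; rewrite expr0 mulr1. Qed.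

Lemma pbound_coord j : pbound (fun p => (p 0 j)%:~R).
Proof.
exists 1, 1%N => p; rewrite nm_int expr1 mul1r ler_nat.
exact: leqW (coord_le_nrm p j).
Qed.

Lemma pbound_prod (I : Type) (s : seq I) (g : I -> 'rV[int]_n -> R[i]) :
  (forall i, pbound (g i)) -> pbound (fun p => \prod_(i <- s) g i p).
Proof.
move=> h; elim: s => [|i s IH].
  by have [A [M hA]] := pbound_cst 1; exists A, M => p; rewrite big_nil.
have [A [M hA]] := pboundM (h i) IH.
by exists A, M => p; rewrite big_cons.
Qed.

(** The eigenvalue of [falling_deriv j l] on an exponential whose frequency in
    the direction [j] is [i]. *)
Definition ff (i : int) (l : nat) : R[i] := \prod_(m < l) (i%:~R - m%:R).

(** The eigenvalue of [mfalling_deriv b] on the exponential of frequency [p]. *)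
Definition mff p (b : 'I_n -> nat) : R[i] := \prod_j ff (p 0 j) (b j).

Lemma ff0 i : ff i 0 = 1. Proof. exact: big_ord0. Qed.

Lemma ffS i l : ff i l.+1 = (i%:~R - l%:R) * ff i l.
Proof. by rewrite /ff big_ord_recr mulrC. Qed.

Lemma pbound_ff j l : pbound (fun p => ff (p 0 j) l).
Proof.
apply: pbound_prod => i; apply: pboundD; first exact: pbound_coord.
exact: pbound_cst.
Qed.

(** The eigenvalue of [cpartial j] on the exponential of frequency [p]. *)
Definition freq j p : R[i] := 0 +i* (2 * pi * (p 0 j)%:~R).

Lemma freqE j p : freq j p = (0 +i* (2 * pi)) * (p 0 j)%:~R.
Proof.
rewrite -[(p 0 j)%:~R](rmorph_int (real_complex R)).
by apply: complex_eq => /=; ring.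
Qed.

Lemma pbound_freq j : pbound (freq j).
Proof.
have [A [M h]] := pboundM (pbound_cst (0 +i* (2 * pi))) (pbound_coord j).
by exists A, M => p; rewrite freqE.
Qed.

Lemma dotDr p x y : dot p (x + y) = dot p x + dot p y.
Proof.
by rewrite /dot -big_split; apply: eq_bigr => j _; rewrite mxE mulrDr.
Qed.

Lemma dotDl p k x : dot (p + k) x = dot p x + dot k x.
Proof.
rewrite /dot -big_split; apply: eq_bigr => j _.
by rewrite mxE intrD mulrDl.
Qed.

Lemma dotNl p x : dot (- p) x = - dot p x.
Proof.
rewrite /dot -sumrN; apply: eq_bigr => j _.
by rewrite mxE mulrNz mulNr.
Qed.

Lemma dotNr p x : dot p (- x) = - dot p x.
Proof.
by rewrite /dot -sumrN; apply: eq_bigr => j _; rewrite mxE mulrN.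
Qed.

Lemma dot_delta p (h : R) j : dot p (h *: delta_mx 0 j) = h * (p 0 j)%:~R.
Proof.
rewrite /dot (bigD1 j)//= big1 ?addr0; last first.
  by move=> i ij; rewrite !mxE eqxx (negbTE ij) /= !mulr0.
by rewrite !mxE !eqxx mulr1 mulrC.
Qed.

Lemma dot_int p (l : 'rV[int]_n) :
  dot p (map_mx intr l : 'rV[R]_n) = (\sum_j p 0 j * l 0 j)%:~R.
Proof.
rewrite /dot [RHS](big_morph intr (@intrD R) (erefl _)).
by apply: eq_bigr => j _; rewrite mxE intrM.
Qed.

Lemma norm_coord x j : `|x 0 j| <= `|x|.
Proof.
have -> : `|x| = mx_norm x by [].
by rewrite mx_normrE; apply: (le_bigmax _ (fun ij => `|x ij.1 ij.2|) (0, j)).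
Qed.

Lemma dot_le p x : `|dot p x| <= jp p * `|x|.
Proof.
apply: (@le_trans _ _ ((nrm p)%:R * `|x|)); last first.
  by rewrite ler_wpM2r// ler_nat.
rewrite /dot (le_trans (ler_norm_sum _ _ _))// /nrm natr_sum mulr_suml.
apply: ler_sum => j _; rewrite normrM ler_pM// ?norm_coord//.
by rewrite -intr_norm -natr_absz.
Qed.

(** The inverse Fourier transform of [c]. *)
Definition synth c x : R[i] := csum (fun p => cexp2pi (dot p x) * c p).

Lemma eq_synth c d x : c =1 d -> synth c x = synth d x.
Proof. by move=> /funext ->. Qed.

Lemma synth_dominated (C : R) c x : dominated C c ->
  dominated C (fun p => cexp2pi (dot p x) * c p).
Proof. by move=> h p; rewrite nmM nm_cexp mul1r. Qed.

Lemma synth_le (C : R) c x : dominated C c -> nm (synth c x) <= C * 3 ^+ n.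
Proof. by move=> h; apply: csum_le; exact: synth_dominated. Qed.

Lemma synthD c d x : rapid c -> rapid d ->
  synth (fun p => c p + d p) x = synth c x + synth d x.
Proof.
move=> /rapid_dominated[C hC] /rapid_dominated[D hD].
rewrite -(csumD (synth_dominated x hC) (synth_dominated x hD)).
by apply: csum_eq => p; rewrite mulrDr.
Qed.

Lemma synthZ z c x : rapid c -> synth (fun p => z * c p) x = z * synth c x.
Proof.
move=> /rapid_dominated[C hC]; rewrite -(csumZ _ (synth_dominated x hC)).
by apply: csum_eq => p; rewrite mulrCA.
Qed.

Lemma rapidZ z c : rapid c -> rapid (fun p => z * c p).
Proof. by apply: rapid_pbound; exact: pbound_cst. Qed.

Lemma rapidD c d : rapid c -> rapid d -> rapid (fun p => c p + d p).
Proof.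
move=> hc hd N; have [C hC] := hc N; have [D hD] := hd N.
exists (C + D) => p; apply: le_trans (lerD (hC p) (hD p)).
by rewrite -mulrDl ler_wpM2r ?nmD// exprn_ge0// ltW// jp_gt0.
Qed.

Lemma synthB c d x : rapid c -> rapid d ->
  synth (fun p => c p - d p) x = synth c x - synth d x.
Proof.
move=> hc hd; rewrite -mulN1r -(synthZ _ _ hd) -synthD//; last exact: rapidZ.
by apply: eq_synth => p; rewrite mulN1r.
Qed.

Lemma synth0 x : synth (fun _ => 0) x = 0.
Proof.
rewrite -[RHS](@csum0 R n); apply: csum_eq => p; exact: mulr0.
Qed.

Lemma rapid0 : rapid (fun _ => 0).
Proof. by move=> N; exists 0 => p; rewrite nm0 mul0r. Qed.

Lemma rapid_sum (I : Type) (s : seq I) (P : pred I) (F : I -> 'rV[int]_n -> R[i]) :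
  (forall i, rapid (F i)) -> rapid (fun p => \sum_(i <- s | P i) F i p).
Proof.
move=> h; elim: s => [|i s IH N].
  by move=> N; have [C hC] := rapid0 N; exists C => p; rewrite big_nil.
case: (boolP (P i)) => Pi; last first.
  by have [C hC] := IH N; exists C => p; rewrite big_cons (negbTE Pi).
have [C hC] := rapidD (h i) IH N.
by exists C => p; rewrite big_cons Pi.
Qed.

Lemma synth_sum (I : Type) (s : seq I) (P : pred I)
    (F : I -> 'rV[int]_n -> R[i]) x : (forall i, rapid (F i)) ->
  synth (fun p => \sum_(i <- s | P i) F i p) x
  = \sum_(i <- s | P i) synth (F i) x.
Proof.
move=> h; elim: s => [|i s IH].
  rewrite big_nil -[RHS](synth0 x).
  by apply: eq_synth => p; rewrite big_nil.
rewrite big_cons -IH; case: ifPn => Pi.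
  rewrite -synthD//; last exact: rapid_sum.
  by apply: eq_synth => p; rewrite big_cons Pi.
by apply: eq_synth => p; rewrite big_cons (negbTE Pi).
Qed.

Lemma synth_periodic c : Defs.periodic (synth c).
Proof.
move=> x l; apply: csum_eq => p.
by rewrite dotDr dot_int cexpD cexp_int mulr1.
Qed.

Lemma synth_conj c x : (exists C : R, dominated C c) ->
  (synth c x)^* = synth (fun p => (c (- p))^*) x.
Proof.
move=> [C hC]; rewrite /synth -csumJ.
have h : dominated C (fun p => (cexp2pi (dot p x) * c p)^*).
  by move=> p; rewrite nmJ; exact: synth_dominated.
rewrite -(csum_opp h); apply: csum_eq => p.
rewrite dotNl cexpN; case: (cexp2pi _) (c _) => a b [u v].
by apply: complex_eq => /=; ring.
Qed.

Lemma synth_lip c : rapid c ->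
  exists C, forall x y, nm (synth c y - synth c x) <= C * `|y - x|.
Proof.
move=> hc; have [C hC] := hc (1 + 2 * n)%N.
exists (4 * pi * C * 3 ^+ n) => x y.
have [D hD] := rapid_dominated hc.
rewrite -(csumB (synth_dominated y hD) (synth_dominated x hD)).
have -> : 4 * pi * C * 3 ^+ n * `|y - x| = (4 * pi * C * `|y - x|) * 3 ^+ n.
  by ring.
apply: csum_le; apply: jp_dominated => p.
have -> : cexp2pi (dot p y) * c p - cexp2pi (dot p x) * c p
        = cexp2pi (dot p x) * (cexp2pi (dot p (y - x)) - 1) * c p.
  by rewrite mulrBr -cexpD -dotDr subrKC mulr1 mulrBl.
rewrite !nmM nm_cexp mul1r.
have := hC p; rewrite exprD expr1 => h.
have j0 : 0 <= nm (c p) * jp p ^+ (2 * n).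
  by rewrite mulr_ge0 ?nm_ge0// exprn_ge0// ltW// jp_gt0.
have p4 : 0 <= 4 * pi :> R by rewrite mulr_ge0// pi_ge0.
have := le_trans (cexp_lip (dot p (y - x))) (ler_wpM2l p4 (dot_le p (y - x))).
move=> /(ler_wpM2r j0); have := ler_wpM2r (normr_ge0 (y - x)) (ler_wpM2l p4 h).
by lra.
Qed.

(** The second-order bound on the exponential, summed over the frequencies,
    justifies termwise differentiation. *)
Lemma synth_derive c j x : rapid c -> exists C : R, forall h : R,
  nm (synth c (h *: delta_mx 0 j + x) - synth c x
      - h%:C * synth (fun p => freq j p * c p) x) <= C * h ^+ 2.
Proof.
move=> hc; have [C hC] := hc (2 + 2 * n)%N.
exists (8 * pi ^+ 2 * C * 3 ^+ n) => h.
have [D hD] := rapid_dominated hc.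
have [E hE] := rapid_dominated (rapid_pbound (pbound_freq j) hc).
have hE' := dominatedM (nm_ge0 h%:C) (fun p => lexx _) (synth_dominated x hE).
have hB := dominatedD (synth_dominated (h *: delta_mx 0 j + x) hD)
             (dominatedN (synth_dominated x hD)).
rewrite -(csumB (synth_dominated _ hD) (synth_dominated x hD)).
rewrite -(csumZ _ (synth_dominated x hE)) -(csumB hB hE').
have -> : 8 * pi ^+ 2 * C * 3 ^+ n * h ^+ 2 = (8 * pi ^+ 2 * C * h ^+ 2) * 3 ^+ n.
  by ring.
apply: csum_le; apply: jp_dominated => p.
have -> : cexp2pi (dot p (h *: delta_mx 0 j + x)) * c p - cexp2pi (dot p x) * c p
     - h%:C * (cexp2pi (dot p x) * (freq j p * c p))
  = cexp2pi (dot p x) * (cexp2pi (h * (p 0 j)%:~R) - 1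
       - (0 +i* (2 * pi * (h * (p 0 j)%:~R)))) * c p.
  rewrite dotDr dot_delta cexpD.
  have -> : 0 +i* (2 * pi * (h * (p 0 j)%:~R)) = h%:C * freq j p.
    by apply: complex_eq => /=; ring.
  by ring.
rewrite !nmM nm_cexp mul1r.
have := hC p; rewrite exprD => hh.
have j0 : 0 <= nm (c p) * jp p ^+ (2 * n).
  by rewrite mulr_ge0 ?nm_ge0// exprn_ge0// ltW// jp_gt0.
have p4 : 0 <= 8 * pi ^+ 2 * h ^+ 2 :> R.
  by rewrite mulr_ge0 ?sqr_ge0// mulr_ge0 ?sqr_ge0.
have hj : (p 0 j)%:~R ^+ 2 <= jp p ^+ 2 :> R.
  rewrite -[leLHS]real_normK ?num_real// lerXn2r ?nnegrE ?(ltW (jp_gt0 _))//.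
  by rewrite -intr_norm -natr_absz /jp ler_nat leqW// coord_le_nrm.
have h1 := ler_wpM2r j0 (cexp_quad (h * (p 0 j)%:~R)).
have h2 := ler_wpM2r j0 (ler_wpM2l p4 hj).
have h3 := ler_wpM2l p4 hh.
rewrite -mulrA; apply: (le_trans h1); rewrite exprMn; lra.
Qed.

End Synthesis.

(** * Quantitative criteria for differentiability and continuity *)

Section DeriveTools.
Variables (R : realType) (V : normedModType R).
Implicit Types (f : V -> R) (x v : V).

Lemma derive_small f x v (l : R) :
  (forall e, 0 < e -> \forall h \near (0 : R),
     `|f (h *: v + x) - f x - h * l| <= e * `|h|) -> is_derive x v f l.
Proof.
move=> H.
have cvl : h^-1 *: ((f \o shift x) (h *: v) - f x) @[h --> 0^'] --> l.
  apply/cvgrPdist_le => e e0.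
  near=> h.
  have h0 : h != 0 by near: h; exact: nbhs_dnbhs_neq.
  rewrite /= distrC.
  have -> : h^-1 *: (f (h *: v + x) - f x) - l
          = h^-1 * (f (h *: v + x) - f x - h * l).
    by rewrite mulrBr mulKf.
  rewrite normrM normfV ler_pdivrMl ?normr_gt0// [leRHS]mulrC.
  by near: h; apply: nbhs_dnbhs; exact: H.
by apply: DeriveDef; [exact: (cvgP l)|exact: cvg_lim].
Unshelve. all: by end_near.
Qed.

Lemma derive_quad f x v (l C : R) :
  (forall h, `|f (h *: v + x) - f x - h * l| <= C * h ^+ 2) -> is_derive x v f l.
Proof.
move=> H; apply: derive_small => e e0.
have C1 : 0 < `|C| + 1 by rewrite ltr_wpDl.
exists (e / (`|C| + 1)) => /=; first exact: divr_gt0.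
move=> h; rewrite /ball_ /= sub0r normrN => /ltW hle.
rewrite (le_trans (H h))// -real_normK ?num_real// expr2 mulrA ler_wpM2r//.
have h1 := ler_wpM2r (normr_ge0 h) (ler_norm C).
have h2 : (`|C| + 1) * `|h| <= e by rewrite mulrC -ler_pdivlMr.
have := normr_ge0 h; lra.
Qed.

Lemma lip_continuous f (C : R) :
  (forall x y, `|f y - f x| <= C * `|y - x|) -> continuous f.
Proof.
move=> H x; apply/cvgrPdist_le => e e0.
have C1 : 0 < `|C| + 1 by rewrite ltr_wpDl.
near=> y.
have yx : `|y - x| <= e / (`|C| + 1).
  rewrite distrC; near: y; apply: cvgr_dist_le; last exact: divr_gt0.
  exact: cvg_id.
rewrite distrC (le_trans (H x y))//.
have h1 := ler_wpM2r (normr_ge0 (y - x)) (ler_norm C).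
have h2 : (`|C| + 1) * `|y - x| <= e by rewrite mulrC -ler_pdivlMr.
have := normr_ge0 (y - x); lra.
Unshelve. all: by end_near.
Qed.

End DeriveTools.

(** * Smoothness of trigonometric series *)

Section SynthesisSmooth.
Variables (R : realType) (n : nat).
Implicit Types (p : 'rV[int]_n) (x : 'rV[R]_n) (c : 'rV[int]_n -> R[i]).

Lemma synth_is_derive c j x : rapid c ->
  is_derive x (delta_mx 0 j) (fun y => complex.Re (synth c y))
    (complex.Re (synth (fun p => freq R j p * c p) x)) /\
  is_derive x (delta_mx 0 j) (fun y => complex.Im (synth c y))
    (complex.Im (synth (fun p => freq R j p * c p) x)).
Proof.
move=> hc; have [C H] := synth_derive j x hc.
split; apply: (@derive_quad _ _ _ _ _ _ C) => h.
- have := le_trans (nm_Re _) (H h).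
  by rewrite !(cReD, cReN) cReM /= mul0r subr0.
- have := le_trans (nm_Im _) (H h).
  by rewrite !(cImD, cImN) cImM /= mul0r addr0.
Qed.

Lemma synth_continuous c : rapid c ->
  continuous (fun y => complex.Re (synth c y)) /\
  continuous (fun y => complex.Im (synth c y)).
Proof.
move=> /synth_lip[C H]; split; apply: (@lip_continuous _ _ _ C) => x y.
- by have := le_trans (nm_Re _) (H x y); rewrite cReD cReN.
- by have := le_trans (nm_Im _) (H x y); rewrite cImD cImN.
Qed.

Lemma partial_synth c j : rapid c ->
  partial j (fun y => complex.Re (synth c y)) =
    (fun y => complex.Re (synth (fun p => freq R j p * c p) y)) /\
  partial j (fun y => complex.Im (synth c y)) =
    (fun y => complex.Im (synth (fun p => freq R j p * c p) y)).
Proof.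
move=> hc; split; apply/funext => x; have [h1 h2] := synth_is_derive j x hc;
  exact: derive_val.
Qed.

Lemma cpartial_synth c j : rapid c ->
  cpartial j (synth c) = synth (fun p => freq R j p * c p).
Proof.
move=> hc; apply/funext => x; have [h1 h2] := partial_synth j hc.
by rewrite /cpartial h1 h2; apply: complex_eq.
Qed.

(** Partial differentiation multiplies the coefficients by [freq j], which
    keeps them rapidly decreasing: functions of this form are closed under all
    derivatives, and each of them is continuous and differentiable. *)
Lemma smooth_synth c : rapid c -> smooth (synth c).
Proof.
have key (s : seq 'I_n) (d : 'rV[int]_n -> R[i]) : rapid d ->
    exists2 e, rapid e &
      foldr (@partial R n) (fun y => complex.Re (synth d y)) s =
        (fun y => complex.Re (synth e y)) /\
      foldr (@partial R n) (fun y => complex.Im (synth d y)) s =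
        (fun y => complex.Im (synth e y)).
  move=> hd; elim: s => [|j s [e he [IH1 IH2]]]; first by exists d.
  exists (fun p => freq R j p * e p).
    exact: rapid_pbound (pbound_freq R j) he.
  by have [h1 h2] := partial_synth j he; rewrite /= IH1 IH2 h1 h2.
move=> hc; split=> s; have [e he [h1 h2]] := key s c hc; rewrite ?h1 ?h2;
  (split; first by have [] := synth_continuous he);
  by move=> j x; have [] := synth_is_derive j x he.
Qed.

Lemma twopii_neq0 : (0 +i* (2 * pi) : R[i]) != 0.
Proof.
apply/eqP => -[/eqP]; rewrite mulf_eq0 pnatr_eq0 /= => /eqP.
by apply/eqP; rewrite gt_eqF// pi_gt0.
Qed.

Lemma falling_synth c j l : rapid c ->
  falling_deriv j l (synth c) = synth (fun p => ff R (p 0 j) l * c p).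
Proof.
move=> hc; elim: l => [|l IH] /=.
  by apply/funext => x; apply: eq_synth => p; rewrite ff0 mul1r.
have hl := rapid_pbound (pbound_ff R j l) hc.
have hf := rapid_pbound (pbound_freq R j) hl.
apply/funext => x; rewrite IH cpartial_synth//.
rewrite -(synthZ _ _ hf) -(synthZ _ _ hl) -synthB; [|exact: rapidZ..].
apply: eq_synth => p; rewrite ffS freqE.
by rewrite mulrA mulrA mulrA mulVf ?twopii_neq0// mul1r; ring.
Qed.

Lemma mfalling_synth c (b : 'I_n -> nat) : rapid c ->
  mfalling_deriv b (synth c) = synth (fun p => mff R p b * c p).
Proof.
move=> hc; rewrite /mfalling_deriv.
have -> : foldr (fun j g => falling_deriv j (b j) g) (synth c) (enum 'I_n)
  = synth (fun p => \prod_(j <- enum 'I_n) ff R (p 0 j) (b j) * c p).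
  elim: (enum 'I_n) => [|j s IH] /=.
    by apply/funext => x; apply: eq_synth => p; rewrite big_nil mul1r.
  rewrite IH falling_synth; last first.
    apply: rapid_pbound hc; apply: pbound_prod => i; exact: pbound_ff.
  by apply/funext => x; apply: eq_synth => p; rewrite big_cons mulrA.
by apply/funext => x; apply: eq_synth => p; rewrite big_enum.
Qed.

End SynthesisSmooth.

(** * Integration of continuous functions over the unit interval *)

Section UnitInterval.
Variable R : realType.
Implicit Types (f g : R -> R) (r t : R).
Notation mu := (@lebesgue_measure R).

Definition int01 f : R := (\int[mu]_(t in `[0%R, 1%R]) f t)%R.

Lemma int01_integrable f : continuous f -> mu.-integrable `[0, 1] (EFin \o f).
Proof.
move=> cf; apply: continuous_compact_integrable; first exact: segment_compact.
exact: continuous_subspaceT.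
Qed.

Lemma int01D f g : continuous f -> continuous g ->
  int01 (fun t => f t + g t) = int01 f + int01 g.
Proof. by move=> cf cg; apply: RintegralD => //; exact: int01_integrable. Qed.

Lemma int01Z r f : continuous f -> int01 (fun t => r * f t) = r * int01 f.
Proof. by move=> cf; apply: RintegralZl => //; exact: int01_integrable. Qed.

Lemma int01_cst r : int01 (fun _ => r) = r.
Proof.
have h : lebesgue_measure [set` `[0 : R, 1]] = 1%E.
  by rewrite lebesgue_measure_itv /= lte_fin ltr01 oppr0 adde0.
rewrite /int01 Rintegral_cst// -[RHS]mulr1; congr (_ * _).
exact: (congr1 fine h).
Qed.

Lemma int01_le f g : continuous f -> continuous g ->
  (forall t, 0 <= t <= 1 -> f t <= g t) -> int01 f <= int01 g.
Proof.
move=> cf cg fg; apply: le_Rintegral => //; try exact: int01_integrable.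
Qed.

Lemma int01_ftc (F f : R -> R) : continuous f ->
  (forall t : R, is_derive t 1 F (f t)) -> int01 f = F 1 - F 0.
Proof.
move=> cf dF.
have cF : continuous F.
  by move=> t; apply/differentiable_continuous/derivable1_diffP; case: (dF t).
rewrite /int01 /Rintegral (@continuous_FTC2 _ f F)//.
- exact: continuous_subspaceT.
- split.
  + by move=> t _; case: (dF t).
  + exact: cvg_at_right_filter (cF 0).
  + exact: cvg_at_left_filter (cF 1).
- by move=> t _; rewrite derive1E; exact: derive_val.
Qed.

End UnitInterval.

(** * Slices of the cube *)

Section RowTopology.
Variables (R : realType).

Lemma mx_continuous (T : topologicalType) m n (f : T -> 'M[R]_(m, n)) :
  (forall i j, continuous (fun x => f x i j)) -> continuous f.
Proof.
move=> cf x A [P hP sub]; apply: filterS (fun y h => sub (f y) h) _.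
by apply: filter_forall => i; apply: filter_forall => j; exact: cf (hP i j).
Qed.

Definition cons_row n (t : R) (y : 'rV[R]_n) : 'rV[R]_(1 + n) :=
  row_mx (t%:M : 'rV[R]_1) y.

Lemma cons_row0 n t (y : 'rV[R]_n) : cons_row t y 0 (@lshift 1 n ord0) = t.
Proof. by rewrite /cons_row (row_mxEl (t%:M : 'rV_1)) mxE eqxx mulr1n. Qed.

Lemma cons_rowS n t (y : 'rV[R]_n) i : cons_row t y 0 (@rshift 1 n i) = y 0 i.
Proof. exact: row_mxEr. Qed.

Lemma cons_row_continuous n :
  continuous (fun z : R * 'rV[R]_n => cons_row z.1 z.2).
Proof.
apply: mx_continuous => i j; rewrite ord1.
case: (split_ordP j) => j' ->.
  rewrite (ord1 j'); under eq_fun do rewrite cons_row0.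
  by move=> z; exact: cvg_fst.
under eq_fun do rewrite cons_rowS.
move=> z; apply: (@continuous_comp _ _ _ snd (fun y : 'rV[R]_n => y 0 j')).
  exact: cvg_snd.
exact: coord_continuous.
Qed.

Definition ucube n : set 'rV[R]_n := [set y | forall i, 0 <= y 0 i <= 1].

Lemma ucube_compact n : compact (@ucube n).
Proof.
have := @rV_compact R n (fun _ => [set` `[0, 1]]) (fun i => @segment_compact R 0 1).
by congr compact; apply/seteqP; split => y hy i; have := hy i; rewrite /= in_itv.
Qed.

Lemma cons_row_ucube n t (y : 'rV[R]_n) :
  0 <= t <= 1 -> ucube y -> ucube (cons_row t y).
Proof.
move=> t01 hy i; case: (split_ordP i) => j ->.
  by rewrite (ord1 j) cons_row0.
by rewrite cons_rowS.
Qed.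

(** The closeness is uniform in [y] by compactness of the cube. *)
Lemma near_ucube n (u : 'rV[R]_n.+1 -> R) (t e : R) : continuous u -> 0 < e ->
  \forall s \near t, forall y, ucube y ->
    `|u (cons_row s y) - u (cons_row t y)| <= e.
Proof.
move=> cu e0.
have := (@compact_near_coveringP _ (@ucube n)).1 (@ucube_compact n) R (nbhs t)
  (fun s y => `|u (cons_row s y) - u (cons_row t y)| <= e) _.
apply=> y hy.
have cz : continuous (fun z : R * 'rV[R]_n => u (cons_row z.1 z.2)).
  move=> z; apply: continuous_comp; first exact: cons_row_continuous.
  exact: cu.
have c1 : \forall y' \near y & s \near t,
    `|u (cons_row s y') - u (cons_row t y)| <= e / 2.
  have e2 : 0 < e / 2 by exact: divr_gt0.
  have /cvgrPdist_le/(_ (e / 2) e2) [[A B] [/= hA hB] sub] := cz (t, y).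
  exists (B, A) => //= -[y' s] /= [By' As].
  by rewrite distrC; exact: (sub (s, y')).
have c2 : \forall y' \near y & s \near t,
    `|u (cons_row t y') - u (cons_row t y)| <= e / 2.
  case: c1 => [[A B] [/= hA hB] sub].
  exists (A, setT) => /=; first by split=> //; exact: filterT.
  by move=> [y' s] /= [Ay' _]; apply: (sub (y', t)); split=> //; exact: nbhs_singleton.
apply: filterS2 c1 c2 => -[y' s] /= h1 h2.
rewrite (le_trans (ler_distD (u (cons_row t y)) _ _))//.
by rewrite [X in _ + X]distrC; lra.
Qed.

End RowTopology.

(** * The iterated integral over the cube *)

Section PointwiseContinuity.
Variables (R : realType) (T : topologicalType).
Implicit Types (f g : T -> R).

Lemma cont_cst (r : R) : continuous (fun _ : T => r).
Proof. by move=> x; exact: cst_continuous. Qed.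

Lemma contD f g : continuous f -> continuous g -> continuous (fun x => f x + g x).
Proof.
by move=> cf cg x; apply: (@continuousD _ _ _ f g); [exact: cf|exact: cg].
Qed.

Lemma contB f g : continuous f -> continuous g -> continuous (fun x => f x - g x).
Proof.
by move=> cf cg x; apply: (@continuousB _ _ _ f g); [exact: cf|exact: cg].
Qed.

Lemma contM f g : continuous f -> continuous g -> continuous (fun x => f x * g x).
Proof.
by move=> cf cg x; apply: (@continuousM _ _ f g); [exact: cf|exact: cg].
Qed.

Lemma contZ (r : R) f : continuous f -> continuous (fun x => r * f x).
Proof. by move=> cf; apply: contM cf; exact: cont_cst. Qed.

End PointwiseContinuity.

Section CubeIntegral.
Variable (R : realType).

Lemma slice_continuous n (u : 'rV[R]_n.+1 -> R) t :
  continuous u -> continuous (fun y : 'rV[R]_n => u (cons_row t y)).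
Proof.
move=> cu y; have := @cons_row_continuous R n (t, y).
move=> h; apply: (@continuous_comp _ _ _ (@cons_row R n t) u); last exact: cu.
move=> A hA; have [[B C] [/= hB hC] sub] := h A hA.
by apply: filterS hC => y' Cy'; apply: (sub (t, y')); split=> //; exact: nbhs_singleton.
Qed.

Lemma cube_integralS n (u : 'rV[R]_n.+1 -> R) :
  cube_integral u =
  int01 (fun t => cube_integral (fun y : 'rV[R]_n => u (cons_row t y))).
Proof. by []. Qed.

(** What is known of the integral in dimension [n] when dimension [n.+1] is
    considered. *)
Definition cube_laws n : Prop :=
  [/\ forall u v : 'rV[R]_n -> R, continuous u -> continuous v ->
        cube_integral (fun x => u x + v x) = cube_integral u + cube_integral v,
      forall (r : R) (u : 'rV[R]_n -> R), continuous u ->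
        cube_integral (fun x => r * u x) = r * cube_integral u,
      forall u v : 'rV[R]_n -> R, continuous u -> continuous v ->
        (forall y, ucube y -> u y <= v y) -> cube_integral u <= cube_integral v &
      forall r : R, cube_integral (fun _ : 'rV[R]_n => r) = r].

(** By compactness of the cube, nearby slices of a continuous function are
    uniformly close, so that their integrals are close as well. *)
Lemma cube_laws_continuous n (u : 'rV[R]_n.+1 -> R) : cube_laws n ->
  continuous u ->
  continuous (fun t => cube_integral (fun y : 'rV[R]_n => u (cons_row t y))).
Proof.
move=> [hD hZ hle hc] cu t; apply/cvgrPdist_le => e e0.
have cs s : continuous (fun y : 'rV[R]_n => u (cons_row s y)).
  exact: slice_continuous.
apply: filterS (near_ucube t cu e0) => s hs.
have -> : cube_integral (fun y : 'rV[R]_n => u (cons_row t y))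
  - cube_integral (fun y : 'rV[R]_n => u (cons_row s y)) =
  cube_integral (fun y : 'rV[R]_n => u (cons_row t y) + -1 * u (cons_row s y)).
  rewrite hD//; last exact: contZ.
  by rewrite hZ// mulN1r.
have cd : continuous (fun y : 'rV[R]_n => u (cons_row t y) + -1 * u (cons_row s y)).
  by apply: contD => //; exact: contZ.
rewrite ler_norml; apply/andP; split.
  rewrite -(hc (- e)); apply: hle => //; first exact: cont_cst.
  by move=> y /hs; rewrite distrC ler_norml mulN1r => /andP[].
rewrite -[leRHS](hc e); apply: hle => //; first exact: cont_cst.
by move=> y /hs; rewrite distrC ler_norml mulN1r => /andP[].
Qed.

(** The induction goes through the continuity in the first variable, which
    makes the outer integral one of a continuous function. *)
Lemma cube_lawsP n : cube_laws n.
Proof.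
elim: n => [|n IHn].
  by split=> //= u v _ _; apply => -[].
have cc u : continuous u ->
    continuous (fun t => cube_integral (fun y : 'rV[R]_n => u (cons_row t y))).
  exact: cube_laws_continuous.
have [IHD IHZ IHle IHc] := IHn; split.
- move=> u v cu cv; rewrite !cube_integralS -int01D; [|exact: cc..].
  by congr int01; apply/funext => t; rewrite IHD//; exact: slice_continuous.
- move=> r u cu; rewrite !cube_integralS -int01Z; last exact: cc.
  by congr int01; apply/funext => t; rewrite IHZ//; exact: slice_continuous.
- move=> u v cu cv uv; rewrite !cube_integralS; apply: int01_le; [exact: cc..|].
  move=> t t01; apply: IHle; [exact: slice_continuous..|].
  by move=> y hy; apply: uv; exact: cons_row_ucube.
- move=> r; rewrite cube_integralS -[RHS]int01_cst; congr int01.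
  by apply/funext => t; exact: IHc.
Qed.

Variable n : nat.
Implicit Types (u v : 'rV[R]_n -> R).

Lemma cube_integralD u v : continuous u -> continuous v ->
  cube_integral (fun x => u x + v x) = cube_integral u + cube_integral v.
Proof. by have [h _ _ _] := cube_lawsP n; exact: h. Qed.

Lemma cube_integralZ (r : R) u : continuous u ->
  cube_integral (fun x => r * u x) = r * cube_integral u.
Proof. by have [_ h _ _] := cube_lawsP n; exact: h. Qed.

Lemma cube_integral_le u v : continuous u -> continuous v ->
  (forall y, ucube y -> u y <= v y) -> cube_integral u <= cube_integral v.
Proof. by have [_ _ h _] := cube_lawsP n; exact: h. Qed.

Lemma cube_integral_cst (r : R) : cube_integral (fun _ : 'rV[R]_n => r) = r.
Proof. by have [_ _ _ h] := cube_lawsP n; exact: h. Qed.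

Lemma cube_integral_continuous (u : 'rV[R]_n.+1 -> R) : continuous u ->
  continuous (fun t => cube_integral (fun y : 'rV[R]_n => u (cons_row t y))).
Proof. exact: cube_laws_continuous (cube_lawsP n). Qed.

Lemma cube_integralB u v : continuous u -> continuous v ->
  cube_integral (fun x => u x - v x) = cube_integral u - cube_integral v.
Proof.
move=> cu cv; rewrite -mulN1r -cube_integralZ// -cube_integralD//.
  by congr cube_integral; apply/funext => x; rewrite mulN1r.
exact: contZ.
Qed.

Lemma cube_integral_norm_le u w : continuous u -> continuous w ->
  (forall y, ucube y -> `|u y| <= w y) -> `|cube_integral u| <= cube_integral w.
Proof.
move=> cu cw uw; rewrite ler_norml; apply/andP; split.
  rewrite -mulN1r -cube_integralZ//; apply: cube_integral_le => //.
    exact: contZ.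
  by move=> y /uw; rewrite ler_norml mulN1r => /andP[].
by apply: cube_integral_le => // y /uw; exact/le_trans/ler_norm.
Qed.

End CubeIntegral.

(** * Integrals of partial derivatives *)

Section CubePartial.
Variable (R : realType).

Lemma shift_coord n (h : R) (j i : 'I_n) (x : 'rV[R]_n) :
  (h *: delta_mx 0 j + x) 0 i = h * (i == j)%:R + x 0 i.
Proof. by rewrite !mxE eqxx. Qed.

Lemma cons_row_delta0 n (t h : R) (y : 'rV[R]_n) :
  h *: delta_mx 0 (@lshift 1 n ord0) + cons_row t y = cons_row (h + t) y.
Proof.
apply/rowP => i; rewrite shift_coord.
case: (split_ordP i) => j ->.
  by rewrite (ord1 j) !cons_row0 eqxx mulr1.
rewrite !cons_rowS (_ : (rshift 1 j == lshift n ord0) = false) ?mulr0 ?add0r//.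
Qed.

Lemma cons_row_deltaS n (t h : R) (y : 'rV[R]_n) i :
  h *: delta_mx 0 (@rshift 1 n i) + cons_row t y
  = cons_row t (h *: delta_mx 0 i + y).
Proof.
apply/rowP => k; rewrite shift_coord.
case: (split_ordP k) => j ->.
  rewrite (ord1 j) !cons_row0.
  by rewrite (_ : (lshift n ord0 == rshift 1 i) = false) ?mulr0 ?add0r.
rewrite !cons_rowS shift_coord.
by rewrite (inj_eq (@rshift_inj _ _)).
Qed.

Lemma cons_row_int n (t : R) (y : 'rV[R]_n) (l : 'rV[int]_n) :
  cons_row t y + map_mx intr (row_mx 0 l : 'rV[int]_(1 + n))
  = cons_row t (y + map_mx intr l).
Proof.
rewrite /cons_row map_row_mx add_row_mx; congr row_mx.
by apply/rowP => k; rewrite !mxE addr0.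
Qed.

Lemma is_derive_mul (V : normedModType R) (a b : V -> R) x v (da db : R) :
  is_derive x v a da -> is_derive x v b db ->
  is_derive x v (fun y => a y * b y) (a x * db + b x * da).
Proof. by move=> ha hb; exact: is_deriveM. Qed.

Lemma is_derive_sub (V : normedModType R) (a b : V -> R) x v (da db : R) :
  is_derive x v a da -> is_derive x v b db ->
  is_derive x v (fun y => a y - b y) (da - db).
Proof. by move=> ha hb; exact: is_deriveB. Qed.

Lemma is_derive_add (V : normedModType R) (a b : V -> R) x v (da db : R) :
  is_derive x v a da -> is_derive x v b db ->
  is_derive x v (fun y => a y + b y) (da + db).
Proof. by move=> ha hb; exact: is_deriveD. Qed.

Lemma is_derive_line n (u : 'rV[R]_n -> R) j x (s : R) :
  (forall y, derivable u y (delta_mx 0 j)) ->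
  is_derive s 1 (fun r => u (r *: delta_mx 0 j + x))
    (partial j u (s *: delta_mx 0 j + x)).
Proof.
move=> du; have hd := du (s *: delta_mx 0 j + x).
have E : (fun h => h^-1 *: (((fun r => u (r *: delta_mx 0 j + x)) \o shift s)
              (h *: 1) - u (s *: delta_mx 0 j + x))) =
         (fun h => h^-1 *: ((u \o shift (s *: delta_mx 0 j + x))
              (h *: delta_mx 0 j) - u (s *: delta_mx 0 j + x))).
  apply/funext => h /=; congr (_ *: (u _ - _)).
  by rewrite /shift /= [h *: 1]mulr1 scalerDl addrA.
by apply: DeriveDef; rewrite /derivable /derive ?E.
Qed.

Definition real_periodic n (u : 'rV[R]_n -> R) :=
  forall x (l : 'rV[int]_n), u (x + map_mx intr l) = u x.

(** In the first variable this is the fundamental theorem of calculus after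
    differentiation under the inner integral; in the others it is the inner
    integral that vanishes. *)
Lemma cube_integral_partial n (u : 'rV[R]_n -> R) (j : 'I_n) :
  continuous u -> (forall x, derivable u x (delta_mx 0 j)) ->
  continuous (partial j u) -> real_periodic u ->
  cube_integral (partial j u) = 0.
Proof.
elim: n u j => [|n IH] u j; first by case: j.
move=> cu du cp pu.
case: (@split_ordP 1 n j) => i ji.
  rewrite (ord1 i) in ji; move=> {i}.
  pose G t := cube_integral (fun y : 'rV[R]_n => u (cons_row t y)).
  pose g t := cube_integral (fun y : 'rV[R]_n => partial j u (cons_row t y)).
  have cg : continuous g by exact: cube_integral_continuous.
  (* The difference quotients of [u] converge uniformly on the slices. *)
  have dG (t : R) : is_derive t 1 G (g t).
    apply: derive_small => e e0.
    have [d /= d0 hd] := near_ucube t cp e0.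
    exists d => //= h; rewrite /ball_ /= sub0r normrN => hd'.
    rewrite [h *: 1]mulr1 /G /g -cube_integralZ; last exact: slice_continuous.
    have cs s : continuous (fun y : 'rV[R]_n => u (cons_row s y)).
      exact: slice_continuous.
    have cz : continuous (fun y : 'rV[R]_n => h * partial j u (cons_row t y)).
      by apply: contZ; exact: slice_continuous.
    have cd : continuous (fun y : 'rV[R]_n => u (cons_row (h + t) y) - u (cons_row t y)).
      exact: contB.
    rewrite -cube_integralB// -cube_integralB//.
    rewrite -[leRHS](@cube_integral_cst _ n); apply: cube_integral_norm_le.
    - exact: contB.
    - exact: cont_cst.
    move=> y hy.
    have hl r : r *: delta_mx 0 j + cons_row t y = cons_row (r + t) y.
      by rewrite ji cons_row_delta0.
    have := @mvt_bound R
      (fun r => u (r *: delta_mx 0 j + cons_row t y) - r * partial j u (cons_row t y))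
      (fun r => partial j u (r *: delta_mx 0 j + cons_row t y)
         - partial j u (cons_row t y)) e h.
    rewrite !hl add0r mul0r subr0 addrAC; apply.
      move=> r; apply: is_deriveB; first exact: is_derive_line.
      set c := partial j u (cons_row t y).
      have -> : (fun r' : R => r' * c) = c *: (id : R -> R).
        by apply/funext => r' /=; rewrite mulrC.
      by apply: is_derive_eq; rewrite /= [RHS](esym (mulr1 c)).
    move=> r rh; rewrite hl hd//=.
    by rewrite opprD addrCA subrr addr0 normrN (le_lt_trans rh).
  rewrite cube_integralS (int01_ftc cg dG).
  apply/eqP; rewrite subr_eq0; apply/eqP; congr cube_integral.
  apply/funext => y.
  rewrite -(pu (cons_row 0 y) (delta_mx 0 j)); congr u.
  rewrite addrC -[1 in LHS]addr0 -cons_row_delta0 scale1r ji; congr (_ + _).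
  by apply/rowP => k; rewrite !mxE eqxx /=; case: (k == _).
rewrite cube_integralS -[RHS](int01_cst (0 : R)); congr int01.
apply/funext => t.
have Q (y : 'rV[R]_n) :
    (fun h : R => h^-1 *: ((u \o shift (cons_row t y)) (h *: delta_mx 0 j)
                        - u (cons_row t y)))
  = (fun h => h^-1 *: (((fun y => u (cons_row t y)) \o shift y)
                          (h *: delta_mx 0 i) - u (cons_row t y))).
  by apply/funext => h /=; rewrite ji cons_row_deltaS.
have E : (fun y : 'rV[R]_n => partial j u (cons_row t y))
       = partial i (fun y => u (cons_row t y)).
  by apply/funext => y; rewrite /partial /derive Q.
rewrite E; apply: IH.
- exact: slice_continuous.
- by move=> y; have := du (cons_row t y); rewrite /derivable Q.
- rewrite -E; exact: slice_continuous.
- by move=> y l; rewrite -cons_row_int pu.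
Qed.

End CubePartial.

(** * Integrals of complex functions over the torus *)

Section ComplexFunctions.
Variables (R : realType) (n : nat).
Implicit Types (g h : 'rV[R]_n -> R[i]) (x : 'rV[R]_n) (z : R[i]).
Implicit Types (p q : 'rV[int]_n).

Definition ccont h : Prop :=
  continuous (fun x => complex.Re (h x)) /\ continuous (fun x => complex.Im (h x)).

Lemma ccontD g h : ccont g -> ccont h -> ccont (fun x => g x + h x).
Proof.
move=> [g1 g2] [h1 h2]; split.
  by under eq_fun do rewrite cReD; exact: contD.
by under eq_fun do rewrite cImD; exact: contD.
Qed.

Lemma ccontM g h : ccont g -> ccont h -> ccont (fun x => g x * h x).
Proof.
move=> [g1 g2] [h1 h2]; split.
  by under eq_fun do rewrite cReM; apply: contB; exact: contM.
by under eq_fun do rewrite cImM; apply: contD; exact: contM.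
Qed.

Lemma ccont_cst z : ccont (fun _ => z).
Proof. by split; exact: cont_cst. Qed.

Lemma ccontZ z h : ccont h -> ccont (fun x => z * h x).
Proof. by apply: ccontM; exact: ccont_cst. Qed.

Lemma ccontB g h : ccont g -> ccont h -> ccont (fun x => g x - h x).
Proof.
move=> cg ch; under eq_fun do rewrite -[- h _]mulN1r.
by apply: ccontD => //; exact: ccontZ.
Qed.

Lemma ccont_sum (I : Type) (s : seq I) (F : I -> 'rV[R]_n -> R[i]) :
  (forall i, ccont (F i)) -> ccont (fun x => \sum_(i <- s) F i x).
Proof.
move=> h; elim: s => [|i s IH].
  by under eq_fun do rewrite big_nil; exact: ccont_cst.
by under eq_fun do rewrite big_cons; exact: ccontD.
Qed.

Lemma ccont_synth (c : 'rV[int]_n -> R[i]) : rapid c -> ccont (synth c).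
Proof. exact: synth_continuous. Qed.

Lemma eq_tint g h : g =1 h -> torus_integral g = torus_integral h.
Proof. by move=> /funext ->. Qed.

Lemma tintD g h : ccont g -> ccont h ->
  torus_integral (fun x => g x + h x) = torus_integral g + torus_integral h.
Proof.
move=> [g1 g2] [h1 h2]; rewrite /torus_integral; apply: complex_eq => /=.
  rewrite -cube_integralD//; congr cube_integral.
  by apply/funext => x; rewrite cReD.
rewrite -cube_integralD//; congr cube_integral.
by apply/funext => x; rewrite cImD.
Qed.

Lemma tintZ z h : ccont h ->
  torus_integral (fun x => z * h x) = z * torus_integral h.
Proof.
move=> [h1 h2]; rewrite /torus_integral; case: z => a b.
apply: complex_eq => /=; rewrite -!cube_integralZ//.
  rewrite -cube_integralB; [|exact: contZ..]; congr cube_integral.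
  by apply/funext => x; rewrite cReM.
rewrite -cube_integralD; [|exact: contZ..]; congr cube_integral.
by apply/funext => x; rewrite cImM.
Qed.

Lemma tintB g h : ccont g -> ccont h ->
  torus_integral (fun x => g x - h x) = torus_integral g - torus_integral h.
Proof.
move=> cg ch; rewrite -mulN1r -tintZ// -tintD//; last exact: ccontZ.
by apply: eq_tint => x; rewrite mulN1r.
Qed.

Lemma tint_cst z : torus_integral (fun _ : 'rV[R]_n => z) = z.
Proof. by rewrite /torus_integral !cube_integral_cst; case: z. Qed.

Lemma tint_sum (I : Type) (s : seq I) (F : I -> 'rV[R]_n -> R[i]) :
  (forall i, ccont (F i)) ->
  torus_integral (fun x => \sum_(i <- s) F i x) = \sum_(i <- s) torus_integral (F i).
Proof.
move=> h; elim: s => [|i s IH].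
  by rewrite big_nil -[RHS]tint_cst; apply: eq_tint => x; rewrite big_nil.
rewrite big_cons -IH -tintD//; last exact: ccont_sum.
by apply: eq_tint => x; rewrite big_cons.
Qed.

Lemma tint_le_fun (w : 'rV[R]_n -> R) h : ccont h -> continuous w ->
  (forall x, nm (h x) <= w x) -> nm (torus_integral h) <= 2 * cube_integral w.
Proof.
move=> [h1 h2] cw hw; apply: (le_trans (nm_le_ReIm _)) => /=.
rewrite mulr_natl mulr2n lerD//; apply: cube_integral_norm_le => // y _.
  by rewrite (le_trans (nm_Re _)).
by rewrite (le_trans (nm_Im _)).
Qed.

Lemma tint_le (r : R) h : ccont h -> (forall x, nm (h x) <= r) ->
  nm (torus_integral h) <= 2 * r.
Proof.
move=> ch hr; rewrite -(cube_integral_cst n r).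
by apply: tint_le_fun => //; exact: cont_cst.
Qed.

Lemma csum_delta p z : csum (fun q => if q == p then z else 0) = z.
Proof.
have hd : dominated (nm z / weight R p) (fun q => if q == p then z else 0).
  move=> q; case: eqP => [->|_]; first by rewrite divfK// gt_eqF// weight_gt0.
  by rewrite nm0 mulr_ge0 ?divr_ge0 ?nm_ge0// ltW// weight_gt0.
apply: (@eq_small _ (2 * (nm z / weight R p))) => e e0.
have [K0 hK] := csum_box n e0.
pose K := maxn K0 (\max_j `|p 0%R j|)%N.
have := hK K (leq_maxl _ _) _ _ hd.
rewrite -big_mkcond /= -big_filter filter_pred1_uniq ?box_uniq ?big_seq1 1?nm_distC//.
rewrite mem_box; apply/forallP => j; rewrite leq_max; apply/orP; right.
exact: (leq_bigmax (F := fun j => `|p 0%R j|%N)).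
Qed.

Definition delta p : 'rV[int]_n -> R[i] := fun q => if q == p then 1 else 0.

Lemma rapid_delta p : rapid (delta p).
Proof.
move=> N; exists (jp R p ^+ N) => q; rewrite /delta; case: eqP => [->|_].
  by rewrite nm1 mul1r.
by rewrite nm0 mul0r exprn_ge0// ltW// jp_gt0.
Qed.

Lemma synth_delta p x : synth (delta p) x = cexp2pi (dot p x).
Proof.
rewrite -[RHS](csum_delta p); apply: csum_eq => q; rewrite /delta.
by case: eqP => [->|_]; rewrite ?mulr1 ?mulr0.
Qed.

Lemma ccont_cexp p : ccont (fun x => cexp2pi (dot p x)).
Proof. by have := ccont_synth (rapid_delta p); rewrite (funext (synth_delta p)). Qed.

Lemma ccont_cexpN p : ccont (fun x => cexp2pi (- dot p x)).
Proof. by under eq_fun do rewrite -dotNl; exact: ccont_cexp. Qed.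

(** Outside a large box the family has a small sum, uniformly in [x]; inside,
    additivity of the integral applies. *)
Lemma tint_csum (C : R) (F : 'rV[int]_n -> 'rV[R]_n -> R[i]) :
  (forall p, ccont (F p)) -> (forall x, dominated C (F^~ x)) ->
  ccont (fun x => csum (F^~ x)) ->
  torus_integral (fun x => csum (F^~ x)) = csum (fun p => torus_integral (F p)).
Proof.
move=> cF hF cS.
have hT : dominated (2 * C) (fun p => torus_integral (F p)).
  by move=> p; rewrite -mulrA; apply: tint_le => // x; exact: hF.
apply: (@eq_small _ (8 * C)) => e e0.
have [K0 /(_ K0 (leqnn _)) hK] := csum_box n e0.
have a := hK _ _ hT; rewrite -tint_sum// in a.
have cB : ccont (fun x => \sum_(p <- box n K0) F p x) by exact: ccont_sum.
have b := tint_le (ccontB cS cB) (fun x => hK _ _ (hF x)).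
rewrite tintB// in b; rewrite nm_distC in a.
rewrite -(subrKA (torus_integral (fun x => \sum_(p <- box n K0) F p x))).
by rewrite (le_trans (nmD _ _))//; lra.
Qed.

End ComplexFunctions.

(** * Smooth periodic functions and integration by parts *)

Section SmoothFunctions.
Variables (R : realType) (n : nat).
Implicit Types (g h : 'rV[R]_n -> R[i]) (x : 'rV[R]_n) (z : R[i]).
Implicit Types (u v : 'rV[R]_n -> R) (p q : 'rV[int]_n).

Lemma foldr_partial_lin (a b : R) u v s : smooth_real u -> smooth_real v ->
  foldr (@partial R n) (fun x => a * u x + b * v x) s
  = (fun x => a * foldr (@partial R n) u s x + b * foldr (@partial R n) v s x).
Proof.
move=> su sv; elim: s => [//|j s IH] /=.
have [_ du] := su s; have [_ dv] := sv s.
rewrite IH; apply/funext => x; rewrite /partial.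
have -> : (fun x => a * foldr (@partial R n) u s x + b * foldr (@partial R n) v s x)
  = a *: foldr (@partial R n) u s + b *: foldr (@partial R n) v s by [].
by rewrite deriveD ?deriveZ//; exact: derivableZ.
Qed.

Lemma smooth_real_lin (a b : R) u v : smooth_real u -> smooth_real v ->
  smooth_real (fun x => a * u x + b * v x).
Proof.
move=> su sv s; have [cu du] := su s; have [cv dv] := sv s.
rewrite (foldr_partial_lin a b s su sv); split.
  by apply: contD; exact: contZ.
move=> j x; apply: (@derivableD _ _ _ (a *: foldr (@partial R n) u s)
  (b *: foldr (@partial R n) v s)); exact: derivableZ.
Qed.

Lemma smooth_realB u v : smooth_real u -> smooth_real v ->
  smooth_real (fun x => u x - v x).
Proof.
move=> su sv; have := smooth_real_lin 1 (-1) su sv.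
by under eq_fun do rewrite mul1r mulN1r.
Qed.

Lemma smoothB g h : smooth g -> smooth h -> smooth (fun x => g x - h x).
Proof.
move=> [g1 g2] [h1 h2]; split.
  by under eq_fun do rewrite cReD cReN; exact: smooth_realB.
by under eq_fun do rewrite cImD cImN; exact: smooth_realB.
Qed.

Lemma smoothZ z h : smooth h -> smooth (fun x => z * h x).
Proof.
case: z => a b [h1 h2]; split.
  by under eq_fun do rewrite cReM /= -mulNr; exact: smooth_real_lin.
by under eq_fun do rewrite cImM /=; exact: smooth_real_lin.
Qed.

Lemma smooth_real_partial j u : smooth_real u -> smooth_real (partial j u).
Proof. by move=> su s; have := su (rcons s j); rewrite foldr_rcons. Qed.

Lemma smooth_cpartial j h : smooth h -> smooth (cpartial j h).
Proof. by move=> [h1 h2]; split; exact: smooth_real_partial. Qed.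

Lemma smooth_ccont h : smooth h -> ccont h.
Proof. by move=> [h1 h2]; have [? _] := h1 [::]; have [? _] := h2 [::]. Qed.

Lemma smooth_derivable h j x : smooth h ->
  derivable (fun y => complex.Re (h y)) x (delta_mx 0 j) /\
  derivable (fun y => complex.Im (h y)) x (delta_mx 0 j).
Proof.
by move=> [h1 h2]; have [_ ?] := h1 [::]; have [_ ?] := h2 [::].
Qed.

Lemma periodicB g h : Defs.periodic g -> Defs.periodic h ->
  Defs.periodic (fun x => g x - h x).
Proof. by move=> pg ph x l; rewrite pg ph. Qed.

Lemma periodicZ z h : Defs.periodic h -> Defs.periodic (fun x => z * h x).
Proof. by move=> ph x l; rewrite ph. Qed.

Lemma partial_periodic j u : real_periodic u -> real_periodic (partial j u).
Proof.
move=> pu x l; rewrite /partial /derive pu.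
have -> : (fun t : R => t^-1 *:
      ((u \o shift (x + map_mx intr l)) (t *: delta_mx 0 j) - u x))
  = (fun t => t^-1 *: ((u \o shift x) (t *: delta_mx 0 j) - u x)).
  by apply/funext => t /=; rewrite addrA pu.
by [].
Qed.

Lemma Re_periodic h : Defs.periodic h -> real_periodic (fun x => complex.Re (h x)).
Proof. by move=> ph x l; rewrite ph. Qed.

Lemma Im_periodic h : Defs.periodic h -> real_periodic (fun x => complex.Im (h x)).
Proof. by move=> ph x l; rewrite ph. Qed.

Lemma cpartial_periodic j h : Defs.periodic h -> Defs.periodic (cpartial j h).
Proof.
move=> ph x l; rewrite /cpartial (partial_periodic j (Re_periodic ph)).
by rewrite (partial_periodic j (Im_periodic ph)).
Qed.

Lemma smooth_falling j l h : smooth h -> smooth (falling_deriv j l h).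
Proof.
move=> sh; elim: l => [//|l IH] /=.
exact: smoothB (smoothZ _ (smooth_cpartial j IH)) (smoothZ _ IH).
Qed.

Lemma periodic_falling j l h : Defs.periodic h ->
  Defs.periodic (falling_deriv j l h).
Proof.
move=> ph; elim: l => [//|l IH] /=.
exact: periodicB (periodicZ _ (cpartial_periodic j IH)) (periodicZ _ IH).
Qed.

Lemma cis_deriveM j g h x : smooth g -> smooth h ->
  is_derive x (delta_mx 0 j) (fun y => complex.Re (g y * h y))
    (complex.Re (g x * cpartial j h x + cpartial j g x * h x)) /\
  is_derive x (delta_mx 0 j) (fun y => complex.Im (g y * h y))
    (complex.Im (g x * cpartial j h x + cpartial j g x * h x)).
Proof.
move=> sg sh.
have [/derivableP g1 /derivableP g2] := smooth_derivable j x sg.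
have [/derivableP h1 /derivableP h2] := smooth_derivable j x sh.
split.
- have := is_derive_sub (is_derive_mul g1 h1) (is_derive_mul g2 h2).
  under [in X in _ -> X]eq_fun do rewrite cReM.
  move=> H; apply: (is_derive_eq H).
  by rewrite cReD !cReM /= /partial; ring.
- have := is_derive_add (is_derive_mul g1 h2) (is_derive_mul g2 h1).
  under [in X in _ -> X]eq_fun do rewrite cImM.
  move=> H; apply: (is_derive_eq H).
  by rewrite cImD !cImM /= /partial; ring.
Qed.

Lemma cpartialM j g h : smooth g -> smooth h ->
  cpartial j (fun x => g x * h x)
  = (fun x => g x * cpartial j h x + cpartial j g x * h x).
Proof.
move=> sg sh; apply/funext => x; have [h1 h2] := cis_deriveM j x sg sh.
by apply: complex_eq => /=; exact: derive_val.
Qed.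

Lemma tint_cpartial j h : ccont h -> ccont (cpartial j h) ->
  (forall x, derivable (fun y => complex.Re (h y)) x (delta_mx 0 j) /\
             derivable (fun y => complex.Im (h y)) x (delta_mx 0 j)) ->
  Defs.periodic h -> torus_integral (cpartial j h) = 0.
Proof.
move=> [c1 c2] [d1 d2] dh ph.
apply: complex_eq.
  exact: cube_integral_partial c1 (fun x => (dh x).1) d1 (Re_periodic ph).
exact: cube_integral_partial c2 (fun x => (dh x).2) d2 (Im_periodic ph).
Qed.

Lemma cexpE p : (fun x => cexp2pi (dot p x)) = synth (@delta R n p).
Proof. by apply/funext => x; rewrite synth_delta. Qed.

Lemma smooth_cexp p : smooth (fun x : 'rV[R]_n => cexp2pi (dot p x)).
Proof. by rewrite cexpE; apply: smooth_synth; exact: rapid_delta. Qed.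

Lemma periodic_cexp p : Defs.periodic (fun x : 'rV[R]_n => cexp2pi (dot p x)).
Proof. by rewrite cexpE; exact: synth_periodic. Qed.

Lemma cpartial_cexp j p : cpartial j (fun x : 'rV[R]_n => cexp2pi (dot p x))
  = (fun x => freq R j p * cexp2pi (dot p x)).
Proof.
rewrite [in LHS]cexpE cpartial_synth; last exact: rapid_delta.
apply/funext => x; rewrite -synth_delta -synthZ; last exact: rapid_delta.
by apply: eq_synth => q; rewrite /delta; case: eqP => [->|_]; rewrite ?mulr0.
Qed.

Lemma freq_eq0 j p : (freq R j p == 0) = (p 0 j == 0).
Proof.
by rewrite freqE mulf_eq0 intr_eq0 (negbTE (twopii_neq0 R)).
Qed.

(** For [p] other than 0 the exponential is a derivative, up to the nonzero
    factor [freq j p]. *)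
Lemma tint_cexp p :
  torus_integral (fun x : 'rV[R]_n => cexp2pi (dot p x)) = if p == 0 then 1 else 0.
Proof.
case: eqP => [->|/eqP p0].
  rewrite -[RHS](tint_cst n); apply: eq_tint => x.
  by rewrite /dot big1 ?cexp0// => j _; rewrite mxE mul0r.
have [j pj] : exists j, p 0 j != 0.
  apply/existsP; rewrite -negb_forall; apply: contra p0 => /forallP h.
  by apply/eqP/rowP => j; rewrite mxE; apply/eqP; exact: h.
have sE := smooth_cexp p; have := tint_cpartial (smooth_ccont sE)
  (smooth_ccont (smooth_cpartial j sE)) (fun x => smooth_derivable j x sE)
  (periodic_cexp p).
rewrite cpartial_cexp tintZ; last exact: ccont_cexp.
by move/eqP; rewrite mulf_eq0 freq_eq0 (negbTE pj) /= => /eqP.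
Qed.

Definition coef h p : R[i] :=
  torus_integral (fun x => cexp2pi (- dot p x) * h x).

(** Integration by parts: the derivative of the periodic product of [h] and an
    exponential has integral 0. *)
Lemma coef_cpartial j h p : smooth h -> Defs.periodic h ->
  coef (cpartial j h) p = freq R j p * coef h p.
Proof.
move=> sh ph; apply/eqP; rewrite -subr_eq0; apply/eqP.
have ce := ccont_cexpN R p; have ch := smooth_ccont sh.
have cj := smooth_ccont (smooth_cpartial j sh).
rewrite /coef -tintZ; last exact: ccontM.
rewrite -tintB; [|exact: ccontM|by apply: ccontZ; exact: ccontM].
have sE := smooth_cexp (- p).
have cE := smooth_ccont sE; have cEj := smooth_ccont (smooth_cpartial j sE).
rewrite -(@tint_cpartial j (fun x => cexp2pi (dot (- p) x) * h x)); first last.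
- by move=> x l; rewrite ph (periodic_cexp (- p)).
- move=> x; have [h1 h2] := cis_deriveM j x sE sh.
  split; [exact: (@ex_derive _ _ _ _ _ _ _ h1)|exact: (@ex_derive _ _ _ _ _ _ _ h2)].
- by rewrite cpartialM//; apply: ccontD; exact: ccontM.
- exact: ccontM.
apply: eq_tint => x; rewrite cpartialM// cpartial_cexp dotNl.
have -> : freq R j (- p) = - freq R j p by rewrite !freqE mxE mulrNz mulrN.
by ring.
Qed.

End SmoothFunctions.

(** * Fourier coefficients *)

Section FourierCoefficients.
Variables (R : realType) (n : nat).
Implicit Types (g h : 'rV[R]_n -> R[i]) (x y : 'rV[R]_n) (z : R[i]).
Implicit Types (p q : 'rV[int]_n).

Lemma coef_sub g h p : ccont g -> ccont h ->
  coef (fun x => g x - h x) p = coef g p - coef h p.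
Proof.
move=> cg ch; have ce := ccont_cexpN R p.
rewrite /coef -tintB; [|exact: ccontM..].
by apply: eq_tint => x; rewrite mulrBr.
Qed.

Lemma coef_scale z h p : ccont h -> coef (fun x => z * h x) p = z * coef h p.
Proof.
move=> ch; have ce := ccont_cexpN R p.
rewrite /coef -tintZ; last exact: ccontM.
by apply: eq_tint => x; rewrite mulrCA.
Qed.

Lemma coef_falling j l h p : smooth h -> Defs.periodic h ->
  coef (falling_deriv j l h) p = ff R (p 0 j) l * coef h p.
Proof.
move=> sh ph; elim: l => [|l IH]; first by rewrite ff0 mul1r.
have sl := smooth_falling j l sh; have pl := periodic_falling j l ph.
have cl := smooth_ccont sl; have cj := smooth_ccont (smooth_cpartial j sl).
rewrite coef_sub; [|exact: ccontZ..].
rewrite !coef_scale// coef_cpartial// IH ffS freqE.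
by rewrite -(mulrA _ (_%:~R)) mulKf ?twopii_neq0//; ring.
Qed.

Lemma mfalling_props (b : 'I_n -> nat) h p : smooth h -> Defs.periodic h ->
  coef (mfalling_deriv b h) p = mff R p b * coef h p /\
  ccont (mfalling_deriv b h).
Proof.
move=> sh ph; rewrite /mfalling_deriv /mff -big_enum /=.
suff [h1 h2 h3] : [/\ smooth (foldr (fun j g => falling_deriv j (b j) g) h (enum 'I_n)),
  Defs.periodic (foldr (fun j g => falling_deriv j (b j) g) h (enum 'I_n)) &
  coef (foldr (fun j g => falling_deriv j (b j) g) h (enum 'I_n)) p
  = (\prod_(j <- enum 'I_n) ff R (p 0 j) (b j)) * coef h p].
  by split=> //; exact: smooth_ccont.
elim: (enum 'I_n) => [|j s [s1 s2 s3]] /=; first by rewrite big_nil mul1r.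
split; [exact: smooth_falling|exact: periodic_falling|].
by rewrite coef_falling// s3 big_cons mulrA.
Qed.

(** Orthogonality of the exponentials, after exchange of sum and integral. *)
Lemma coef_synth (c : 'rV[int]_n -> R[i]) p : rapid c -> coef (synth c) p = c p.
Proof.
move=> hc; have [C hC] := rapid_dominated hc.
have E x : cexp2pi (- dot p x) * synth c x
         = csum (fun q => c q * cexp2pi (dot (q - p) x)).
  rewrite -(csumZ _ (synth_dominated x hC)); apply: csum_eq => q.
  by rewrite dotDl dotNl addrC cexpD; ring.
rewrite /coef (eq_tint E) (@tint_csum _ _ C); first last.
- under eq_fun do rewrite -E.
  by apply: ccontM; [exact: ccont_cexpN|exact: ccont_synth].
- by move=> x q; rewrite nmM nm_cexp mulr1.
- by move=> q; apply: ccontZ; exact: ccont_cexp.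
rewrite -[RHS](csum_delta p); apply: csum_eq => q.
rewrite tintZ; last exact: ccont_cexp.
by rewrite tint_cexp subr_eq0; case: eqP => [->|_]; rewrite ?mulr1 ?mulr0.
Qed.

End FourierCoefficients.

(** * Distance of the exponential to 1 *)

Section Uniqueness.
Variable R : realType.
Implicit Types (t s : R).

Lemma cexpX t m : cexp2pi (m%:R * t) = cexp2pi t ^+ m.
Proof.
elim: m => [|m IH]; first by rewrite mul0r cexp0.
by rewrite -natr1 mulrDl mul1r cexpD IH exprSr.
Qed.

Lemma nm_cexp_sub1 t : nm (cexp2pi t - 1) ^+ 2 = 2 - 2 * cos (2 * pi * t).
Proof.
rewrite /cexp2pi /= sqr_sqrtr ?addr_ge0 ?sqr_ge0//.
have := cos2Dsin2 (2 * pi * t).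
move: (cos _) (sin _) => a b h; rewrite oppr0 addr0 sqrrB expr1n mulr1.
have hb : b ^+ 2 = 1 - a ^+ 2 by lra.
by rewrite hb; ring.
Qed.

Lemma cexp_int_shift t (l : int) : cexp2pi (t - l%:~R) = cexp2pi t.
Proof. by rewrite cexpD -intrN cexp_int mulr1. Qed.

(** Once [t] is reduced to [-1/2, 1/2], the bound is the monotonicity of the
    cosine on [0, pi]. *)
Lemma cexp_away (d t : R) : 0 < d -> d <= 2^-1 ->
  (exists l : int, `|t - l%:~R| < d) \/
  2 - 2 * cos (2 * pi * d) <= nm (cexp2pi t - 1) ^+ 2.
Proof.
move=> d0 d2; pose l := Num.floor (t + 2^-1).
have /andP[l1 l2] := floor_itv (t + 2^-1); rewrite -/l in l1 l2.
have [lt|ge] := ltP (`|t - l%:~R|) d; first by left; exists l.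
right; rewrite -(cexp_int_shift t l) nm_cexp_sub1 lerD2l lerN2 ler_pM2l//.
set r := t - l%:~R in ge *.
have r2 : `|r| <= 2^-1.
  by rewrite ler_norml /r; rewrite intrD in l2; lra.
have p0 := pi_gt0 R.
have -> : cos (2 * pi * r) = cos (2 * pi * `|r|).
  by rewrite -[LHS]cos_norm normrM (@ger0_norm _ (2 * pi))// mulr_ge0// pi_ge0.
rewrite leNgt ltr_cos ?in_itv -?leNgt /=.
- by rewrite ler_pM2l// mulr_gt0.
- rewrite !mulr_ge0 ?(ltW p0)//= -[leRHS](mulr1) mulrAC mulrC.
  rewrite ler_wpM2l ?(ltW p0)//; lra.
- rewrite !mulr_ge0 ?(ltW p0) ?(ltW d0)//=.
  rewrite -[leRHS](mulr1) mulrAC mulrC ler_wpM2l ?(ltW p0)//; lra.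
Qed.

End Uniqueness.

(** * Uniqueness of Fourier coefficients in one variable *)

Section UniquenessLine.
Variable R : realType.
Implicit Types (h g : 'rV[R]_1 -> R[i]) (x y : 'rV[R]_1).

Lemma cons_row1 x : cons_row (x 0 0) (0 : 'rV[R]_0) = x.
Proof.
apply/rowP => j; rewrite (ord1 j).
by have := cons_row0 (x 0 0) (0 : 'rV[R]_0); rewrite (_ : lshift 0 ord0 = 0)//; apply: val_inj.
Qed.

Lemma dot1 (p : 'rV[int]_1) x : dot p x = (p 0 0)%:~R * x 0 0.
Proof. by rewrite /dot big_ord1. Qed.

(** Where [y] is close to [x] modulo 1, continuity gives the bound [e].
    Elsewhere [cexp2pi (y - x)] stays away from 1, and a large [M] absorbs the
    bound on [h]. *)
Lemma periodic_modulus h x (e B : R) : 0 < e -> ccont h -> Defs.periodic h ->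
  (forall y, nm (h y) <= B) ->
  exists2 M : R, 0 <= M &
    forall y, nm (h x - h y) <= e + M * nm (cexp2pi (y 0 0 - x 0 0) - 1) ^+ 2.
Proof.
move=> e0 [c1 c2] ph hB.
have e2 : 0 < e / 2 by exact: divr_gt0.
have [d1 /= d10 hd1] := near_ucube (x 0 0) c1 e2.
have [d2 /= d20 hd2] := near_ucube (x 0 0) c2 e2.
have v0 : ucube (0 : 'rV[R]_0) by move=> [].
pose d := Num.min (2^-1) (Num.min d1 d2).
have d0 : 0 < d by rewrite !lt_min d10 d20 invr_gt0 ltr0n.
have dle : d <= 2^-1 by rewrite ge_min lexx.
have near y : `|y 0 0 - x 0 0| < d -> nm (h x - h y) <= e.
  rewrite !lt_min => /and3P[_ y1 y2].
  rewrite -(cons_row1 x) -(cons_row1 y) nm_distC (le_trans (nm_le_ReIm _))//.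
  rewrite cReD cReN cImD cImN [leRHS]splitr lerD//.
    by apply: (hd1 (y 0 0)) => //; rewrite /ball_ /= distrC.
  by apply: (hd2 (y 0 0)) => //; rewrite /ball_ /= distrC.
pose a := 2 - 2 * cos (2 * pi * d).
have a0 : 0 < a.
  have p0 := pi_gt0 R.
  rewrite subr_gt0 -[ltRHS]mulr1 ltr_pM2l// -[ltRHS](@cos0 R) ltr_cos.
  - by rewrite !mulr_gt0.
  - by rewrite in_itv /= lexx (ltW p0).
  - rewrite in_itv /= !mulr_ge0 ?(ltW p0) ?(ltW d0)//=.
    by rewrite -[leRHS](mulr1) mulrAC mulrC ler_wpM2l ?(ltW p0)//; lra.
have B0 : 0 <= B by rewrite (le_trans (nm_ge0 _) (hB 0)).
exists (2 * B / a); first by rewrite divr_ge0 ?(ltW a0)// mulr_ge0.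
move=> y; have [[l yl]|far] := cexp_away (y 0 0 - x 0 0) d0 dle.
  have := near (y + map_mx intr (const_mx (- l))); rewrite ph.
  rewrite !mxE intrN addrAC => /(_ yl) /le_trans; apply.
  by rewrite lerDl !mulr_ge0 ?invr_ge0 ?(ltW a0) ?sqr_ge0.
rewrite (le_trans (nmB _ _))//.
have h1 : 2 * B <= 2 * B / a * nm (cexp2pi (y 0 0 - x 0 0) - 1) ^+ 2.
  by rewrite mulrAC ler_pdivlMr// ler_wpM2l// mulr_ge0.
have h2 : nm (h x) + nm (h y) <= 2 * B by rewrite mulr_natl mulr2n lerD.
by rewrite (le_trans h2)// (le_trans h1)// lerDr ltW.
Qed.

Definition dirichlet K (t : R) : R[i] := \sum_(i < K) cexp2pi ((i : nat)%:R * t).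

Lemma dirichletE K t :
  (cexp2pi t - 1) * dirichlet K t = cexp2pi (K%:R * t) - 1.
Proof.
rewrite cexpX subrX1; congr (_ * _); apply: eq_bigr => i _.
exact: cexpX.
Qed.

Lemma dirichlet_le K t :
  nm (cexp2pi t - 1) ^+ 2 * nm (dirichlet K t) ^+ 2 <= 4.
Proof.
rewrite -exprMn -nmM dirichletE.
have h : nm (cexp2pi (K%:R * t) - 1) <= 2.
  by rewrite (le_trans (nmB _ _))// nm1 (nm_cexp (K%:R * t)).
have -> : 4 = 2 ^+ 2 :> R by rewrite expr2; ring.
by rewrite lerXn2r ?nnegrE ?nm_ge0.
Qed.

Lemma dirichletJ K t :
  (dirichlet K t)^* = \sum_(i < K) cexp2pi (- ((i : nat)%:R * t)).
Proof.
apply: complex_eq; rewrite ?cReJ ?cImJ ?cRe_sum ?cIm_sum -?sumrN;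
  by apply: eq_bigr => i _; rewrite cexpN ?cReJ ?cImJ.
Qed.

Definition fpt (i j : nat) : 'rV[int]_1 := const_mx (Posz i - Posz j).

(** The squared modulus of the Dirichlet kernel centred at [x], that is [K]
    times the Fejer kernel, written as a trigonometric polynomial: its integral
    against a function is a combination of Fourier coefficients. *)
Definition fejer K x y : R[i] :=
  \sum_(i < K) \sum_(j < K) cexp2pi (dot (fpt i j) (y - x)).

Lemma fejerE K x y : fejer K x y = (nm (dirichlet K (y 0 0 - x 0 0)) ^+ 2)%:C.
Proof.
have sq (z : R[i]) : (nm z ^+ 2)%:C = z * (z^*)%C.
  case: z => a b; rewrite /= sqr_sqrtr ?addr_ge0 ?sqr_ge0//.
  by apply: complex_eq => /=; ring.
rewrite sq dirichletJ /fejer /dirichlet.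
rewrite mulr_suml; apply: eq_bigr => i _; rewrite mulr_sumr.
apply: eq_bigr => j _; rewrite -cexpD dot1 !mxE intrB; congr cexp2pi.
by ring.
Qed.

Lemma tint_fejer K x g : ccont g ->
  torus_integral (fun y => g y * fejer K x y) =
  \sum_(i < K) \sum_(j < K) cexp2pi (- dot (fpt i j) x) * coef g (- fpt i j).
Proof.
move=> cg.
have cE i j : ccont (fun y => cexp2pi (- dot (- fpt i j) y) * g y).
  by apply: ccontM => //; exact: ccont_cexpN.
under eq_tint => y.
  rewrite /fejer mulr_sumr; under eq_bigr do rewrite mulr_sumr.
  over.
rewrite tint_sum; last first.
  move=> i; apply: ccont_sum => j; apply: ccontM => //.
  under eq_fun do rewrite dotDr cexpD mulrC.
  exact/ccontZ/ccont_cexp.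
apply: eq_bigr => i _; rewrite tint_sum; last first.
  move=> j; apply: ccontM => //.
  under eq_fun do rewrite dotDr cexpD mulrC.
  exact/ccontZ/ccont_cexp.
apply: eq_bigr => j _; rewrite /coef -tintZ//.
apply: eq_tint => y; rewrite dotNl opprK dotDr dotNr cexpD.
by ring.
Qed.

Lemma coef_one n (p : 'rV[int]_n) :
  coef (fun _ : 'rV[R]_n => 1) (- p) = if p == 0 then 1 else 0.
Proof.
rewrite -(@tint_cexp R); apply: eq_tint => x.
by rewrite mulr1 dotNl opprK.
Qed.

Lemma tint_fejer1 K x : torus_integral (fejer K x) = K%:R.
Proof.
have -> : torus_integral (fejer K x) = torus_integral (fun y => 1 * fejer K x y).
  by apply: eq_tint => y; rewrite mul1r.
rewrite tint_fejer; last exact: ccont_cst.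
rewrite -[K in RHS]card_ord -sumr_const; apply: eq_bigr => i _.
rewrite (bigD1 i)//= big1 ?addr0 => [|j ji].
  rewrite coef_one (_ : fpt i i = 0) ?eqxx; last first.
    by apply/rowP => k; rewrite !mxE subrr.
  by rewrite dot1 mxE mul0r oppr0 cexp0 mulr1.
rewrite coef_one (_ : (fpt i j == 0) = false) ?mulr0//.
apply/negbTE; apply: contra ji => /eqP/rowP/(_ 0); rewrite !mxE => /eqP.
by rewrite subr_eq0 => /eqP[] ij; apply/eqP/val_inj.
Qed.

Lemma ccont_fejer K x : ccont (fejer K x).
Proof.
apply: ccont_sum => i; apply: ccont_sum => j.
under eq_fun do rewrite dotDr cexpD mulrC.
exact/ccontZ/ccont_cexp.
Qed.

(** Fejer's argument: the product of [h] with the positive kernel [fejer K x]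
    has integral 0, while the kernel has mass [K] and is bounded, uniformly in
    [K], away from [x]. *)
Lemma fourier_uniqueness1 h (B : R) : ccont h -> Defs.periodic h ->
  (forall y, nm (h y) <= B) -> (forall p, coef h p = 0) -> forall x, h x = 0.
Proof.
move=> ch ph hB h0 x; apply: (@eq_small _ 3) => e e0; rewrite subr0.
have [M M0 hM] := periodic_modulus x e0 ch ph hB.
(* The mass [K] of the kernel outweighs the part [4 * M] away from [x]. *)
have [K K1 KM] : exists2 K : nat, 0 < K%:R :> R & 8 * M <= e * K%:R.
  exists (Num.truncn (8 * M / e)).+1; first by rewrite ltr0n.
  by rewrite [leRHS]mulrC -ler_pdivrMr// ltW// truncnS_gt.
have cf := ccont_fejer K x.
have E : h x * K%:R = torus_integral (fun y => (h x - h y) * fejer K x y).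
  have -> : torus_integral (fun y => (h x - h y) * fejer K x y)
    = torus_integral (fun y => h x * fejer K x y - h y * fejer K x y).
    by apply: eq_tint => y; rewrite mulrBl.
  rewrite tintB; [|exact: ccontZ|exact: ccontM].
  rewrite tintZ// tint_fejer1 tint_fejer// big1 ?subr0// => i _.
  by rewrite big1// => j _; rewrite h0 mulr0.
pose w y := e * complex.Re (fejer K x y) + 4 * M.
have cw : continuous w.
  by apply: contD; [apply: contZ; case: cf|exact: cont_cst].
have := tint_le_fun (ccontM (ccontB (ccont_cst 1 (h x)) ch) cf) cw.
rewrite -E nmM nm_nat.
have -> : cube_integral w = e * K%:R + 4 * M.
  rewrite /w cube_integralD; [|by apply: contZ; case: cf|exact: cont_cst].
  rewrite cube_integral_cst cube_integralZ; last by case: cf.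
  congr (e * _ + _).
  have := congr1 (@complex.Re R) (tint_fejer1 K x); rewrite /= => ->.
  by rewrite -[K%:R](rmorph_nat (real_complex R)).
move=> H; rewrite -(ler_pM2r K1); apply: (le_trans (H _)); last by lra.
move=> y; rewrite nmM fejerE nm_real /w fejerE /= ger0_norm ?sqr_ge0//.
have := ler_wpM2r (sqr_ge0 (nm (dirichlet K (y 0 0 - x 0 0)))) (hM y).
have := ler_wpM2l M0 (dirichlet_le K (y 0 0 - x 0 0)).
lra.
Qed.

End UniquenessLine.

(** * Uniqueness and inversion in several variables *)

Section FourierInversion.
Variable R : realType.

Lemma row_mx_cons n (x : 'rV[R]_(1 + n)) :
  x = cons_row (x 0 (lshift n ord0)) (rsubmx x).
Proof.
apply/rowP => i; case: (split_ordP i) => j ->.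
  by rewrite (ord1 j) cons_row0.
by rewrite cons_rowS mxE.
Qed.

Lemma cons_row_intl n (t : R) (y : 'rV[R]_n) (l : 'rV[int]_1) :
  cons_row t y + map_mx intr (row_mx l 0 : 'rV[int]_(1 + n))
  = cons_row (t + (l 0 0)%:~R) y.
Proof.
rewrite /cons_row map_row_mx add_row_mx; congr row_mx.
  by apply/rowP => i; rewrite (ord1 i) !mxE.
by apply/rowP => i; rewrite !mxE addr0.
Qed.

Definition pcons n (q : 'rV[int]_1) (p : 'rV[int]_n) : 'rV[int]_n.+1 :=
  row_mx q p.

Lemma dot_cons n q (p : 'rV[int]_n) (t : R) (y : 'rV[R]_n) :
  dot (pcons q p) (cons_row t y) = (q 0 0)%:~R * t + dot p y.
Proof.
rewrite /dot (@big_split_ord _ _ _ 1 n) big_ord1 /=; congr (_ + _).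
  by rewrite cons_row0 /pcons (row_mxEl q p).
by apply: eq_bigr => j _; rewrite cons_rowS /pcons (row_mxEr q p).
Qed.

Section Slices.
Variables (n : nat) (h : 'rV[R]_n.+1 -> R[i]).

Lemma slice_ccont t : ccont h -> ccont (fun y : 'rV[R]_n => h (cons_row t y)).
Proof.
move=> [h1 h2]; split.
- exact: (@slice_continuous R n (fun x => complex.Re (h x))).
- exact: (@slice_continuous R n (fun x => complex.Im (h x))).
Qed.

Lemma slice_periodic t : Defs.periodic h ->
  Defs.periodic (fun y : 'rV[R]_n => h (cons_row t y)).
Proof. by move=> ph y l; rewrite -cons_row_int ph. Qed.

(** A partial Fourier coefficient in all variables but the first. *)
Definition slice_coef (p : 'rV[int]_n) (z : 'rV[R]_1) : R[i] :=
  coef (fun y : 'rV[R]_n => h (cons_row (z 0 0) y)) p.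

Lemma ccont_slice_coef p : ccont h -> ccont (slice_coef p).
Proof.
move=> ch; have ce := ccont_cexpN R (pcons 0 p).
have [w1 w2] := ccontM ce ch.
have E (t : R) (y : 'rV[R]_n) : cexp2pi (- dot p y) * h (cons_row t y)
  = cexp2pi (- dot (pcons 0 p) (cons_row t y)) * h (cons_row t y).
  by rewrite dot_cons mxE mul0r add0r.
split.
- have cG := cube_integral_continuous w1.
  have -> : (fun z => complex.Re (slice_coef p z)) =
      (fun t : R => cube_integral (fun y : 'rV[R]_n => complex.Re
        (cexp2pi (- dot (pcons 0 p) (cons_row t y)) * h (cons_row t y))))
      \o (fun z : 'rV[R]_1 => z 0 0).
    apply/funext => z /=; congr cube_integral; apply/funext => y.
    by rewrite E.
  move=> z; apply: continuous_comp; first exact: coord_continuous.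
  exact: cG.
- have cG := cube_integral_continuous w2.
  have -> : (fun z => complex.Im (slice_coef p z)) =
      (fun t : R => cube_integral (fun y : 'rV[R]_n => complex.Im
        (cexp2pi (- dot (pcons 0 p) (cons_row t y)) * h (cons_row t y))))
      \o (fun z : 'rV[R]_1 => z 0 0).
    apply/funext => z /=; congr cube_integral; apply/funext => y.
    by rewrite E.
  move=> z; apply: continuous_comp; first exact: coord_continuous.
  exact: cG.
Qed.

Lemma slice_coef_periodic p : Defs.periodic h -> Defs.periodic (slice_coef p).
Proof.
move=> ph z l; apply: eq_tint => y; congr (_ * _).
rewrite -(ph (cons_row (z 0 0) y) (row_mx l 0 : 'rV_(1 + n))).
by rewrite cons_row_intl !mxE.
Qed.

Lemma coef_slice_coef p q : ccont h ->
  coef (slice_coef p) q = coef h (pcons q p).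
Proof.
move=> ch.
have E (t : R) : cexp2pi (- dot q (cons_row t (0 : 'rV[R]_0)))
      * slice_coef p (cons_row t (0 : 'rV[R]_0))
  = torus_integral (fun y : 'rV[R]_n =>
      cexp2pi (- dot (pcons q p) (cons_row t y)) * h (cons_row t y)).
  have t0 : (cons_row t (0 : 'rV[R]_0)) 0 0 = t.
    have := cons_row0 t (0 : 'rV[R]_0).
    by rewrite (_ : lshift 0 ord0 = 0)//; apply: val_inj.
  have cs := slice_ccont t ch; have ce := ccont_cexpN R p.
  rewrite /slice_coef /coef t0 -tintZ; last exact: ccontM.
  apply: eq_tint => y; rewrite dot1 t0 dot_cons opprD cexpD.
  by rewrite mulrA.
apply: complex_eq; rewrite [LHS]/=.
- transitivity (int01 (fun t : R => complex.Re (
     cexp2pi (- dot q (cons_row t (0 : 'rV[R]_0)))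
      * slice_coef p (cons_row t (0 : 'rV[R]_0))))); first by [].
  by rewrite [RHS]cube_integralS; congr int01; apply/funext => t; rewrite E.
- transitivity (int01 (fun t : R => complex.Im (
     cexp2pi (- dot q (cons_row t (0 : 'rV[R]_0)))
      * slice_coef p (cons_row t (0 : 'rV[R]_0))))); first by [].
  by rewrite [RHS]cube_integralS; congr int01; apply/funext => t; rewrite E.
Qed.

End Slices.

(** The partial Fourier coefficients in the last variables are functions of the
    first variable whose own coefficients vanish, so that they vanish by the
    one-dimensional case; the slices then vanish by induction. *)
Lemma fourier_uniqueness n (h : 'rV[R]_n -> R[i]) (B : R) :
  ccont h -> Defs.periodic h -> (forall x, nm (h x) <= B) ->
  (forall p, coef h p = 0) -> forall x, h x = 0.
Proof.
elim: n h B => [|n IH] h B ch ph hB h0 x.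
  have := h0 0; rewrite /coef /torus_integral /=.
  have -> : x = 0 by apply/rowP => -[].
  have -> : dot (0 : 'rV[int]_0) (0 : 'rV[R]_0) = 0 by rewrite /dot big_ord0.
  by rewrite oppr0 cexp0 mul1r; case: (h 0).
rewrite (@row_mx_cons n x); move: (x 0 _) (rsubmx _) => t.
apply: (IH (fun y => h (cons_row t y)) B).
- exact: slice_ccont.
- exact: slice_periodic.
- by [].
move=> p.
have := @fourier_uniqueness1 R (slice_coef h p) (2 * B)
  (ccont_slice_coef p ch) (slice_coef_periodic p ph) _ _ (const_mx t).
rewrite /slice_coef mxE; apply.
  move=> z; apply: tint_le.
    by apply: ccontM; [exact: ccont_cexpN|exact: slice_ccont].
  by move=> y; rewrite nmM nm_cexp mul1r.
by move=> q; rewrite coef_slice_coef.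
Qed.

(** The two sides have the same Fourier coefficients. *)
Lemma fourier_inversion n (h : 'rV[R]_n -> R[i]) (B : R) :
  ccont h -> Defs.periodic h -> (forall x, nm (h x) <= B) ->
  rapid (coef h) -> h = synth (coef h).
Proof.
move=> ch ph hB hr; have [D hD] := rapid_dominated hr.
have cs := ccont_synth hr.
apply/funext => x; apply/eqP; rewrite -subr_eq0; apply/eqP.
apply: (@fourier_uniqueness n (fun x => h x - synth (coef h) x) (B + D * 3 ^+ n)).
- exact: ccontB.
- by apply: periodicB => //; exact: synth_periodic.
- by move=> y; rewrite (le_trans (nmB _ _))// lerD// synth_le.
- by move=> p; rewrite coef_sub// coef_synth// subrr.
Qed.

End FourierInversion.

(** * Paths in the lattice *)

Section LatticeSteps.
Variables (n : nat).
Implicit Types (q k : 'rV[int]_n).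

Lemma nrm_eq0 q : nrm q = 0%N -> q = 0.
Proof.
move=> /eqP; rewrite sum_nat_eq0 => /forallP h.
by apply/rowP => j; rewrite mxE; apply/eqP; rewrite -absz_eq0; exact: h.
Qed.

Lemma nrm_step q m : nrm q = m.+1 ->
  exists j q', nrm q' = m /\ (q = q' + delta_mx 0 j \/ q' = q + delta_mx 0 j).
Proof.
move=> hq; have [j qj] : exists j, q 0 j != 0.
  apply/existsP; rewrite -negb_forall; apply/negP => /forallP h.
  by move: hq; rewrite /nrm big1// => j _; rewrite (eqP (h j)).
have E (r : int) q' : q' = q + r *: delta_mx 0 j ->
    absz (q 0 j) = (absz (q 0 j + r)).+1 -> nrm q' = m.
  move=> -> hr; apply/eqP; rewrite -eqSS -hq /nrm (bigD1 j)//= [in eqbRHS](bigD1 j)//= hr.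
  rewrite !mxE !eqxx mulr1 -addSn; apply/eqP; congr (_ + _)%N.
  by apply: eq_bigr => i ij; rewrite !mxE eqxx (negbTE ij) mulr0 addr0.
have [q0|q0] := leP 0 (q 0 j).
  exists j, (q - delta_mx 0 j); split; last by left; rewrite subrK.
  apply: (E (-1)); first by rewrite scaleN1r.
  by move: q0 qj; move: (q _ _) => i; lia.
exists j, (q + delta_mx 0 j); split; last by right.
apply: (E 1); first by rewrite scale1r.
by move: q0; move: (q _ _) => i; lia.
Qed.

End LatticeSteps.

(** * Weight functions and the inequality of Peetre *)

Section WeightFunctions.
Variables (R : realType) (n : nat) (mu : R) (Lam : 'rV[int]_n -> R).
Hypothesis hLam : weight_function mu Lam.
Implicit Types (q k : 'rV[int]_n).

Lemma Lam_gt0 k : 0 < Lam k.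
Proof. by case: hLam. Qed.

Lemma mu_gt0 : 0 < mu.
Proof.
case: hLam => _ [[mu0 [mu1 [C0 [C1 [[h1 h2 h3] _ _ _]]]]] _].
exact: lt_le_trans h1 (le_trans h2 h3).
Qed.

Lemma Lam_ge : exists2 c : R, 0 < c & forall k, c <= Lam k.
Proof.
case: hLam => _ [[mu0 [mu1 [C0 [C1 [[h1 _ _] c0 _ h]]]]] _].
exists C0 => // k; have [+ _] := h k; apply: le_trans.
rewrite ler_peMr ?(ltW c0)// -[leLHS](powRr0 (1 + enorm R k)).
by rewrite ler_powR ?(ltW h1)// lerDl sqrtr_ge0.
Qed.

Lemma enorm_coord k j : `|(k 0 j)%:~R : R| <= enorm R k.
Proof.
rewrite /enorm -[leLHS]sqrtr_sqr ler_sqrt ?sumr_ge0// => [|i _]; last exact: sqr_ge0.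
by rewrite (bigD1 j)//= lerDl sumr_ge0// => i _; rewrite sqr_ge0.
Qed.

Lemma enorm_le_jp k : 1 + enorm R k <= jp R k.
Proof.
rewrite /jp -natr1 addrC lerD2r /enorm.
rewrite -[leRHS]ger0_norm// -sqrtr_sqr ler_sqrt ?sqr_ge0// /nrm natr_sum.
have : forall s : seq 'I_n, \sum_(j <- s) (k 0 j)%:~R ^+ 2
    <= (\sum_(j <- s) (absz (k 0 j))%:R) ^+ 2 :> R.
  elim=> [|j s IH]; first by rewrite !big_nil expr0n.
  have s0 : 0 <= \sum_(i <- s) (absz (k 0 i))%:R :> R by apply: sumr_ge0.
  rewrite !big_cons sqrrD -[(k 0 j)%:~R ^+ 2]real_normK ?num_real//.
  rewrite -intr_norm -natr_absz addrAC -addrA lerD2l (le_trans IH)// lerDl.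
  by rewrite mulrn_wge0// mulr_ge0.
exact.
Qed.

Lemma jp_le_enorm k : jp R k <= n.+1%:R * (1 + enorm R k).
Proof.
have e0 : 0 <= enorm R k by exact: sqrtr_ge0.
rewrite /jp -natr1 /nrm natr_sum -[n.+1%:R]natr1 mulrDl mul1r.
apply: lerD; last by rewrite lerDl.
apply: (@le_trans _ _ (\sum_(j < n) (1 + enorm R k))).
  apply: ler_sum => j _; rewrite natr_absz intr_norm.
  by rewrite (le_trans (enorm_coord k j))// lerDr.
by rewrite sumr_const card_ord mulr_natl.
Qed.

Lemma Lam_diff : exists2 D : R, 0 < D & forall j k,
  `|Lam (k + delta_mx 0 j) - Lam k| <= D * Lam k `^ (1 - mu^-1).
Proof.
case: hLam => _ [_ h].
have {}h j : exists D : R, 0 < D /\ forall k,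
    `|Lam (k + delta_mx 0 j) - Lam k| <= D * Lam k `^ (1 - mu^-1).
  have [D D0 hD] := h (fun i => (i == j) : nat) (fun _ => false).
  exists D; split=> // k; have := hD k.
  have -> : mpow R k (fun _ => false) = 1 by rewrite /mpow big1.
  have -> : mlen (fun i => (i == j) : nat) = 1%N.
    by rewrite /mlen (bigD1 j)//= eqxx big1// => i /negbTE ->.
  rewrite mul1r mul1r; suff -> : mdiff (fun i => ((i == j) + false)%N) Lam = diff1 j Lam by [].
  rewrite /mdiff; have := enum_uniq 'I_n; have : j \in enum 'I_n by rewrite mem_enum.
  elim: (enum 'I_n) => [//|i s IH]; rewrite inE => /orP[/eqP <-|js] /= /andP[js' us].
    rewrite eqxx /=; congr diff1.
    elim: s js' {IH us} => [//|i' s IH]; rewrite inE negb_or eq_sym /= => /andP[/negbTE -> /IH].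
    by [].
  rewrite IH//; case: eqP js' => [->|_ _//]; by rewrite js.
have [D hD] := choice h.
exists (1 + \sum_j D j).
  by rewrite ltr_wpDr// sumr_ge0// => j _; rewrite ltW//; case: (hD j).
move=> j k; have [D0 {}/(_ k) h1] := hD j; apply: (le_trans h1).
rewrite ler_wpM2r ?powR_ge0// (bigD1 j)//= addrCA lerDl addr_ge0// sumr_ge0//.
by move=> i _; rewrite ltW//; case: (hD i).
Qed.

(** For an integer [r >= mu], the factorization of [Y ^+ r - X ^+ r] turns the
    bound on the differences of [Lam] into a Lipschitz bound for its [r]-th
    root. *)
Lemma Lam_root : exists (r : nat) (X : 'rV[int]_n -> R) (c D : R),
  [/\ forall k, Lam k = X k ^+ r, 0 < c, 0 <= D, forall k, c <= X k &
      forall j k, `|X (k + delta_mx 0 j) - X k| <= D].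
Proof.
have [c c0 hc] := Lam_ge; have [D D0 hD] := Lam_diff.
have m0 := mu_gt0.
(* An integer exponent at least [mu]; the lower bound [c] on [Lam] pays for the
   loss in the exponent from [mu^-1] to [r%:R^-1]. *)
pose r := (Num.truncn mu).+1.
have rmu : mu <= r%:R by exact/ltW/truncnS_gt.
have r0 : 0 < r%:R :> R by rewrite ltr0n.
pose X k := Lam k `^ r%:R^-1.
have XE k : Lam k = X k ^+ r.
  by rewrite -powR_mulrn ?powR_ge0// -powRrM mulVf ?gt_eqF// powRr1// ltW// Lam_gt0.
have X0 k : 0 < X k by rewrite powR_gt0// Lam_gt0.
exists r, X, (c `^ r%:R^-1), (D * c `^ (r%:R^-1 - mu^-1)).
split=> //.
- exact: powR_gt0.
- by rewrite mulr_ge0 ?powR_ge0// ltW.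
- move=> k; rewrite ge0_ler_powR ?nnegrE ?invr_ge0 ?(ltW r0) ?(ltW c0)//.
  by rewrite ltW// Lam_gt0.
move=> j k; set Y := X (k + _).
have Y0 : 0 < Y by exact: X0.
have h1 : `|Y ^+ r - X k ^+ r| <= D * Lam k `^ (1 - mu^-1).
  by rewrite -!XE.
have h2 : `|Y - X k| * X k ^+ r.-1 <= `|Y ^+ r - X k ^+ r|.
  rewrite subrXX normrM ler_wpM2l// ger0_norm; last first.
    by apply: sumr_ge0 => i _; rewrite mulr_ge0// exprn_ge0// ltW.
  rewrite big_ord_recr /= subnn expr0 mul1r lerDr.
  by apply: sumr_ge0 => i _; rewrite mulr_ge0// exprn_ge0// ltW.
have h3 : Lam k `^ (1 - mu^-1) <= c `^ (r%:R^-1 - mu^-1) * X k ^+ r.-1.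
  have -> : X k ^+ r.-1 = Lam k `^ (1 - r%:R^-1).
    rewrite -powR_mulrn ?powR_ge0// -powRrM; congr (_ `^ _).
    by rewrite /= mulrC -[(Num.truncn mu)%:R](addrK 1) natr1 mulrBl mulfV ?mul1r// gt_eqF.
  have -> : 1 - mu^-1 = (r%:R^-1 - mu^-1) + (1 - r%:R^-1) by ring.
  rewrite powRD; last by rewrite (gt_eqF (Lam_gt0 k)) implybT.
  rewrite ler_wpM2r ?powR_ge0//.
  have e0 : 0 <= mu^-1 - r%:R^-1 by rewrite subr_ge0 lef_pV2 ?posrE.
  rewrite -opprB !powRN lef_pV2 ?posrE ?powR_gt0 ?Lam_gt0//.
  by rewrite ge0_ler_powR ?nnegrE ?(ltW c0) ?(ltW (Lam_gt0 k)).
rewrite -(ler_pM2r (exprn_gt0 r.-1 (X0 k))) (le_trans h2)// (le_trans h1)//.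
by rewrite -mulrA ler_wpM2l// ltW.
Qed.

(** A positive Lipschitz function, bounded away from 0, changes between [k] and
    [k + q] by a factor that is at most linear in |q|. *)
Lemma Lam_slow : exists r A, 1 <= A /\
  forall k q, Lam (k + q) <= (A * jp R q) ^+ r * Lam k.
Proof.
have [r [X [c [D [XE c0 D0 Xc XD]]]]] := Lam_root.
exists r, (1 + D / c); split; first by rewrite lerDl divr_ge0// ltW.
have X0 k : 0 < X k by exact: lt_le_trans c0 (Xc k).
have lip m : forall k q, nrm q = m -> X (k + q) <= X k + D * m%:R.
  elim: m => [|m IH] k q hq; first by rewrite (nrm_eq0 hq) addr0 mulr0 addr0.
  have [j [q' [hq' [->|qq]]]] := nrm_step hq.
    have := IH k q' hq'; have := XD j (k + q').
    rewrite addrA ler_norml -natr1 mulrDr mulr1 => /andP[_]; lra.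
  have := IH k q' hq'; have := XD j (k + q).
  rewrite -addrA -qq ler_norml -natr1 mulrDr mulr1 => /andP[]; lra.
move=> k q; rewrite !XE -exprMn lerXn2r ?nnegrE ?(ltW (X0 _))//.
  by rewrite !mulr_ge0 ?(ltW (X0 _)) ?addr_ge0 ?divr_ge0 ?(ltW c0) ?(ltW (jp_gt0 _ _)).
apply: (le_trans (lip _ k q erefl)).
have h : D * (nrm q)%:R <= D / c * jp R q * X k.
  rewrite -2!mulrA ler_wpM2l// mulrCA.
  rewrite -[leLHS]mulr1 ler_pM//; first by rewrite ler_nat.
  by rewrite mulrC ler_pdivlMr// mul1r.
have j1 := jp_ge1 R q.
have := ler_wpM2r (ltW (X0 k)) j1; rewrite mul1r; move: h.
rewrite mulrDl mul1r mulrDl; lra.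
Qed.

(** Peetre's inequality. For negative [e] the roles of [k] and [k + q] are
    exchanged. *)
Lemma Lam_peetre e : exists P M, [/\ 0 <= P &
  forall k q, Lam (k + q) `^ e <= P * jp R q ^+ M * Lam k `^ e].
Proof.
have [r [A [A1 hA]]] := Lam_slow.
pose M := (Num.truncn (r%:R * `|e|)).+1.
have A0 : 0 <= A by rewrite (le_trans ler01).
exists (A ^+ M), M; split; first exact: exprn_ge0.
move=> k q; rewrite -exprMn; set B := A * jp R q.
have B1 : 1 <= B by rewrite -[leLHS]mulr1 ler_pM// jp_ge1.
have B0 : 0 < B by rewrite (lt_le_trans ltr01).
have h1 : Lam (k + q) <= B ^+ r * Lam k by exact: hA.
have h2 : Lam k <= B ^+ r * Lam (k + q).
  by have := hA (k + q) (- q); rewrite addrK jpN.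
have L1 := Lam_gt0 k; have L2 := Lam_gt0 (k + q).
have hB (s : R) : 0 <= s -> s <= `|e| -> (B ^+ r) `^ s <= B ^+ M.
  move=> s0 se; rewrite -powR_mulrn ?(ltW B0)// -powRrM -powR_mulrn ?(ltW B0)//.
  rewrite ler_powR// (le_trans (ler_wpM2l (ler0n _ r) se))//.
  exact/ltW/truncnS_gt.
have [e0|e0] := leP 0 e.
  apply: (@le_trans _ _ ((B ^+ r * Lam k) `^ e)).
    by rewrite ge0_ler_powR ?nnegrE ?(ltW L2)// mulr_ge0 ?exprn_ge0 ?(ltW B0) ?(ltW L1) ?(ltW L2).
  rewrite powRM ?exprn_ge0 ?(ltW B0) ?(ltW L1) ?(ltW L2)// ler_wpM2r ?powR_ge0// hB//.
  exact: ler_norm.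
pose s := - e; have s0 : 0 <= s by rewrite oppr_ge0 ltW.
have E x : x `^ e = (x `^ s)^-1 by rewrite -powRN opprK.
rewrite !E ler_pdivlMr ?powR_gt0// mulrC ler_pdivrMr ?powR_gt0//.
apply: (@le_trans _ _ ((B ^+ r * Lam (k + q)) `^ s)).
  by rewrite ge0_ler_powR ?nnegrE ?(ltW L1)// mulr_ge0 ?exprn_ge0 ?(ltW B0) ?(ltW L2).
rewrite powRM ?exprn_ge0 ?(ltW B0) ?(ltW L2)// ler_wpM2r ?powR_ge0// hB//.
by rewrite -normrN ler_norm.
Qed.

(** Peetre's inequality between the origin and [k]. *)
Lemma Lam_poly e : exists P M, [/\ 0 <= P & forall k, Lam k `^ e <= P * jp R k ^+ M].
Proof.
have [P [M [P0 h]]] := Lam_peetre e.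
exists (P * Lam 0 `^ e), M; split; first by rewrite mulr_ge0// powR_ge0.
by move=> k; have := h 0 k; rewrite add0r mulrAC.
Qed.

(** The weight is bounded below, so that the symbol classes increase with the
    order. *)
Lemma Lam_mono (a b : R) : a <= b ->
  exists2 P, 0 <= P & forall k, Lam k `^ a <= P * Lam k `^ b.
Proof.
move=> ab; have [c c0 hc] := Lam_ge.
exists (c `^ (a - b)); first exact: powR_ge0.
move=> k; have L := Lam_gt0 k.
have -> : Lam k `^ a = Lam k `^ (a - b) * Lam k `^ b.
  by rewrite -powRD ?subrK// (gt_eqF L) implybT.
rewrite ler_wpM2r ?powR_ge0// -opprB !powRN lef_pV2 ?posrE ?powR_gt0//.
by rewrite ge0_ler_powR ?nnegrE ?subr_ge0 ?(ltW c0) ?(ltW L).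
Qed.

End WeightFunctions.

(** * Difference operators on the lattice *)

Section DifferenceOperators.
Variables (n : nat) (V : comNzRingType).
Implicit Types (f g : 'rV[int]_n -> V) (k q : 'rV[int]_n) (s w : seq 'I_n).

(** Differences along a list of directions, on which inductions are easier than
    on a multi-index. *)
Definition diffs s f := foldr (@diff1 n V) f s.

Definition theta j f : 'rV[int]_n -> V := fun k => (k 0 j)%:~R * diff1 j f k.

Definition thetas w f := foldl (fun g j => theta j g) f w.

Definition translate q f : 'rV[int]_n -> V := fun k => f (k + q).

Lemma diff1C i j f : diff1 i (diff1 j f) = diff1 j (diff1 i f).
Proof. by apply/funext => k; rewrite /diff1 (addrAC k); ring. Qed.

Lemma diff1D j f g : diff1 j (fun k => f k + g k) = (fun k => diff1 j f k + diff1 j g k).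
Proof. by apply/funext => k; rewrite /diff1; ring. Qed.

Lemma diff1Z j (z : V) f : diff1 j (fun k => z * f k) = (fun k => z * diff1 j f k).
Proof. by apply/funext => k; rewrite /diff1; ring. Qed.

Lemma diff1_shift j q f : diff1 j (translate q f) = translate q (diff1 j f).
Proof. by apply/funext => k; rewrite /diff1 /translate (addrAC k). Qed.

Lemma diffsD s f g : diffs s (fun k => f k + g k) = (fun k => diffs s f k + diffs s g k).
Proof. by elim: s => //= j s ->; rewrite diff1D. Qed.

Lemma diffsZ s (z : V) f : diffs s (fun k => z * f k) = (fun k => z * diffs s f k).
Proof. by elim: s => //= j s ->; rewrite diff1Z. Qed.

Lemma diffs_shift s q f : diffs s (translate q f) = translate q (diffs s f).
Proof. by elim: s => //= j s ->; rewrite diff1_shift. Qed.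

Lemma diffs_rcons s j f : diffs s (diff1 j f) = diffs (rcons s j) f.
Proof. by rewrite /diffs foldr_rcons. Qed.

Lemma diffs_diff1 s j f : diff1 j (diffs s f) = diffs s (diff1 j f).
Proof. by elim: s => //= i s IH; rewrite diff1C IH. Qed.

Lemma thetaD j f g : theta j (fun k => f k + g k) = (fun k => theta j f k + theta j g k).
Proof. by apply/funext => k; rewrite /theta diff1D mulrDr. Qed.

Lemma thetaZ j (z : V) f : theta j (fun k => z * f k) = (fun k => z * theta j f k).
Proof. by apply/funext => k; rewrite /theta diff1Z mulrCA. Qed.

Lemma thetasD w f g : thetas w (fun k => f k + g k) = (fun k => thetas w f k + thetas w g k).
Proof. by elim: w f g => //= j w IH f g; rewrite thetaD IH. Qed.

Lemma thetasZ w (z : V) f : thetas w (fun k => z * f k) = (fun k => z * thetas w f k).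
Proof. by elim: w f => //= j w IH f; rewrite thetaZ IH. Qed.

Lemma theta_shift j q f : theta j (translate q f) =
  (fun k => translate q (theta j f) k + - (q 0 j)%:~R * translate q (diff1 j f) k).
Proof.
apply/funext => k; rewrite /theta diff1_shift /translate mxE intrD.
by ring.
Qed.

Lemma theta_diff1 i j f : i != j -> theta i (diff1 j f) = diff1 j (theta i f).
Proof.
move=> ij; apply/funext => k; rewrite /theta diff1C.
by rewrite {3}/diff1 mxE mxE eqxx (negbTE ij) addr0 /diff1; ring.
Qed.

Lemma theta_diff1_same j f : theta j (diff1 j f) =
  (fun k => diff1 j (theta j f) k + - 1 * translate (delta_mx 0 j) (diff1 j f) k).
Proof.
apply/funext => k; rewrite /theta /translate /diff1 !mxE !eqxx /= intrD mulr1z.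
by ring.
Qed.

Lemma mdiff_diffs (a : 'I_n -> nat) :
  exists2 s, size s = mlen a & forall f, mdiff a f = diffs s f.
Proof.
exists (flatten [seq nseq (a j) j | j <- enum 'I_n]) => [|f].
  rewrite size_flatten sumnE big_map big_map /mlen -big_enum /=.
  by apply: eq_bigr => j _; rewrite size_nseq.
rewrite /mdiff; elim: (enum 'I_n) => //= j s ->.
by rewrite /diffs foldr_cat; elim: (a j) => //= m ->.
Qed.

Lemma mdiff_delta (a : 'I_n -> nat) j f :
  mdiff (fun i => (a i + (i == j))%N) f = mdiff a (diff1 j f).
Proof.
have comm i m g : iter m (diff1 i) (diff1 j g) = diff1 j (iter m (diff1 i) g).
  by elim: m => //= m ->; rewrite diff1C.
have commf s g : foldr (fun i h => iter (a i) (diff1 i) h) (diff1 j g) s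
   = diff1 j (foldr (fun i h => iter (a i) (diff1 i) h) g s).
  by elim: s => //= i s ->; rewrite comm.
have out s : j \notin s ->
    foldr (fun i h => iter (a i + (i == j))%N (diff1 i) h) f s
    = foldr (fun i h => iter (a i) (diff1 i) h) f s.
  elim: s => //= i s IH; rewrite inE negb_or eq_sym => /andP[/negbTE -> /IH ->].
  by rewrite addn0.
rewrite /mdiff; have := enum_uniq 'I_n; have := mem_enum 'I_n j; rewrite inE.
elim: (enum 'I_n) => //= i s IH; rewrite inE => /orP[/eqP <-|js] /andP[js' us].
  by rewrite eqxx addn1 out// commf iterS -comm -iterSr iterS.
rewrite IH//; case: eqP js' => [->|_ _]; first by rewrite js.
by rewrite addn0.
Qed.

Lemma mdiff0 (a : 'I_n -> nat) f : (forall j, a j = 0%N) -> mdiff a f = f.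
Proof.
by move=> a0; rewrite /mdiff; elim: (enum 'I_n) => //= j s ->; rewrite a0.
Qed.

Lemma mlen_delta (a : 'I_n -> nat) j :
  mlen (fun i => (a i + (i == j))%N) = (mlen a).+1.
Proof.
rewrite /mlen big_split /= -[RHS]addn1; congr (_ + _)%N.
by rewrite (bigD1 j)//= eqxx big1// => i /negbTE ->.
Qed.

Lemma diffs_mdiff s :
  exists2 a : 'I_n -> nat, mlen a = size s & forall f, diffs s f = mdiff a f.
Proof.
elim: s => [|j s [a ha E]].
  by exists (fun _ => 0%N) => [|f]; rewrite ?mdiff0// /mlen big1.
exists (fun i => (a i + (i == j))%N) => [|f]; first by rewrite mlen_delta ha.
by rewrite mdiff_delta -E /= diffs_diff1.
Qed.

(** For distinct indices the factors [k_j] and [Delta_i] commute, which turns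
    [k^g Delta^g] into a composition of the operators [theta]. *)
Lemma mpow_mdiff (g : 'I_n -> bool) f k :
  mpow V k g * mdiff g f k = thetas (rev [seq j <- enum 'I_n | g j]) f k.
Proof.
rewrite /thetas foldl_rev /mpow -big_enum /mdiff /=.
have := enum_uniq 'I_n; elim: (enum 'I_n) k => [|j s IH] k /=.
  by rewrite big_nil mul1r.
move=> /andP[js us]; rewrite big_cons.
case: (g j) => /=; last by rewrite expr0 mul1r IH.
rewrite expr1 /theta -mulrA; congr (_ * _).
rewrite /diff1 mulrBr; congr (_ - _); last exact: IH.
rewrite -IH//; congr (_ * _); apply: eq_big_seq => i si.
rewrite !mxE eqxx; case: eqP si => [->|_ _]; first by rewrite (negbTE js).
by rewrite addr0.
Qed.

End DifferenceOperators.

(** * Symbol classes of Fourier coefficients *)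

Section SymbolClasses.
Variables (R : realType) (n : nat) (mu : R) (Lam : 'rV[int]_n -> R).
Hypothesis hLam : weight_function mu Lam.
Variable rho : R.
Hypothesis rho_ge0 : 0 <= rho.
Implicit Types (k q : 'rV[int]_n) (s w l : seq 'I_n) (m : R).

(** The image of the class S under the Fourier transform in [x]: the family is
    a symbol of order [m] in [k], with rapid decay in the size of the index.
    The index is the frequency [p], possibly with further data such as a shift
    [q] of size at most that of [p]; the constants may not depend on it. *)
Definition Scl (I : Type) (sz : I -> R) m (u : I -> 'rV[int]_n -> R[i]) :=
  forall s N, exists C : R, forall i k,
    nm (diffs s (u i) k) * sz i ^+ N <= C * Lam k `^ (m - rho * (size s)%:R).

(** The image of the class M: the operators [theta j = k_j Delta_j], each
    applied at most once for [j] in [l], keep the family in the class S. *)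
Definition Mcl (I : Type) (sz : I -> R) l m (u : I -> 'rV[int]_n -> R[i]) :=
  forall w, subseq w l -> Scl sz m (fun i => thetas w (u i)).

Section Closure.
Variables (I : Type) (sz : I -> R).
Hypothesis sz1 : forall i, 1 <= sz i.
Implicit Types (u v : I -> 'rV[int]_n -> R[i]).

Let sz0 i N : 0 <= sz i ^+ N.
Proof. by rewrite exprn_ge0// (le_trans ler01). Qed.

Let pw0 k m : 0 < Lam k `^ m.
Proof. by rewrite powR_gt0// (Lam_gt0 hLam). Qed.

Lemma Scl_diff m u j : Scl sz m u -> Scl sz (m - rho) (fun i => diff1 j (u i)).
Proof.
move=> h s N; have [C hC] := h (rcons s j) N; exists C => i k.
have -> : m - rho - rho * (size s)%:R = m - rho * (size (rcons s j))%:R.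
  by rewrite size_rcons -natr1; ring.
by rewrite diffs_rcons.
Qed.

Lemma Scl_le m m' u : m <= m' -> Scl sz m u -> Scl sz m' u.
Proof.
move=> mm h s N; have [C hC] := h s N.
have mm' : m - rho * (size s)%:R <= m' - rho * (size s)%:R by rewrite lerD2r.
have [P P0 hP] := Lam_mono hLam mm'.
exists (C * P) => i k; apply: (le_trans (hC i k)).
have C0 : 0 <= C.
  by have := le_trans (mulr_ge0 (nm_ge0 _) (sz0 i N)) (hC i k); rewrite pmulr_lge0.
by rewrite -mulrA ler_wpM2l.
Qed.

(** A shift by [q i] costs powers of [jp (q i)], by Peetre's inequality, and
    these are absorbed by the rapid decay in [sz i]. *)
Lemma Scl_shift m u (q : I -> 'rV[int]_n) (A : R) :
  (forall i, jp R (q i) <= A * sz i) -> Scl sz m u ->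
  Scl sz m (fun i => translate (q i) (u i)).
Proof.
move=> hq h s N; have [P [M [P0 hP]]] := Lam_peetre hLam (m - rho * (size s)%:R).
have [C hC] := h s (M + N)%N.
exists (C * P * A ^+ M) => i k; rewrite diffs_shift /translate.
have hh := hC i (k + q i).
have C0 : 0 <= C.
  have := le_trans (mulr_ge0 (nm_ge0 _) (sz0 i (M + N))) hh.
  by rewrite pmulr_lge0.
have j0 : 0 <= jp R (q i) ^+ M by rewrite exprn_ge0// ltW// jp_gt0.
have sM : 0 < sz i ^+ M by rewrite exprn_gt0// (lt_le_trans ltr01).
rewrite -(ler_pM2r sM); rewrite exprD in hh.
have h1 := ler_wpM2l C0 (hP k (q i)).
have h2 : jp R (q i) ^+ M <= A ^+ M * sz i ^+ M.
  rewrite -exprMn lerXn2r ?nnegrE ?(ltW (jp_gt0 _ _))//.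
  by rewrite (le_trans (ltW (jp_gt0 R (q i)))).
have CP : 0 <= C * P * Lam k `^ (m - rho * (size s)%:R).
  by rewrite !mulr_ge0// ltW.
by have := ler_wpM2l CP h2; lra.
Qed.

Lemma Scl_scale m u (g : I -> R[i]) (A : R) M :
  (forall i, nm (g i) <= A * sz i ^+ M) -> Scl sz m u ->
  Scl sz m (fun i k => g i * u i k).
Proof.
move=> hg h s N; have [C hC] := h s (M + N)%N; exists (A * C) => i k.
have A0 : 0 <= A.
  have := le_trans (nm_ge0 _) (hg i).
  by rewrite pmulr_lge0// exprn_gt0// (lt_le_trans ltr01).
rewrite diffsZ nmM.
have := ler_wpM2r (mulr_ge0 (nm_ge0 (diffs s (u i) k)) (sz0 i N)) (hg i).
have := ler_wpM2l A0 (hC i k); rewrite exprD; lra.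
Qed.

Lemma Scl_add m u v : Scl sz m u -> Scl sz m v ->
  Scl sz m (fun i k => u i k + v i k).
Proof.
move=> hu hv s N; have [C hC] := hu s N; have [D hD] := hv s N.
exists (C + D) => i k; rewrite diffsD.
have := lerD (hC i k) (hD i k).
have := ler_wpM2r (sz0 i N) (nmD (diffs s (u i) k) (diffs s (v i) k)).
lra.
Qed.

Lemma Mcl_nil m u : Mcl sz [::] m u <-> Scl sz m u.
Proof.
split=> [h|h w]; first exact: (h [::]).
by rewrite subseq0 => /eqP ->.
Qed.

Lemma Mcl_cons j l m u : Mcl sz (j :: l) m u <->
  Mcl sz l m u /\ Mcl sz l m (fun i => theta j (u i)).
Proof.
split=> [h|[h1 h2] [|x w]].
- split=> w wl; first exact: h (subseq_trans wl (subseq_cons l j)).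
  by apply: (h (j :: w)); rewrite /= eqxx.
- by move=> _; exact: (h1 [::] (sub0seq l)).
by rewrite /=; case: eqP => [-> /h2|_ /h1].
Qed.

Lemma Mcl_Scl l m u : Mcl sz l m u -> Scl sz m u.
Proof. by move=> h; apply: (h [::]); exact: sub0seq. Qed.

Lemma Mcl_le l m m' u : m <= m' -> Mcl sz l m u -> Mcl sz l m' u.
Proof. by move=> mm h w /h; exact: Scl_le. Qed.

Lemma Mcl_add l m u v : Mcl sz l m u -> Mcl sz l m v ->
  Mcl sz l m (fun i k => u i k + v i k).
Proof.
move=> hu hv w wl; under [X in Scl _ _ X]eq_fun do rewrite thetasD.
exact: Scl_add (hu w wl) (hv w wl).
Qed.

Lemma Mcl_scale l m u (g : I -> R[i]) (A : R) M :
  (forall i, nm (g i) <= A * sz i ^+ M) -> Mcl sz l m u ->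
  Mcl sz l m (fun i k => g i * u i k).
Proof.
move=> hg hu w wl; under [X in Scl _ _ X]eq_fun do rewrite thetasZ.
exact: Scl_scale hg (hu w wl).
Qed.

(** Commuting [theta] with a shift produces an error term with a difference,
    and commuting it with a difference one with a shift. The two statements are
    therefore proved together, by induction on the number of operators
    [theta]. *)
Lemma Mcl_shift_diff l :
  (forall m u (q : I -> 'rV[int]_n) (A : R),
     (forall i, jp R (q i) <= A * sz i) -> Mcl sz l m u ->
     Mcl sz l m (fun i => translate (q i) (u i))) /\
  (forall m u j, Mcl sz l m u -> Mcl sz l (m - rho) (fun i => diff1 j (u i))).
Proof.
elim: l => [|a l [IHs IHd]].
  split=> [m u q A hq /Mcl_nil h|m u j /Mcl_nil h]; apply/Mcl_nil.
    exact: Scl_shift hq h.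
  exact: Scl_diff.
have low m : m - rho <= m by rewrite gerBl.
have one : forall i : I, jp R (delta_mx 0 a : 'rV[int]_n) <= 2 * sz i.
  by move=> i; rewrite /jp nrm_delta ler_peMr.
split=> [m u q A hq /Mcl_cons[h1 h2]|m u j /Mcl_cons[h1 h2]]; apply/Mcl_cons.
  split; first exact: IHs hq h1.
  under [X in Mcl _ _ _ X]eq_fun do rewrite theta_shift.
  apply: Mcl_add; first exact: IHs hq h2.
  apply: (@Mcl_scale _ _ _ (fun i => - (q i 0 a)%:~R) A 1).
    move=> i; rewrite nmN nm_int expr1 (le_trans _ (hq i))// ler_nat.
    exact: leqW (coord_le_nrm (q i) a).
  have hd : Mcl sz l m (fun i => diff1 a (u i)).
    exact: Mcl_le (low m) (IHd _ _ a h1).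
  exact: IHs hq hd.
split; first exact: IHd.
have [<-|aj] := eqVneq a j; last first.
  by under [X in Mcl _ _ _ X]eq_fun do rewrite theta_diff1//; exact: IHd.
under [X in Mcl _ _ _ X]eq_fun do rewrite theta_diff1_same.
apply: Mcl_add; first exact: IHd.
apply: (@Mcl_scale _ _ _ (fun _ => -1) 1 0).
  by move=> i; rewrite nmN nm1 expr0 mulr1.
exact: (IHs _ _ (fun _ => delta_mx 0 a) 2 one (IHd _ _ a h1)).
Qed.

Lemma Mcl_shift l m u (q : I -> 'rV[int]_n) (A : R) :
  (forall i, jp R (q i) <= A * sz i) -> Mcl sz l m u ->
  Mcl sz l m (fun i => translate (q i) (u i)).
Proof. by have [h _] := Mcl_shift_diff l; exact: h. Qed.

Lemma Mcl_diff l m u j :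
  Mcl sz l m u -> Mcl sz l (m - rho) (fun i => diff1 j (u i)).
Proof. by have [_ h] := Mcl_shift_diff l; exact: h. Qed.

End Closure.

Lemma Mcl_reindex (I J : Type) (sz : I -> R) (phi : J -> I) l m
    (u : I -> 'rV[int]_n -> R[i]) :
  Mcl sz l m u -> Mcl (sz \o phi) l m (u \o phi).
Proof.
move=> h w wl s N; have [C hC] := h w wl s N.
by exists C => j k; exact: hC.
Qed.

Lemma Mcl_fin (I : Type) (sz : I -> R) (T : finType) l m
    (u : I * T -> 'rV[int]_n -> R[i]) : (forall i, 1 <= sz i) ->
  (forall t, Mcl sz l m (fun i => u (i, t))) -> Mcl (fun x => sz x.1) l m u.
Proof.
move=> sz1 h w wl s N.
have /choice[C hC] : forall t, exists C : R, forall i k,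
    nm (diffs s (thetas w (u (i, t))) k) * sz i ^+ N
      <= C * Lam k `^ (m - rho * (size s)%:R).
  by move=> t; exact: h t w wl s N.
exists (\sum_t `|C t|) => -[i t] k /=; apply: (le_trans (hC t i k)).
rewrite ler_wpM2r ?powR_ge0// (le_trans (ler_norm _))//.
by rewrite (bigD1 t)//= lerDl sumr_ge0.
Qed.

End SymbolClasses.

(** * The multivariate forward difference formula of Newton *)

Section DiscreteTaylor.
Variables (R : realType) (n : nat).
Implicit Types (f : 'rV[int]_n -> R[i]) (k q : 'rV[int]_n) (a : 'I_n -> nat).

(** The binomial coefficient of [q] over [a], for [q] of any sign. *)
Definition mbin q a : R[i] := (mfact a)%:R^-1 * mff R q a.

(** The remainder of Newton's forward difference formula for [f (k + q)]. *)
Definition taylor_rem N q f : 'rV[int]_n -> R[i] := fun k =>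
  f (k + q) - \sum_(a : {ffun 'I_n -> 'I_N} | (mlen (box_index a) < N)%N)
                mbin q (box_index a) * mdiff (box_index a) f k.

Lemma ff_succ (i : int) l : ff R (i + 1) l.+1 = (i + 1)%:~R * ff R i l.
Proof.
elim: l => [|l IH]; first by rewrite ffS !ff0 subr0.
by rewrite ffS IH ffS -natr1 intrD mulr1z; ring.
Qed.

Lemma ff_pascal (i : int) l :
  ff R (i + 1) l.+1 - ff R i l.+1 = l.+1%:R * ff R i l.
Proof. by rewrite ff_succ ffS -natr1 intrD mulr1z; ring. Qed.

Lemma mbin_pascal0 q a j : a j = 0%N -> mbin (q + delta_mx 0 j) a = mbin q a.
Proof.
move=> aj; congr (_ * _); apply: eq_bigr => i _; rewrite !mxE eqxx /=.
by case: eqP => [->|_]; rewrite ?aj ?ff0// addr0.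
Qed.

Lemma mbin_pascal q a j (b := fun i => (a i + (i == j))%N) :
  mbin (q + delta_mx 0 j) b - mbin q b = mbin q a.
Proof.
rewrite /mbin -mulrBr.
have -> : mff R (q + delta_mx 0 j) b - mff R q b = (a j).+1%:R * mff R q a.
  rewrite /mff (bigD1 j)//= [X in _ - X](bigD1 j)//= [in RHS](bigD1 j)//= /b.
  rewrite eqxx addn1 !mxE !eqxx /= mulrA -ff_pascal mulrBl.
  congr (_ * _ - _ * _); apply: eq_bigr => i /negbTE ij.
    by rewrite !mxE ij andbF addr0 addn0.
  by rewrite ij addn0.
have -> : (mfact b)%:R = (a j).+1%:R * (mfact a)%:R :> R[i].
  rewrite -natrM /mfact (bigD1 j)//= [in RHS](bigD1 j)//= /b eqxx addn1 factS.
  rewrite mulnA; congr (_ * _)%:R; apply: eq_bigr => i /negbTE ->.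
  by rewrite addn0.
by rewrite invfM mulrACA mulVf ?mul1r// pnatr_eq0.
Qed.

(** Pascal's rule: the increment in [q] of the Newton polynomial of order
    [N.+1] is the Newton polynomial of order [N] of the difference. *)
Lemma taylor_sum_step N q f j k :
  \sum_(a : {ffun 'I_n -> 'I_N.+1} | (mlen (box_index a) < N.+1)%N)
     (mbin (q + delta_mx 0 j) (box_index a) - mbin q (box_index a))
       * mdiff (box_index a) f k
  = \sum_(a : {ffun 'I_n -> 'I_N} | (mlen (box_index a) < N)%N)
      mbin q (box_index a) * mdiff (box_index a) (diff1 j f) k.
Proof.
case: N => [|N].
  rewrite big1 => [|a _]; last first.
    rewrite mbin_pascal0 ?subrr ?mul0r//.
    by rewrite /box_index; case: (a j) => -[|].
  by rewrite big1// => a; rewrite ltn0.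
rewrite (bigID (fun a : {ffun 'I_n -> 'I_N.+2} => (0 < a j)%N)) /=.
rewrite [X in _ + X]big1 ?addr0; last first.
  move=> a /andP[_]; rewrite -eqn0Ngt => /eqP aj.
  by rewrite mbin_pascal0 ?subrr ?mul0r.
(* [up] adds the unit vector [j]; [down] removes it, and is its inverse on the
   multi-indices with a positive entry at [j], the only ones that contribute. *)
pose up (a : {ffun 'I_n -> 'I_N.+1}) : {ffun 'I_n -> 'I_N.+2} :=
  [ffun i => inord (a i + (i == j))].
pose down (a : {ffun 'I_n -> 'I_N.+2}) : {ffun 'I_n -> 'I_N.+1} :=
  [ffun i => inord (a i - (i == j))].
have upE (a : {ffun 'I_n -> 'I_N.+1}) i : up a i = (a i + (i == j))%N :> nat.
  by rewrite ffunE inordK//; have := ltn_ord (a i); case: (i == j); lia.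
have box_up (a : {ffun 'I_n -> 'I_N.+1}) : box_index (up a) = (fun i => (box_index a i + (i == j))%N).
  by apply/funext => i; exact: upE.
have downE (a : {ffun 'I_n -> 'I_N.+2}) i : (mlen (box_index a) < N.+2)%N ->
    (0 < a j)%N -> down a i = (a i - (i == j))%N :> nat.
  move=> ha aj; rewrite ffunE inordK//.
  case: eqP => [->|ij]; first by have := ltn_ord (a j); lia.
  have : (a i + a j <= mlen (box_index a))%N.
    rewrite /mlen (bigD1 i)//= (bigD1 j)/=; last by apply/eqP => /esym.
    by rewrite /box_index addnA leq_addr.
  by move: ha aj; rewrite /=; lia.
rewrite (reindex_onto up down) /=; last first.
  move=> a /andP[ha aj]; apply/ffunP => i; apply/val_inj; rewrite /= upE downE//.
  by case: eqP => [->|_] /=; lia.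
apply: eq_big => [a|a _]; last by rewrite box_up mbin_pascal mdiff_delta.
have aj : (0 < up a j)%N by rewrite upE eqxx addn1.
rewrite aj andbT box_up mlen_delta ltnS.
case: (boolP (mlen (box_index a) < N.+1)%N) => //= ha.
apply/eqP/ffunP => i; apply/val_inj; rewrite /= downE//.
  by rewrite upE addnK.
by rewrite box_up mlen_delta ltnS.
Qed.

Lemma taylor_rem_step N q f j : taylor_rem N.+1 (q + delta_mx 0 j) f
  = (fun k => taylor_rem N.+1 q f k + taylor_rem N q (diff1 j f) k).
Proof.
apply/funext => k; rewrite /taylor_rem -taylor_sum_step.
under [X in _ = _ + (_ - X)]eq_bigr do rewrite mulrBl.
rewrite sumrB /diff1 addrA.
set A := \sum_(_ | _) _; set B := \sum_(_ | _) _.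
by ring.
Qed.

Lemma taylor_rem_zero N f : taylor_rem N.+1 0 f = (fun _ => 0).
Proof.
apply/funext => k; rewrite /taylor_rem addr0.
rewrite (bigD1 [ffun _ => ord0])/=; last by rewrite /mlen big1// => i _; rewrite /box_index ffunE.
rewrite big1 => [|a /andP[_ a0]].
  rewrite addr0 mdiff0; last by move=> j; rewrite /box_index ffunE.
  rewrite /mbin /mff /mfact !big1 ?mulr1 ?invr1 ?mul1r ?subrr// => i _;
    by rewrite /box_index ffunE ?ff0.
have [j aj] : exists j, a j != ord0.
  apply/existsP; rewrite -negb_forall; apply: contra a0 => /forallP h.
  by apply/eqP/ffunP => j; rewrite ffunE; apply/eqP; exact: h.
rewrite /mbin /mff (bigD1 j)//= mxE /box_index.
case: (a j) aj => -[//|l] hl _ /=.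
by rewrite /ff big_ord_recl /= subrr !mul0r mulr0 mul0r.
Qed.

Lemma taylor_rem_order0 q f : taylor_rem 0 q f = translate q f.
Proof.
apply/funext => k; rewrite /taylor_rem big_pred0 ?subr0//.
Qed.

End DiscreteTaylor.

(** * The remainder as a symbol *)

Section TaylorRemainder.
Variables (R : realType) (n : nat) (mu : R) (Lam : 'rV[int]_n -> R).
Hypothesis hLam : weight_function mu Lam.
Variable rho : R.
Hypothesis rho_ge0 : 0 <= rho.

(** The remainder of order [N.+1] at [q] is a sum, along a lattice path from 0
    to [q], of remainders of order [N] of first differences. *)
Lemma Mcl_taylor_rem N (I : Type) (sz : I -> R) (q : I -> 'rV[int]_n) (A : R) m l
    (u : I -> 'rV[int]_n -> R[i]) : (forall i, 1 <= sz i) ->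
  (forall i, jp R (q i) <= A * sz i) -> Mcl Lam rho sz l m u ->
  Mcl Lam rho sz l (m - rho * N%:R) (fun i => taylor_rem N (q i) (u i)).
Proof.
elim: N I sz q A m u => [|N IH] I sz q A m u sz1 hq hu.
  rewrite mulr0 subr0; under eq_fun do rewrite taylor_rem_order0.
  exact: (Mcl_shift hLam rho_ge0 sz1 hq hu).
(* The index is enlarged by a direction and by a point of the path, which stays
   in the ball of radius |q|, so that the induction hypothesis gives a bound
   uniform along the path. *)
pose J := {x : (I * 'I_n) * 'rV[int]_n | (nrm x.2 <= nrm (q x.1.1))%N}.
pose szJ (x : J) := sz (sval x).1.1.
pose v (x : I * 'I_n) := diff1 x.2 (u x.1).
have hv : Mcl Lam rho (fun x : I * 'I_n => sz x.1) l (m - rho) v.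
  by apply: Mcl_fin => // j; exact: (Mcl_diff hLam rho_ge0 sz1).
have hJ : Mcl Lam rho szJ l (m - rho) (fun x : J => v (sval x).1).
  exact: (@Mcl_reindex _ _ _ _ _ _ _ (fun x : J => (sval x).1) _ _ _ hv).
have qJ (x : J) : jp R (sval x).2 <= A * szJ x.
  apply: le_trans (hq _); rewrite ler_nat ltnS; exact: (svalP x).
have := IH J szJ (fun x => (sval x).2) A (m - rho) _ (fun x => sz1 _) qJ hJ.
have -> : m - rho - rho * N%:R = m - rho * N.+1%:R by rewrite -natr1; ring.
move=> H w wl s P; have [C hC] := H w wl s P.+1.
exists (A * `|C|) => i k.
set E := Lam k `^ _.
have E0 : 0 <= E by exact: powR_ge0.
pose L (f : 'rV[int]_n -> R[i]) := diffs s (thetas w f) k.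
have LD f g : L (fun k => f k + g k) = L f + L g by rewrite /L thetasD diffsD.
have L0 : L (fun _ => 0) = 0.
  have := LD (fun _ => 0) (fun _ => 0).
  rewrite (_ : (fun k : 'rV[int]_n => 0 + 0 : R[i]) = (fun _ => 0)); last first.
    by apply/funext => k'; rewrite addr0.
  by move/eqP; rewrite -subr_eq0 opprD addrA subrr sub0r oppr_eq0 => /eqP.
have inc j q' : (nrm q' <= nrm (q i))%N ->
    nm (L (taylor_rem N q' (diff1 j (u i)))) * sz i ^+ P.+1 <= `|C| * E.
  move=> hq'; have := hC (exist _ ((i, j), q') hq') k.
  by move=> /le_trans; apply; rewrite ler_wpM2r// ler_norm.
have sP : 0 <= sz i ^+ P.+1 by rewrite exprn_ge0// (le_trans ler01).
have path M : forall q', nrm q' = M -> (M <= nrm (q i))%N ->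
    nm (L (taylor_rem N.+1 q' (u i))) * sz i ^+ P.+1 <= M%:R * (`|C| * E).
  elim: M => [|M IHM] q' hq' hM.
    by rewrite (nrm_eq0 hq') taylor_rem_zero L0 nm0 !mul0r.
  have [j [q2 [hq2 hstep]]] := nrm_step hq'.
  have h1 := IHM q2 hq2 (ltnW hM).
  have h2 : nm (L (taylor_rem N.+1 q' (u i)))
      <= nm (L (taylor_rem N.+1 q2 (u i)))
         + nm (L (taylor_rem N (if q' == q2 + delta_mx 0 j then q2 else q')
                   (diff1 j (u i)))).
    case: eqP => [->|ne]; first by rewrite taylor_rem_step LD nmD.
    case: hstep => // ->; rewrite taylor_rem_step LD.
    set X := L (taylor_rem N.+1 _ _); set Y := L _.
    by rewrite -{1}(addrK Y X) nmB.
  have h3 : nm (L (taylor_rem N (if q' == q2 + delta_mx 0 j then q2 else q')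
                   (diff1 j (u i)))) * sz i ^+ P.+1 <= `|C| * E.
    by apply: inc; case: ifP => _; rewrite ?hq2 ?hq'// ltnW.
  have := ler_wpM2r sP h2; rewrite -natr1; lra.
(* The number of steps, at most [A * sz i], is paid for by the extra power of
   [sz i]. *)
have := path _ (q i) erefl (leqnn _).
rewrite exprSr => h.
have s0 : 0 < sz i by rewrite (lt_le_trans ltr01).
rewrite -(ler_pM2r s0) -[leLHS]mulrA (le_trans h)//.
have h4 : (nrm (q i))%:R <= A * sz i.
  by rewrite (le_trans _ (hq i))// ler_nat.
have := ler_wpM2r (mulr_ge0 (normr_ge0 C) E0) h4; lra.
Qed.

End TaylorRemainder.

(** * Symbols and their Fourier coefficients *)

Section SymbolsAndCoefficients.
Variables (R : realType) (n : nat).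
Implicit Types (p k l : 'rV[int]_n) (x : 'rV[R]_n) (w : seq 'I_n).
Implicit Types (s : 'rV[int]_n -> 'rV[R]_n -> R[i]).
Implicit Types (v : 'rV[int]_n -> 'rV[int]_n -> R[i]) (b : 'I_n -> nat).

Lemma mff_step p b j : (p 0 j)%:~R * mff R p b
  = mff R p (fun i => (b i + (i == j))%N) + (b j)%:R * mff R p b.
Proof.
rewrite /mff (bigD1 j)//= [X in _ = X + _](bigD1 j)//=.
rewrite eqxx addn1 ffS.
under [X in _ = _ * X + _]eq_bigr => i /negbTE -> do rewrite addn0.
by ring.
Qed.

(** Bounds against all falling factorials of the frequency amount to rapid
    decay, since [p_j] times a falling factorial is a combination of two of
    them. *)
Lemma falling_decay (I : Type) (X : 'rV[int]_n -> I -> R) (E : I -> R) :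
  (forall p i, 0 <= X p i) ->
  (forall b, exists C : R, forall p i, nm (mff R p b) * X p i <= C * E i) ->
  forall N, exists C : R, forall p i, X p i * jp R p ^+ N <= C * E i.
Proof.
move=> X0 h N.
suff [C hC] : exists C : R, forall p i,
    nm (mff R p (fun _ => 0%N)) * X p i * jp R p ^+ N <= C * E i.
  exists C => p i; have := hC p i; rewrite /mff big1 ?nm1 ?mul1r// => j _.
  exact: ff0.
(* The induction needs the bound for all falling factorials, since one more
   power of [p] raises their order. *)
move: (fun _ => 0%N); elim: N => [|N IH] b.
  by have [C hC] := h b; exists C => p i; rewrite expr0 mulr1.
have [C0 hC0] := IH b.
have /choice[C hC] : forall j, exists C : R, forall p i,
    nm (mff R p (fun i => (b i + (i == j))%N)) * X p i * jp R p ^+ N <= C * E i.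
  by move=> j; exact: IH.
exists (C0 + \sum_j (C j + (b j)%:R * C0)) => p i.
have Y0 : 0 <= X p i * jp R p ^+ N.
  by rewrite mulr_ge0// exprn_ge0// ltW// jp_gt0.
have -> : nm (mff R p b) * X p i * jp R p ^+ N.+1
  = nm (mff R p b) * (X p i * jp R p ^+ N)
    + \sum_j (absz (p 0 j))%:R * nm (mff R p b) * (X p i * jp R p ^+ N).
  by rewrite -!mulr_suml -natr_sum exprS /jp -natr1 -/(nrm p); ring.
rewrite mulrDl lerD//; first by rewrite mulrA.
rewrite mulr_suml; apply: ler_sum => j _.
have hj : (absz (p 0 j))%:R * nm (mff R p b)
    <= nm (mff R p (fun i => (b i + (i == j))%N)) + (b j)%:R * nm (mff R p b).
  by rewrite -nm_int -nmM mff_step (le_trans (nmD _ _))// nmM nm_nat.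
have := ler_wpM2r Y0 hj; have := hC j p i.
have := ler_wpM2l (ler0n R (b j)) (hC0 p i); lra.
Qed.

Lemma coef_diffs s w p k : (forall l, ccont (s l)) ->
  ccont (fun x => diffs w (fun l => s l x) k) /\
  diffs w (fun l => coef (s l) p) k = coef (fun x => diffs w (fun l => s l x) k) p.
Proof.
move=> cs; elim: w k => [|j w IH] k /=; first by split=> //; exact: cs.
have [c1 e1] := IH (k + delta_mx 0 j); have [c2 e2] := IH k.
by split; [exact: ccontB|rewrite /diff1 e1 e2 -coef_sub].
Qed.

Lemma coef_thetas s w p k : (forall l, ccont (s l)) ->
  thetas w (fun l => coef (s l) p) k = coef (fun x => thetas w (fun l => s l x) k) p.
Proof.
elim: w s => [//|j w IH] s cs /=.
have cs' l : ccont (fun x => theta j (fun l => s l x) l).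
  by apply: ccontZ; apply: ccontB.
rewrite -IH//; congr (thetas w _ k); apply/funext => l.
by rewrite /theta /diff1 -coef_sub// -coef_scale//; exact: ccontB.
Qed.

Lemma rapid_diffs v w k : (forall l, rapid (v^~ l)) -> rapid (fun p => diffs w (v p) k).
Proof.
move=> hv; elim: w k => [|j w IH] k //=.
have := rapidD (IH (k + delta_mx 0 j)) (rapidZ (-1) (IH k)).
by under [X in rapid X]eq_fun do rewrite mulN1r.
Qed.

Lemma synth_diffs v w k x : (forall l, rapid (v^~ l)) ->
  diffs w (fun l => synth (v^~ l) x) k = synth (fun p => diffs w (v p) k) x.
Proof.
move=> hv; elim: w k => [//|j w IH] k /=.
by rewrite /diff1 !IH -synthB//; exact: rapid_diffs.
Qed.

Lemma synth_thetas v w k x : (forall l, rapid (v^~ l)) ->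
  thetas w (fun l => synth (v^~ l) x) k = synth (fun p => thetas w (v p) k) x.
Proof.
elim: w v => [//|j w IH] v hv /=.
have hd l : rapid (fun p => diff1 j (v p) l) by exact: (rapid_diffs [:: j]).
rewrite -(IH (fun p => theta j (v p))); last by move=> l; exact: rapidZ.
congr (thetas w _ k); apply/funext => l.
rewrite /theta -[diff1 j _ l]/(diffs [:: j] _ l) synth_diffs//.
exact: (esym (synthZ _ _ (hd l))).
Qed.

Lemma smooth_diffs s w k : smooth_symbol s ->
  smooth (fun x => diffs w (fun l => s l x) k) /\
  Defs.periodic (fun x => diffs w (fun l => s l x) k).
Proof.
move=> hs; elim: w k => [|j w IH] k /=; first by have [] := hs k.
have [s1 p1] := IH (k + delta_mx 0 j); have [s2 p2] := IH k.
by split; [exact: smoothB|exact: periodicB].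
Qed.

Lemma subseq_rev_filter w : subseq w (rev (enum 'I_n)) ->
  w = rev [seq j <- enum 'I_n | j \in w].
Proof.
rewrite -filter_rev => /subseq_uniqP; apply.
by rewrite rev_uniq enum_uniq.
Qed.

Section Weighted.
Variables (mu : R) (Lam : 'rV[int]_n -> R).
Hypothesis hLam : weight_function mu Lam.
Variables (rho : R) (rho_ge0 : 0 <= rho).
Variable m : R.

Definition hat s p k : R[i] := coef (s k) p.

(** Integration by parts turns the bounds on falling derivatives into bounds of
    the coefficients against falling factorials of the frequency. *)
Lemma Scl_hat s : symbol_S rho Lam m s -> Scl Lam rho (@jp R n) m (hat s).
Proof.
move=> [hs hb] w N.
have cs l : ccont (s l) by have [_ /smooth_ccont] := hs l.
pose X p k := nm (diffs w (hat s p) k).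
have [] := @falling_decay _ X (fun k => Lam k `^ (m - rho * (size w)%:R)) _ _ N.
- by move=> p k; exact: nm_ge0.
- move=> b; have [a ha E] := diffs_mdiff R[i] w.
  have [C C0 hC] := hb a b.
  exists (2 * C) => p k; rewrite /X -nmM.
  have [c1 ->] := coef_diffs w p k cs.
  have [s1 p1] := smooth_diffs w k hs.
  have [<- cm] := mfalling_props b p s1 p1.
  rewrite -mulrA /coef -ha; apply: tint_le.
    by apply: ccontM => //; exact: ccont_cexpN.
  move=> x; rewrite nmM nm_cexp mul1r -lecR.
  have := hC k x; rewrite /symbol_deriv /symbol_diff normE.
  by under [X in mfalling_deriv b X]eq_fun do rewrite -E.
by move=> C hC; exists C.
Qed.

Lemma Mcl_hat s : symbol_M rho Lam m s ->
  Mcl Lam rho (@jp R n) (rev (enum 'I_n)) m (hat s).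
Proof.
move=> [hs hg] w wl; rewrite (subseq_rev_filter wl).
have cs l : ccont (s l) by have [_ /smooth_ccont] := hs l.
have := Scl_hat (hg (fun j => j \in w)).
congr Scl; apply/funext => p; apply/funext => k.
rewrite /hat coef_thetas//; congr (coef _ p); apply/funext => x.
by rewrite /symbol_diff mpow_mdiff.
Qed.

Lemma rapid_Scl v k : Scl Lam rho (@jp R n) m v -> rapid (v^~ k).
Proof.
by move=> h N; have [C hC] := h [::] N; eexists => p; exact: (hC p k).
Qed.

Lemma smooth_symbol_synth v : (forall k, rapid (v^~ k)) ->
  smooth_symbol (fun k => synth (v^~ k)).
Proof. by move=> h k; split; [exact: synth_periodic|exact: smooth_synth]. Qed.

(** The differences and falling derivatives act on the coefficients, where they
    cost at most a power of [jp p]. *)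
Lemma symbol_S_synth v : Scl Lam rho (@jp R n) m v ->
  symbol_S rho Lam m (fun k => synth (v^~ k)).
Proof.
move=> hv; have hr k := rapid_Scl k hv.
split; first exact: smooth_symbol_synth.
move=> a b.
have [A [M hA]] : pbound (fun p : 'rV[int]_n => mff R p b).
  by apply: pbound_prod => j; exact: pbound_ff.
have [w ha E] := mdiff_diffs R[i] a.
have [C hC] := hv w (M + 2 * n)%N.
(* The term 1 makes the constant positive. *)
exists (`|A * C| * 3 ^+ n + 1); first by rewrite ltr_wpDl// mulr_ge0// exprn_ge0.
move=> k x.
have -> : symbol_deriv b (symbol_diff a (fun k => synth (v^~ k))) k
   = synth (fun p => mff R p b * diffs w (v p) k).
  rewrite -mfalling_synth; last exact: rapid_diffs.
  rewrite /symbol_deriv /symbol_diff; congr mfalling_deriv.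
  by apply/funext => y; rewrite E synth_diffs.
rewrite normE lecR -ha.
set e := _ `^ _; have e0 : 0 <= e by exact: powR_ge0.
apply: (@le_trans _ _ (`|A * C| * e * 3 ^+ n)); last first.
  by rewrite mulrDl mul1r mulrAC lerDl.
apply: synth_le; apply: jp_dominated => p.
have A0 := pbound_ge0 hA.
have j0 : 0 <= nm (diffs w (v p) k) * jp R p ^+ (2 * n).
  by rewrite mulr_ge0 ?nm_ge0// exprn_ge0// ltW// jp_gt0.
have h1 := ler_wpM2r j0 (hA p); have h2 := ler_wpM2l A0 (hC p k).
have h3 := ler_wpM2r e0 (ler_norm (A * C)).
rewrite exprD -/e in h2; rewrite nmM.
move: (`|A * C|) h1 h2 h3 => AC; clearbody e; lra.
Qed.

Lemma symbol_M_synth v : Mcl Lam rho (@jp R n) (rev (enum 'I_n)) m v ->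
  symbol_M rho Lam m (fun k => synth (v^~ k)).
Proof.
move=> hv; have hr k := rapid_Scl k (Mcl_Scl hv).
split; first exact: smooth_symbol_synth.
move=> g; have := symbol_S_synth (hv (rev [seq j <- enum 'I_n | g j]) _).
have -> : (fun k : 'rV[int]_n => synth (fun p =>
      thetas (rev [seq j <- enum 'I_n | g j]) (v p) k)) =
    (fun k x => mpow R[i] k g * symbol_diff g (fun k => synth (v^~ k)) k x).
  apply/funext => k; apply/funext => x.
  by rewrite /symbol_diff mpow_mdiff -synth_thetas.
apply; rewrite -filter_rev; exact: filter_subseq.
Qed.

Lemma Mcl_conj (I : Type) (sz : I -> R) w (u : I -> 'rV[int]_n -> R[i]) :
  Mcl Lam rho sz w m u -> Mcl Lam rho sz w m (fun i k => (u i k)^*%C).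
Proof.
have conjB (z1 z2 : R[i]) : (z1 - z2)^*%C = z1^*%C - z2^*%C.
  by apply: complex_eq; rewrite !(cReJ, cImJ, cReD, cImD, cReN, cImN)// opprD.
have dJ j (f : 'rV[int]_n -> R[i]) :
    diff1 j (fun k => (f k)^*%C) = (fun k => (diff1 j f k)^*%C).
  by apply/funext => k; rewrite /diff1 conjB.
have tJ j (f : 'rV[int]_n -> R[i]) :
    theta j (fun k => (f k)^*%C) = (fun k => (theta j f k)^*%C).
  apply/funext => k; rewrite /theta dJ -[(k 0 j)%:~R](rmorph_int (real_complex R)).
  by apply: complex_eq; rewrite !(cReJ, cImJ, cReM, cImM) /=; ring.
have dsJ (s : seq 'I_n) (f : 'rV[int]_n -> R[i]) :
    diffs s (fun k => (f k)^*%C) = (fun k => (diffs s f k)^*%C).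
  by elim: s => //= j s ->; rewrite dJ.
have tsJ (s : seq 'I_n) : forall f : 'rV[int]_n -> R[i],
    thetas s (fun k => (f k)^*%C) = (fun k => (thetas s f k)^*%C).
  by elim: s => //= j s IH f; rewrite tJ IH.
move=> h w' /h {}h s' N; have [C hC] := h s' N; exists C => i k.
by rewrite tsJ dsJ nmJ.
Qed.

End Weighted.
End SymbolsAndCoefficients.

(** * The matrix of a pseudo-differential operator *)

Section PdoMatrix.
Variables (R : realType) (n : nat).
Implicit Types (p k l : 'rV[int]_n) (x : 'rV[R]_n).
Implicit Types (c f g : 'rV[int]_n -> R[i]).

Lemma rapid_decreasing f : rapid f <-> rapidly_decreasing f.
Proof.
have e0 k : 0 < 1 + enorm R k by rewrite ltr_pwDl// sqrtr_ge0.
split=> h N.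
  have [C hC] := h N; exists C => k.
  rewrite normE lecR ler_pdivlMr ?exprn_gt0//; apply: le_trans (hC k).
  rewrite ler_wpM2l ?nm_ge0// lerXn2r ?nnegrE ?(ltW (e0 _)) ?(ltW (jp_gt0 _ _))//.
  exact: enorm_le_jp.
have [C hC] := h N; exists (n.+1%:R ^+ N * C) => k.
have := hC k; rewrite normE lecR ler_pdivlMr ?exprn_gt0// => hk.
apply: (@le_trans _ _ (nm (f k) * (n.+1%:R * (1 + enorm R k)) ^+ N)).
  rewrite ler_wpM2l ?nm_ge0// lerXn2r ?nnegrE ?(ltW (jp_gt0 _ _))//.
    by rewrite mulr_ge0// ltW.
  exact: jp_le_enorm.
by rewrite exprMn mulrCA ler_wpM2l// exprn_ge0.
Qed.

Lemma fourier_synth f x : rapid f -> fourier f x = synth (fun l => f (- l)) x.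
Proof.
move=> /rapid_dominated[C hC].
have hd : dominated C (fun l => cexp2pi (dot l x) * f (- l)).
  by move=> l; rewrite nmM nm_cexp mul1r -weightN.
rewrite /synth -(csum_opp hd); apply: csum_eq => l.
by rewrite opprK dotNl.
Qed.

(** The matrix of a pseudo-differential operator in terms of the Fourier
    coefficients of its symbol. *)
Lemma pdo_synth s c f k : rapid c -> s k = synth c -> rapid f ->
  pdo s f k = csum (fun l => c (l - k) * f l).
Proof.
move=> hc sk hf; rewrite /pdo sk.
have [C hC] := rapid_dominated hc; have [D hD] := rapid_dominated hf.
have E x : cexp2pi (dot k x) * synth c x * fourier f x
    = csum (fun l => cexp2pi (dot k x) * synth c x * (cexp2pi (- dot l x) * f l)).
  rewrite -(@csumZ _ _ D)//.
  by move=> l; rewrite nmM (nm_cexp (- dot l x)) mul1r.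
have cs := ccont_synth hc.
have ce : ccont (fun x => cexp2pi (dot k x) * synth c x).
  by apply: ccontM => //; exact: ccont_cexp.
rewrite (eq_tint E) (@tint_csum _ _ (C * 3 ^+ n * D)); first last.
- under eq_fun do rewrite -E.
  apply: ccontM => //.
  have -> : fourier f = synth (fun l => f (- l)).
    by apply/funext => x; exact: fourier_synth.
  apply: ccont_synth => N; have [B hB] := hf N; exists B => l.
  by rewrite -jpN.
- move=> x l; rewrite !nmM (nm_cexp (dot k x)) (nm_cexp (- dot l x)) !mul1r.
  by rewrite -mulrA ler_pM ?nm_ge0// synth_le.
- move=> l; apply: ccontM => //.
  by apply: ccontM; [exact: ccont_cexpN|exact: ccont_cst].
apply: csum_eq => l; rewrite -[in RHS](coef_synth (l - k) hc) mulrC /coef -tintZ.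
  apply: eq_tint => x; rewrite dotDl dotNl opprD opprK cexpD.
  by ring.
by apply: ccontM => //; exact: ccont_cexpN.
Qed.

End PdoMatrix.

(** * The adjoint and its expansion *)

Section Adjoint.
Variables (R : realType) (n : nat) (mu : R) (Lam : 'rV[int]_n -> R).
Hypothesis hLam : weight_function mu Lam.
Variables (rho : R) (rho_ge0 : 0 <= rho).
Variables (m : R) (sigma : 'rV[int]_n -> 'rV[R]_n -> R[i]).
Hypothesis hsigma : symbol_M rho Lam m sigma.
Implicit Types (p k l : 'rV[int]_n) (x : 'rV[R]_n).

(** The Fourier coefficients of the conjugate symbol. *)
Definition conj_hat p k : R[i] := (hat sigma (- p) k)^*%C.

(** The matrix of the adjoint is the conjugate transpose; in terms of Fourier
    coefficients this shifts those of the conjugate symbol by the frequency. *)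
Definition adjoint_symbol k x : R[i] :=
  synth (fun p => translate p (conj_hat p) k) x.

Lemma Mcl_conj_hat : Mcl Lam rho (@jp R n) (rev (enum 'I_n)) m conj_hat.
Proof.
have h := Mcl_conj (Mcl_hat hsigma).
have := @Mcl_reindex _ _ _ _ _ _ _ (fun p : 'rV[int]_n => - p) _ _ _ h.
by congr Mcl; apply/funext => p /=; rewrite jpN.
Qed.

Lemma rapid_conj_hat k : rapid (conj_hat^~ k).
Proof. exact: rapid_Scl (Mcl_Scl Mcl_conj_hat). Qed.

Lemma rapid_hat k : rapid (fun p => hat sigma p k).
Proof.
move=> N; have [C hC] := rapid_conj_hat k N; exists C => p.
by have := hC (- p); rewrite /conj_hat opprK nmJ jpN.
Qed.

Lemma sigma_synth k : sigma k = synth (fun p => hat sigma p k).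
Proof.
have [hs hg] := hsigma; have [ps ss] := hs k.
(* The symbol bound without differences and derivatives says that [sigma k] is
   bounded. *)
have [_ /(_ (fun _ => 0%N) (fun _ => 0%N))[C _ hC]] := hg (fun _ => false).
apply: (@fourier_inversion _ _ _ (C * Lam k `^ (m - rho * (mlen (fun _ : 'I_n => 0%N))%:R))).
- exact: smooth_ccont.
- by [].
- move=> x; have := hC k x; rewrite normE lecR; apply: le_trans.
  rewrite le_eqVlt; apply/orP; left; apply/eqP; congr nm.
  rewrite /symbol_deriv /mfalling_deriv /symbol_diff.
  have -> : forall h : 'rV[R]_n -> R[i], foldr (fun j g => falling_deriv j 0 g) h (enum 'I_n) = h.
    by move=> h; elim: (enum 'I_n) => //= j s ->.
  by rewrite !mdiff0// /mpow big1 ?mul1r.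
- exact: rapid_hat.
Qed.

Lemma symbol_conj_synth k : symbol_conj sigma k = synth (conj_hat^~ k).
Proof.
apply/funext => x; rewrite /symbol_conj sigma_synth.
exact: synth_conj (rapid_dominated (rapid_hat k)).
Qed.

Lemma Mcl_conj_hat_rem N : Mcl Lam rho (@jp R n) (rev (enum 'I_n))
  (m - rho * N%:R) (fun p => taylor_rem N p (conj_hat p)).
Proof.
apply: (@Mcl_taylor_rem _ _ _ _ hLam _ rho_ge0 N _ _ id 1 m _ conj_hat).
- exact: jp_ge1.
- by move=> p; rewrite mul1r.
- exact: Mcl_conj_hat.
Qed.

Lemma rapid_translate k : rapid (fun p => translate p (conj_hat p) k).
Proof.
have := rapid_Scl k (Mcl_Scl (Mcl_conj_hat_rem 0)).
by under [X in rapid X]eq_fun do rewrite taylor_rem_order0.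
Qed.

Lemma rapid_mbin_mdiff k (a : 'I_n -> nat) :
  rapid (fun p => mff R p a * mdiff a (conj_hat p) k).
Proof.
apply: rapid_pbound; first by apply: pbound_prod => j; exact: pbound_ff.
have [w _ E] := mdiff_diffs R[i] a.
have := rapid_diffs w k rapid_conj_hat.
by under [X in rapid X -> _]eq_fun do rewrite -E.
Qed.

Lemma adjoint_expansion_synth N k x : adjoint_expansion N sigma k x =
  synth (fun p => \sum_(a : {ffun 'I_n -> 'I_N} | (mlen (box_index a) < N)%N)
     mbin R p (box_index a) * mdiff (box_index a) (conj_hat p) k) x.
Proof.
rewrite synth_sum; last first.
  move=> a; have := rapidZ (mfact (box_index a))%:R^-1 (rapid_mbin_mdiff k (box_index a)).
  by under [X in rapid X -> _]eq_fun do rewrite mulrA.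
apply: eq_bigr => a _; move: (box_index a) => {}a.
have E1 l : symbol_deriv a (symbol_conj sigma) l
    = synth (fun p => mff R p a * conj_hat p l).
  by rewrite /symbol_deriv symbol_conj_synth mfalling_synth//; exact: rapid_conj_hat.
have hr l : rapid (fun p => mff R p a * conj_hat p l).
  apply: rapid_pbound; last exact: rapid_conj_hat.
  by apply: pbound_prod => j; exact: pbound_ff.
have [w _ E] := mdiff_diffs R[i] a.
rewrite /symbol_diff E.
under [X in diffs _ X]eq_fun do rewrite E1.
rewrite (synth_diffs w k x hr) -synthZ; last exact: rapid_diffs.
by apply: eq_synth => p; rewrite diffsZ -E mulrA.
Qed.

(** The terms of the expansion are those of Newton's formula for the shifted
    coefficients, because [mff p a] is the eigenvalue of [mfalling_deriv a]. *)
Lemma adjoint_remainder N :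
  (fun k x => adjoint_symbol k x - adjoint_expansion N sigma k x)
  = (fun k => synth (fun p => taylor_rem N p (conj_hat p) k)).
Proof.
apply/funext => k; apply/funext => x.
rewrite adjoint_expansion_synth /adjoint_symbol -synthB//.
  exact: rapid_translate.
apply: rapid_sum => a.
have := rapidZ (mfact (box_index a))%:R^-1 (rapid_mbin_mdiff k (box_index a)).
by under [X in rapid X -> _]eq_fun do rewrite mulrA.
Qed.

Lemma adjoint_symbol_M : symbol_M rho Lam m adjoint_symbol.
Proof.
have := symbol_M_synth (Mcl_conj_hat_rem 0); rewrite mulr0 subr0.
congr symbol_M; apply/funext => k; apply/funext => x.
by apply: eq_synth => p; rewrite taylor_rem_order0.
Qed.

Lemma conj_hat_bound N : exists C P M, [/\ 0 <= C * P &
  forall p k, nm (conj_hat p k) * jp R p ^+ N <= C * P * jp R k ^+ M].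
Proof.
have [C hC] := Mcl_Scl Mcl_conj_hat [::] N.
have [P [M [P0 hP]]] := Lam_poly hLam (m - rho * 0).
have C0 : 0 <= C.
  have := le_trans (mulr_ge0 (nm_ge0 _) _) (hC 0 0).
  rewrite pmulr_lge0 ?powR_gt0 ?(Lam_gt0 hLam)//; apply.
  by rewrite exprn_ge0// ltW// jp_gt0.
exists C, P, M; split; first exact: mulr_ge0.
by move=> p k; rewrite (le_trans (hC p k))// -mulrA ler_wpM2l.
Qed.

Lemma pdo_adjoint g k : rapid g ->
  pdo adjoint_symbol g k = csum (fun l => conj_hat (l - k) l * g l).
Proof.
move=> hg; rewrite (pdo_synth (c := fun p => translate p (conj_hat p) k))//.
- by apply: csum_eq => l; rewrite /translate subrKC.
- exact: rapid_translate.
Qed.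

(** The decay of the matrix off the diagonal transports the decay of [g] from
    [l] to [k], since [jp k <= jp (l - k) * jp l]. *)
Lemma rapid_pdo_adjoint g : rapid g -> rapid (pdo adjoint_symbol g).
Proof.
move=> hg N; have [C [P [M [CP0 hC]]]] := conj_hat_bound N.
have [D hD] := hg (N + M + 2 * n)%N.
exists (C * P * D * 3 ^+ n) => k; rewrite pdo_adjoint//.
have j0 p i : 0 <= jp R p ^+ i by rewrite exprn_ge0// ltW// jp_gt0.
have jk : 0 < jp R k ^+ N by rewrite exprn_gt0// jp_gt0.
rewrite -ler_pdivlMr// mulrAC.
apply: csum_le; apply: jp_dominated => l.
rewrite ler_pdivlMr// nmM.
have h1 : jp R k ^+ N <= jp R (l - k) ^+ N * jp R l ^+ N.
  rewrite -exprMn lerXn2r ?nnegrE ?mulr_ge0 ?(ltW (jp_gt0 _ _))//.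
  by have := jpD R l (- (l - k)); rewrite jpN opprB subrKC mulrC.
have a1 := ler_wpM2l (mulr_ge0 (mulr_ge0 (nm_ge0 (conj_hat (l - k) l))
  (nm_ge0 (g l))) (j0 l (2 * n)%N)) h1.
have a2 := ler_wpM2r (mulr_ge0 (mulr_ge0 (nm_ge0 (g l)) (j0 l (2 * n)%N)) (j0 l N))
  (hC (l - k) l).
have a3 := ler_wpM2l CP0 (hD l); rewrite (exprD _ (N + M)) exprD in a3.
by move: (C * P) a2 a3 => CP a2 a3; lra.
Qed.

(** Both inner products are the same absolutely convergent double sum. *)
Lemma is_adjoint_symbol : is_adjoint (pdo sigma) (pdo adjoint_symbol).
Proof.
split=> [g /rapid_decreasing hg|f g /rapid_decreasing hf /rapid_decreasing hg].
  exact/rapid_decreasing/rapid_pdo_adjoint.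
have [C [P [M [CP0 hC]]]] := conj_hat_bound 0.
have hhat p k : nm (hat sigma p k) <= C * P * jp R k ^+ M.
  by have := hC (- p) k; rewrite /conj_hat opprK nmJ expr0 mulr1.
have [D hD] := rapid_dominated hf.
have [E hE] : exists E, forall k, jp R k ^+ M * nm (g k) <= E * weight R k.
  have [E hE] := hg (M + 2 * n)%N; exists E => k.
  have := @jp_dominated R n (fun k => (jp R k ^+ M)%:C * g k) E.
  move=> /(_ _ k); rewrite nmM nm_real ger0_norm; last first.
    by rewrite exprn_ge0// ltW// jp_gt0.
  apply=> l; rewrite nmM nm_real ger0_norm ?exprn_ge0 ?(ltW (jp_gt0 _ _))//.
  by have := hE l; rewrite exprD; lra.
pose F k l := hat sigma (l - k) k * f l * (g k)^*%C.
have hF k l : nm (F k l) <= C * P * E * D * weight R k * weight R l.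
  rewrite !nmM nmJ.
  have b1 := ler_wpM2r (mulr_ge0 (nm_ge0 (f l)) (nm_ge0 (g k))) (hhat (l - k) k).
  have b2 := ler_wpM2l CP0 (ler_pM (mulr_ge0 (exprn_ge0 M (ltW (jp_gt0 R k))) (nm_ge0 (g k)))
    (nm_ge0 (f l)) (hE k) (hD l)).
  by move: (C * P) b1 b2 => CP b1 b2; lra.
have jM k : 0 <= jp R k ^+ M by rewrite exprn_ge0// ltW// jp_gt0.
transitivity (csum (fun k => csum (F k))).
  apply: csum_eq => k.
  rewrite (pdo_synth (rapid_hat k) (sigma_synth k) hf).
  rewrite -(@csumZr R n (C * P * jp R k ^+ M * D))//.
  move=> l; rewrite nmM -[leRHS]mulrA.
  exact: ler_pM (nm_ge0 _) (nm_ge0 _) (hhat _ k) (hD l).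
rewrite (csum_fubini hF); apply: csum_eq => l.
rewrite pdo_adjoint//.
transitivity (f l * (csum (fun k => conj_hat (k - l) k * g k))^*%C); last by [].
rewrite -csumJ -(@csumZ R n (C * P * E)).
  apply: csum_eq => k; rewrite /F /conj_hat opprB.
  by apply: complex_eq; rewrite !(cReJ, cImJ, cReM, cImM); ring.
move=> k; rewrite nmJ nmM.
have b1 := ler_wpM2r (nm_ge0 (g k)) (hhat (l - k) k).
have b2 := ler_wpM2l CP0 (hE k).
rewrite /conj_hat opprB nmJ; move: (C * P) b1 b2 => CP b1 b2; lra.
Qed.

End Adjoint.

Theorem theorem4p3 (R : realType) (n : nat)
    (mu : R) (Lam : 'rV[int]_n -> R) (hLam : weight_function mu Lam)
    (rho : R) (hrho0 : 0 < rho) (hrho : rho <= mu^-1)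
    (m : R) (sigma : 'rV[int]_n -> 'rV[R]_n -> R[i])
    (hsigma : symbol_M rho Lam m sigma) :
  exists sigma_star : 'rV[int]_n -> 'rV[R]_n -> R[i],
    [/\ symbol_M rho Lam m sigma_star,
        is_adjoint (pdo sigma) (pdo sigma_star) &
        forall N : nat,
          symbol_M rho Lam (m - rho * N%:R)
            (fun k x => sigma_star k x - adjoint_expansion N sigma k x)].
Proof.
exists (adjoint_symbol sigma); split.
- exact: (adjoint_symbol_M hLam (ltW hrho0) hsigma).
- exact: (is_adjoint_symbol hLam (ltW hrho0) hsigma).
- move=> N; rewrite (adjoint_remainder hLam (ltW hrho0) hsigma).
  exact: (symbol_M_synth (Mcl_conj_hat_rem hLam (ltW hrho0) hsigma N)).
Qed.
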